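(* Suppose that $\mathcal{P}$ is a polynomial functor of degree $d$. (1) The action of $\operatorname{GL}_n$ on $H^j\left(\mathbb{P}^{n-1},\mathcal{P}(\Omega)\right)$ is trivial for all $j<n-1$. (2) If $n-1\geq d$ then the action of $\operatorname{GL}_n$ on $H^{n-1}\left(\mathbb{P}^{n-1},\mathcal{P}(\Omega)\right)$ is trivial. (3) If $e<0$ then $H^j\left(\mathbb{P}^{n-1},\mathcal{P}(\Omega)\otimes\mathcal{O}_{\mathbb{P}^{n-1}}(e)\right)=0$ for all $j<n-1$. (4) If $d-n+1\leq e\leq -1$ then $H^{n-1}\left(\mathbb{P}^{n-1},\mathcal{P}(\Omega)\otimes\mathcal{O}_{\mathbb{P}^{n-1}}(e)\right)=0$.
   Context: $\mathbf{k}$ is an algebraically closed field. A polynomial functor of degree $d$ is a functor $\mathcal{P}$ from finite dimensional $\mathbf{k}$-vector spaces to itself such that the maps $\operatorname{Hom}(V,W)\to\operatorname{Hom}(\mathcal{P}(V),\mathcal{P}(W))$ are polynomial and $\mathcal{P}(c\cdot\mathrm{id}_V)=c^d\cdot\mathrm{id}_{\mathcal{P}(V)}$ for all $c\in\mathbf{k}$. Such functors apply to vector bundles. $\Omega$ is the cotangent sheaf of $\mathbb{P}^{n-1}=\operatorname{Proj}(\operatorname{Sym}V)$, $V=\mathbf{k}^n=H^0(\mathbb{P}^{n-1},\mathcal{O}(1))$, with its natural $\operatorname{GL}_n$-equivariant structure as the kernel in the Euler sequence $0\to\Omega\to V\otimes\mathcal{O}(-1)\to\mathcal{O}\to 0$.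 *)

(* Defs.v *)
From HB Require Import structures.
From mathcomp Require Import all_boot all_order all_algebra.
From mathcomp Require Import mpoly.

Set Implicit Arguments.
Unset Strict Implicit.
Unset Printing Implicit Defensive.

Import GRing.Theory.
Local Open Scope ring_scope.

(** * Polynomial functors *)

(* [k] is meant to be infinite, so that polynomial functions determine
   polynomials and these are also the strict polynomial functors. *)
Definition polynomial_map (k : fieldType) (A B : vectType k) (f : A -> B) :=
  forall phi : 'Hom(B, k^o),
  exists p : {mpoly k[\dim (fullv : {vspace A})]},
  forall a, phi (f a) = p.@[fun i => coord (vbasis fullv) i a].

Record poly_functor (k : fieldType) (d : nat) := PolyFunctor {
  pobj :> vectType k -> vectType k;
  pmap : forall A B : vectType k, 'Hom(A, B) -> 'Hom(pobj A, pobj B);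
  pmap_id : forall A : vectType k, @pmap A A \1%VF = \1%VF;
  pmap_comp : forall (A B C : vectType k) (f : 'Hom(B, C)) (g : 'Hom(A, B)),
    pmap (f \o g)%VF = (pmap f \o pmap g)%VF;
  pmap_poly : forall A B, polynomial_map (@pmap A B);
  pmap_scale : forall (A : vectType k) (c : k),
    @pmap A A (c *: \1%VF) = c ^+ d *: \1%VF
}.

(** * Projective space *)

(* With V = k^n realised as column vectors, the closed points of
   P^{n-1} = Proj (Sym V) are the nonzero row vectors x (linear forms on V) up
   to scaling; v : V is the linear function x |-> x *m v.  A subset of P^{n-1}
   is represented by the cone over it, a scaling-invariant set of nonzero row
   vectors. *)
Section ProjectiveSpace.
Variables (k : fieldType) (n : nat).

Definition region := 'rV[k]_n -> Prop.

Definition sub_region (U W : region) := forall x, U x -> W x.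

Definition peval (f : {mpoly k[n]}) (x : 'rV[k]_n) : k := f.@[x 0].

(* Invariance under scaling follows from the homogeneity of [f]. *)
Definition zopen (U : region) :=
  forall x, U x -> x != 0 /\
    exists m (f : {mpoly k[n]}),
      [/\ f \is m.-homog, peval f x != 0
        & forall y, y != 0 -> peval f y != 0 -> U y].

Definition zcover (I : Type) (U : I -> region) :=
  (forall i, zopen (U i)) /\ (forall x, x != 0 -> exists i, U i x).

(* Sections of O(e) over U, as homogeneous functions of degree e on the cone.
   Here and below, only the values on U of a function matter. *)
Definition O_section (e : int) (U : region) (f : 'rV[k]_n -> k) :=
  forall x, U x -> exists W : region, [/\ zopen W, W x, sub_region W U &
    exists p q (a b : {mpoly k[n]}),
      [/\ a \is p.-homog, b \is q.-homog, p%:Z - q%:Z = e &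
        forall y, W y -> peval b y != 0 /\ f y = peval a y / peval b y]].

(* Sections of M (x) O(e) over U. *)
Definition OM_section (M : vectType k) (e : int) (U : region)
    (f : 'rV[k]_n -> M) :=
  forall phi : 'Hom(M, k^o), O_section e U (fun x => phi (f x)).

(** * The cotangent sheaf and polynomial functors of it *)

(* Kernel of the Euler map V (x) O(-1) -> O. *)
Definition Omega_section (U : region) (s : 'rV[k]_n -> 'cV[k]_n) :=
  OM_section (-1) U s /\ (forall x, U x -> x *m s x = 0).

(* The columns of [t] form a basis of Omega restricted to W: a trivialization
   O^r ~ Omega over W. *)
Definition Omega_frame (W : region) (r : nat) (t : 'rV[k]_n -> 'M[k]_(n, r)) :=
  [/\ forall j, Omega_section W (fun x => col j (t x)),
      forall (U : region) s, zopen U -> sub_region U W -> Omega_section U s ->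
        exists a : 'rV[k]_n -> 'cV[k]_r,
          OM_section 0 U a /\ (forall x, U x -> s x = t x *m a x)
    & forall (U : region) (a : 'rV[k]_n -> 'cV[k]_r),
        zopen U -> sub_region U W -> OM_section 0 U a ->
        (forall x, U x -> t x *m a x = 0) -> forall x, U x -> a x = 0].

(* Sections of P(Omega) (x) O(e) over U.  A trivialization t : O^r ~ Omega
   induces P(k^r) (x) O(e) ~ P(Omega) (x) O(e).  As Omega is locally a direct
   summand of V (x) O(-1), P(Omega) (x) O(e) is a subsheaf of
   P(V (x) O(-1)) (x) O(e) = P(V) (x) O(e - d); sections are thus taken as
   P(V)-valued functions, and the induced trivialization is
   h |-> (x |-> P(t x) (h x)). *)
Definition POmega_section (d : nat) (P : poly_functor k d) (e : int)
    (U : region) (s : 'rV[k]_n -> P 'cV[k]_n) :=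
  forall x, U x -> exists (W : region) (r : nat)
      (t : 'rV[k]_n -> 'M[k]_(n, r)) (h : 'rV[k]_n -> P 'cV[k]_r),
    [/\ zopen W, W x, sub_region W U, Omega_frame W t &
      OM_section e W h /\
      forall y, W y -> s y = pmap P (linfun (mulmx (t y))) (h y)].

End ProjectiveSpace.

(** * Čech cohomology *)

(* Cohomology of a sheaf on P^{n-1} as in Serre's FAC: the colimit, over all
   open covers ordered by refinement, of the cohomology of the Čech complex of
   all (not necessarily alternating) cochains.  The sheaf is given by the
   predicate [F U s], "s restricts to a section over U", on functions with
   values in a fixed module M. *)
Section Cohomology.
Variables (k : fieldType) (n : nat) (M : lmodType k).
Variable F : region k n -> ('rV[k]_n -> M) -> Prop.

Definition cochain (I : Type) (q : nat) :=
  {ffun 'I_q.+1 -> I} -> 'rV[k]_n -> M.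

Definition inter (I : Type) (U : I -> region k n) q (s : {ffun 'I_q.+1 -> I})
    : region k n :=
  fun x => forall i, U (s i) x.

Definition is_cochain (I : Type) (U : I -> region k n) q (c : cochain I q) :=
  forall s, F (inter U s) (c s).

Definition cochain_eq (I : Type) (U : I -> region k n) q (c c' : cochain I q) :=
  forall s x, inter U s x -> c s x = c' s x.

Definition coboundary (I : Type) q (c : cochain I q) : cochain I q.+1 :=
  fun s x => \sum_(i < q.+2) (-1) ^+ i *: c [ffun j => s (lift i j)] x.

Definition is_cocycle (I : Type) (U : I -> region k n) q (c : cochain I q) :=
  is_cochain U c /\ cochain_eq U (coboundary c) (fun _ _ => 0).

Definition is_coboundary (I : Type) (U : I -> region k n) q :
    cochain I q -> Prop :=
  match q with
  | 0 => fun c => cochain_eq U c (fun _ _ => 0)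
  | q'.+1 => fun c => exists b : cochain I q',
                        is_cochain U b /\ cochain_eq U c (coboundary b)
  end.

(* Raw representatives of classes in H^q; those satisfying [is_class],
   considered up to [same_class], are the elements of H^q. *)
Record cech_rep (q : nat) := CechRep {
  cidx : Type;
  ccov : cidx -> region k n;
  ccoch : cochain cidx q
}.

Definition is_class q (z : cech_rep q) :=
  zcover (@ccov q z) /\ is_cocycle (@ccov q z) (@ccoch q z).

Definition refine (I J : Type) (r : J -> I) q (c : cochain I q) : cochain J q :=
  fun s => c [ffun i => r (s i)].

Definition same_class q (z z' : cech_rep q) :=
  exists (J : Type) (W : J -> region k n)
         (r : J -> cidx z) (r' : J -> cidx z'),
    [/\ zcover W,
        forall j, sub_region (W j) (ccov (r j)),
        forall j, sub_region (W j) (ccov (r' j))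
      & is_coboundary W (fun s x =>
          refine r (@ccoch q z) s x - refine r' (@ccoch q z') s x)].

Definition zero_class q : cech_rep q :=
  CechRep (fun (_ : unit) x => x != 0) (fun _ _ => 0).

Definition cohomology_vanishes q :=
  forall z : cech_rep q, is_class z -> same_class z (zero_class q).

End Cohomology.

(* For g in GL_n, (g s)(x) = P(g) (s (x g)): P(g) comes from the action of g on
   V, and x |-> x g is the inverse of the contragredient action on points. It
   maps sections over U to sections over g U = {x | x g \in U}. *)
Definition gl_act (k : fieldType) (n d : nat) (P : poly_functor k d)
    (g : 'M[k]_n) q (z : cech_rep n (P 'cV[k]_n) q) :
    cech_rep n (P 'cV[k]_n) q :=
  CechRep (fun i x => ccov (c := z) i (x *m g))
    (fun s x => pmap P (linfun (mulmx g)) (ccoch (c := z) s (x *m g))).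

Definition POmega_cohomology_vanishes (k : fieldType) (n d : nat)
    (P : poly_functor k d) (e : int) (q : nat) :=
  cohomology_vanishes (@POmega_section k n d P e) q.

Definition POmega_gl_trivial (k : fieldType) (n d : nat)
    (P : poly_functor k d) (q : nat) :=
  forall g : 'M[k]_n, g \in unitmx ->
  forall z : cech_rep n (P 'cV[k]_n) q,
    is_class (@POmega_section k n d P 0) z ->
    same_class (@POmega_section k n d P 0) (gl_act g z) z.

(* Main.v *)
(* A section of P(Omega)(e) over U is a regular function s : U -> P(V),
   homogeneous of degree e - d, with s x in P(ker x) for all x.

   Every class is represented by a cocycle on the standard cover D(x_0), ...,
   D(x_(n-1)): by the Nullstellensatz a cover has a finite subcover by basic
   open sets with partitions of unity over each D(x_j), and averaging over the
   indices with these weights is a cochain map.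

   A cocycle c on the standard cover splits into eigenvectors for the torus.
   Suppose that c has weight b < 0 for the j-th factor.  Then c s vanishes
   unless s contains j, and over D(x_j) the projection V -> V / V_j along the
   basis vector e_j identifies P(Omega)(e) with P(V / V_j) (x) O(e - d), so c
   amounts to Laurent polynomials of degree e - d and of degree b < 0 in x_j.
   A monomial with only negative exponents needs every coordinate to be
   inverted, so q >= n - 1, and its degree is at most - n.  When one of these is
   excluded, each monomial contains some x_l, l <> j, with nonnegative exponent,
   and coning with l contracts the part of the complex on that monomial.

   So only nonnegative weights survive.  They add up to e, so for e < 0 nothing
   is left, and for e = 0 the torus acts trivially.  In the latter case the
   elements of GL_n acting trivially form a normal subgroup containing the
   diagonal pseudo-reflections, hence all of GL_n. *)

From HB Require Import structures.
From mathcomp Require Import all_boot all_order all_algebra.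
From mathcomp Require Import mpoly zify ring.
From Stdlib Require Import Classical FunctionalExtensionality.
Require Import Defs.

Set Implicit Arguments.
Unset Strict Implicit.
Unset Printing Implicit Defensive.

Import Order.TTheory GRing.Theory Num.Theory.
Local Open Scope ring_scope.

(** * Nullstellensatz *)

(** [POmega_sectionP] trades the frames of the definition for homogeneous functions of degree e - d
    satisfying a pointwise condition, so that all later arguments concern functions with values in
    the fixed space P(V). Such functions are fractions only locally; the Nullstellensatz gives them
    common denominators and thereby makes them Laurent polynomials.

    Weight components come from interpolation in t: each is a fixed linear combination of torus
    translates of the cocycle, hence again a cocycle, and still an eigenvector for the coordinates
    treated before.

    The chart at j exists only where x_j is nonzero, whereas the contraction must also produce
    sections on intersections not involving j. This is why the cone index l has to differ from j:
    the contracted cochain then vanishes on all intersections without j, and elsewhere it can be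
    lifted back by the projection onto ker x along e_j.

    The weights add up to e because a scalar u acts by u^d through P and by u^(e-d) through
    homogeneity. *)

Section Nullstellensatz.
Variable k : closedFieldType.

Lemma exists_nonroot (p : {poly k}) : p != 0 -> exists t, t != 0 /\ ~~ root p t.
Proof.
move=> p0; have pX0 : p * 'X != 0 by rewrite mulf_neq0 ?polyX_eq0.
have /closed_nonrootP[t] := pX0; rewrite rootM negb_or rootX => /andP[pt t0].
by exists t.
Qed.

(** Makes the substitution x_i = t^(B^i) injective on monomials with exponents below B. *)
Lemma digits_inj B n (u v : 'I_n -> nat) :
  (forall i, u i < B)%N -> (forall i, v i < B)%N ->
  (\sum_i u i * B ^ i = \sum_i v i * B ^ i)%N -> u =1 v.
Proof.
elim: n u v => [|n IH] u v uB vB; first by move=> _ [].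
rewrite !big_ord_recl !muln1.
under eq_bigr do rewrite expnS mulnCA.
under [X in _ = (_ + X)%N]eq_bigr do rewrite expnS mulnCA.
rewrite -!big_distrr /= => E.
have B0 : (0 < B)%N by apply: leq_trans (uB ord0).
have E0 : u ord0 = v ord0.
  have := congr1 (fun x => x %% B)%N E.
  by rewrite ![(u _ + _)%N]addnC ![(v _ + _)%N]addnC ![(B * _)%N]mulnC !modnMDl !modn_small.
move: E; rewrite E0 => /addnI /eqP; rewrite eqn_pmul2l // => /eqP E.
have {}IH := IH _ _ (fun i => uB (lift ord0 i)) (fun i => vB (lift ord0 i)) E.
by move=> i; case: (unliftP ord0 i) => [j|] ->.
Qed.

(** Kronecker substitution: with B above every exponent of f, x_i = t^(B^i) sends distinct monomials
    to distinct powers of t, so f becomes a nonzero polynomial in t. A nonzero t gives a point of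
    the torus, where one may divide by coordinates. *)
Lemma mpoly_nonvanishing n (f : {mpoly k[n]}) : f != 0 ->
  exists x : 'I_n -> k, (forall i, x i != 0) /\ f.@[x] != 0.
Proof.
move=> f0.
pose B := msize f; pose kap (m : 'X_{1..n}) := (\sum_i m i * B ^ i)%N.
have kap_inj : {in msupp f &, injective kap}.
  have h m : m \in msupp f -> forall i, (m i < B)%N.
    move=> /msize_mdeg_lt; rewrite mdegE => mB i; apply: leq_ltn_trans mB.
    by rewrite (bigD1 i) //= leq_addr.
  by move=> m m' /h mB /h mB' /(digits_inj mB mB')/mnmP.
pose p : {poly k} := \sum_(m <- msupp f) f@_m *: 'X^(kap m).
have p0 : p != 0.
  apply/eqP => /(congr1 (fun q : {poly k} => q`_(kap (mlead f)))).
  rewrite coef0 coef_sum (bigD1_seq (mlead f)) ?msupp_uniq ?mlead_supp //=.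
  rewrite coefZ coefXn eqxx mulr1 big_seq_cond big1 => [|m /andP[mf ml]].
    by rewrite addr0 => /eqP; rewrite mleadc_eq0 (negPf f0).
  rewrite coefZ coefXn; case: eqP => [|_]; rewrite ?mulr0 // => /kap_inj e.
  by rewrite e ?mlead_supp ?eqxx in ml.
have [t [t0 pt]] := exists_nonroot p0.
exists (fun i => t ^+ (B ^ i)); split=> [i|]; first by rewrite expf_neq0.
suff -> : f.@[fun i => t ^+ (B ^ i)] = p.[t] by [].
rewrite mevalE horner_sum; apply: eq_bigr => m _.
rewrite hornerZ hornerXn /kap expr_sum; congr (_ * _).
by apply: eq_bigr => i _; rewrite mulnC exprM.
Qed.

Lemma mpoly_vanish n (f : {mpoly k[n]}) :
  (forall x, (forall i, x i != 0) -> f.@[x] = 0) -> f = 0.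
Proof.
move=> h; apply/eqP/negPn/negP => /mpoly_nonvanishing [x [x0]].
by rewrite h ?eqxx.
Qed.

(** Ideals are predicates in [Prop], since those needed below (denominators of a function,
    combinations of an infinite family) are given by existence statements. *)
Definition ideal (R : comNzRingType) (J : R -> Prop) :=
  [/\ J 0, forall a b, J a -> J b -> J (a + b) & forall r a, J a -> J (r * a)].

Lemma idealN (R : comNzRingType) (J : R -> Prop) a : ideal J -> J a -> J (- a).
Proof. by case=> _ _ JM Ja; rewrite -mulN1r; apply: JM. Qed.

Lemma ideal_sum (R : comNzRingType) (J : R -> Prop) (I : Type) (s : seq I)
    (F : I -> R) : ideal J -> (forall i, J (F i)) -> J (\sum_(i <- s) F i).
Proof. by case=> J0 JD _ JF; elim/big_rec: _ => // i x _; apply: JD. Qed.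

Definition nullst n := forall J : {mpoly k[n]} -> Prop, ideal J ->
  (forall v, exists f, J f /\ f.@[v] != 0) -> J 1.

(** Euclid's algorithm in k[X], run on representatives: a root c of the specialized g is not a root
    of some specialized f in J, so f modulo g is nonzero of smaller degree. The quotient has
    coefficients in k, and lifting them as constants keeps the remainder in J. *)
Lemma ideal_fiber_unit n (J : {poly {mpoly k[n]}} -> Prop) (v : 'I_n -> k)
    (g : {poly {mpoly k[n]}}) :
  ideal J -> J g -> map_poly (meval v) g != 0 ->
  (forall c, exists f, J f /\ (map_poly (meval v) f).[c] != 0) ->
  exists f, J f /\ map_poly (meval v) f = 1.
Proof.
move=> idJ; have [J0 JD JM] := idJ.
have [m] := ubnP (size (map_poly (meval v) g)).
elim: m g => // m IH g; rewrite ltnS => gm Jg g0 nz.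
have [/eqP/size_poly1P[c c0 gc]|s1] := eqVneq (size (map_poly (meval v) g)) 1%N.
  exists ((c^-1)%:MP%:P * g); split; first exact: JM.
  by rewrite rmorphM /= map_polyC /= mevalC gc -polyCM mulVf.
have [c /rootP gc] := closed_rootP _ s1.
have [f [Jf fc]] := nz c.
pose q := map_poly (meval v) f %/ map_poly (meval v) g.
pose r := f - map_poly (@mpolyC n k) q * g.
have er : map_poly (meval v) r = map_poly (meval v) f %% map_poly (meval v) g.
  rewrite rmorphB rmorphM /= -map_poly_comp /=.
  rewrite (eq_map_poly (g := idfun)) ?map_poly_id //=; last by move=> x /=; rewrite mevalC.
  by rewrite {1}(divp_eq (map_poly (meval v) f) (map_poly (meval v) g)) addrC addrA addNr add0r.
apply: (IH r) => //.
- by rewrite er (leq_trans _ gm) // ltn_modp.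
- by apply: JD => //; apply: idealN => //; apply: JM.
rewrite er; apply: contra_neq fc => r0.
by rewrite (divp_eq (map_poly (meval v) f) (map_poly (meval v) g)) r0 addr0 hornerM gc mulr0.
Qed.

(* Nakayama: if [f] specializes to 1 at [v], the finite module R[X]/(f, g) is
   killed by a determinant that specializes to 1 at [v]. *)
Lemma nullst_monic n : nullst n -> forall (J : {poly {mpoly k[n]}} -> Prop) g,
  ideal J -> J g -> g \is monic ->
  (forall v c, exists f, J f /\ (map_poly (meval v) f).[c] != 0) -> J 1.
Proof.
move=> NS J g idJ Jg gm nz; have [J0 JD JM] := idJ.
apply: NNPP => nJ1.
have idJ0 : ideal (fun r => J r%:P).
  by split=> [|a b|r a]; rewrite ?polyCD ?polyCM //; [apply: JD | apply: JM].
(* J meets the coefficient ring in a proper ideal, which has a common zero v by the case of n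
   variables. *)
have [v Jv] : exists v, forall r, J r%:P -> r.@[v] = 0.
  apply: NNPP => nv; apply: nJ1; apply: (NS _ idJ0) => v.
  apply: NNPP => nf; apply: nv; exists v => r Jr.
  by apply/eqP/negPn/negP => rv; apply: nf; exists r.
have gv : map_poly (meval v) g \is monic by apply: monic_map.
have [f [Jf fv]] := ideal_fiber_unit idJ Jg (monic_neq0 gv) (nz v).
(* Modulo J, X^i is congruent to X^i (1 - f), hence to its remainder r_i by the monic g; as 1 - f
   dies at v, so does r_i. *)
pose r i := Pdiv.Ring.rmodp ('X^i * (1 - f)) g.
have rE i : 'X^i * (1 - f) = Pdiv.Ring.rdivp ('X^i * (1 - f)) g * g + r i.
  exact: Pdiv.RingMonic.rdivp_eq.
have Jr i : J ('X^i - r i).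
  have -> : 'X^i - r i = 'X^i * f + Pdiv.Ring.rdivp ('X^i * (1 - f)) g * g.
    have -> : r i = 'X^i * (1 - f) - Pdiv.Ring.rdivp ('X^i * (1 - f)) g * g.
      by rewrite [X in X - _]rE addrC addKr.
    by ring.
  by apply: JD; apply: JM.
have rv i : map_poly (meval v) (r i) = 0.
  have := congr1 (map_poly (meval v)) (rE i).
  rewrite rmorphD !rmorphM rmorphB rmorph1 /= fv subrr mulr0 => /esym/eqP.
  rewrite addrC addr_eq0 => /eqP e.
  have : (size (map_poly (meval v) (r i)) < size (map_poly (meval v) g))%N.
    rewrite (leq_ltn_trans (size_poly _ _)) //.
    rewrite (size_poly_eq (E := fun i => (g`_i).@[v])).
      by rewrite Pdiv.Ring.ltn_rmodpN0 // monic_neq0.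
    by rewrite -lead_coefE (monicP gm) rmorph1 oner_neq0.
  apply: contraTeq => nz0; rewrite e size_polyN -leqNgt.
  set q := map_poly (meval v) (Pdiv.Ring.rdivp _ _).
  have q0 : q != 0 by apply: contra_neq nz0 => q0; rewrite e -/q q0 mul0r oppr0.
  rewrite size_Mmonic //.
  rewrite -(size_poly_gt0 q) in q0.
  by case: (size q) q0 => // a _; rewrite addSn leq_addl.
have [N sg] : exists N, size g = N.+1.
  by exists (size g).-1; rewrite prednK // size_poly_gt0 monic_neq0.
(* A monic g of degree 0 is 1, and then 1 is in J already. Otherwise the degree N + 1 of g is the
   size of the matrix below. *)
case: N sg => [|N] sg.
  apply: nJ1; move: gm Jg; rewrite monicE /lead_coef sg /= => /eqP g0.
  by rewrite (size1_polyC (eq_leq sg)) g0.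
have sr i : (size (r i) <= N.+1)%N.
  by rewrite -ltnS -sg Pdiv.Ring.ltn_rmodpN0 // monic_neq0.
(* Row i of A times the column of powers of X is X^i - r_i, an element of J, so the adjugate puts
   det A in J. But A specializes to the identity at v. *)
pose A : 'M[{mpoly k[n]}]_N.+1 := \matrix_(i, j) ((i == j)%:R - (r i)`_j).
pose u : 'cV[{poly {mpoly k[n]}}]_N.+1 := \col_j 'X^j.
pose C := map_mx (@polyC _) A.
have Cu i : (C *m u) i 0 = 'X^i - r i.
  have -> : (C *m u) i 0 =
      \sum_(j < N.+1) ((i == j)%:R *: 'X^j - (r i)`_j *: 'X^j).
    rewrite mxE; apply: eq_bigr => j _.
    by rewrite !mxE polyCB mulrBl !mul_polyC.
  rewrite big_split /= sumrN; congr (_ - _).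
    rewrite (bigD1 i) //= eqxx scale1r big1 ?addr0 // => j.
    by rewrite eq_sym => /negPf->; rewrite scale0r.
  rewrite -(poly_def N.+1 (fun j => (r i)`_j)); apply/polyP => j; rewrite coef_poly.
  by case: ltnP => // sj; rewrite nth_default // (leq_trans _ sj).
have Jdet : J (\det A)%:P.
  have <- : (\adj C *m (C *m u)) 0 0 = (\det A)%:P.
    by rewrite mulmxA mul_adj_mx mul_scalar_mx !mxE mulr1 det_map_mx.
  by rewrite mxE; apply: ideal_sum => // j; rewrite Cu; apply: JM.
have := Jv _ Jdet; rewrite -det_map_mx; suff -> : map_mx (meval v) A = 1%:M.
  by rewrite det1 => /eqP; rewrite oner_eq0.
apply/matrixP => i j; rewrite !mxE rmorphB rmorph_nat.
by have := coef_map (meval v) (r i) j; rewrite rv coef0 /= => <-; rewrite subr0.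
Qed.

(** A degree bound with the coefficient at that degree, instead of size and [lead_coef]: c may be 0,
    so the data are multiplicative over any ring. *)
Definition topc (R : comNzRingType) (p : {poly R}) d c := (size p <= d.+1)%N /\ p`_d = c.

Lemma topcM (R : comNzRingType) (p q : {poly R}) d e a b :
  topc p d a -> topc q e b -> topc (p * q) (d + e) (a * b).
Proof.
move=> [sp <-] [sq <-]; split.
  by apply: leq_trans (size_polyMleq p q) _; lia.
rewrite coefM (bigD1 (inord d)) //= inordK ?ltnS ?leq_addr // addKn.
rewrite big1 ?addr0 // => j; rewrite -val_eqE /= inordK ?ltnS ?leq_addr // => jd.
have [jd'|dj] := ltnP d j; first by rewrite [p`_j]nth_default ?mul0r ?(leq_trans sp).
by rewrite [q`_ _]nth_default ?mulr0 //; apply: leq_trans sq _; lia.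
Qed.

Lemma topcX (R : comNzRingType) (p : {poly R}) d c m :
  topc p d c -> topc (p ^+ m) (m * d) (c ^+ m).
Proof.
move=> h; elim: m => [|m IH]; last by rewrite !exprS mulSn; apply: topcM.
by rewrite !expr0 mul0n; split; rewrite ?size_poly1 ?coef1.
Qed.

Lemma topc_prod (R : comNzRingType) (I : Type) (s : seq I) (p : I -> {poly R}) d c :
  (forall i, topc (p i) (d i) (c i)) ->
  topc (\prod_(i <- s) p i) (\sum_(i <- s) d i)%N (\prod_(i <- s) c i).
Proof.
move=> h; elim: s => [|i s IH]; last by rewrite !big_cons; apply: topcM.
by rewrite !big_nil; split; rewrite ?size_poly1 ?coef1.
Qed.

(** * Linear coordinate change making a polynomial monic in one variable *)

Section CoordinateChange.
Variables (n : nat) (lam : 'I_n.+1 -> k).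
Hypothesis lam1 : lam ord_max = 1.

(** X_i becomes X_i + lam_i Z for i below the last index, and the last variable becomes Z itself
    once [lam ord_max] is 1; Z is the variable of the outer [{poly _}]. *)
Definition shear_var (i : 'I_n.+1) : {poly {mpoly k[n]}} :=
  (if unlift ord_max i is Some j then 'X_j else 0)%:P + (lam i)%:MP *: 'X.
Definition shear (f : {mpoly k[n.+1]}) : {poly {mpoly k[n]}} :=
  mmap (@polyC _ \o @mpolyC n k) shear_var f.
Definition unshear_coef : {mpoly k[n]} -> {mpoly k[n.+1]} :=
  mmap (@mpolyC _ _) (fun j => 'X_(lift ord_max j) - lam (lift ord_max j) *: 'X_ord_max).
Definition unshear (p : {poly {mpoly k[n]}}) : {mpoly k[n.+1]} :=
  (map_poly unshear_coef p).['X_ord_max].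

Definition shear_pt (v : 'I_n -> k) (c : k) (i : 'I_n.+1) :=
  (if unlift ord_max i is Some j then v j else 0) + lam i * c.

Lemma meval_shear f v c : (map_poly (meval v) (shear f)).[c] = f.@[shear_pt v c].
Proof.
rewrite /shear /mmap [RHS]mevalE rmorph_sum horner_sum; apply: eq_bigr => m _.
rewrite rmorphM /= map_polyC /= mevalC hornerM hornerC; congr (_ * _).
rewrite /mmap1 rmorph_prod horner_prod; apply: eq_bigr => i _.
rewrite rmorphXn horner_exp; congr (_ ^+ _); rewrite /shear_var /shear_pt.
rewrite rmorphD /= map_polyC map_polyZ map_polyX /= mevalC hornerD hornerC hornerZ hornerX.
by case: unliftP => [j|] _; rewrite ?mevalXU ?meval0.
Qed.

Lemma meval_unshear p w : (unshear p).@[w] =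
  (map_poly (meval (fun j => w (lift ord_max j) - lam (lift ord_max j) * w ord_max)) p).[w ord_max].
Proof.
rewrite /unshear -horner_map /= mevalXU -map_poly_comp; congr (_.[_]).
apply: eq_map_poly => r /=; rewrite /unshear_coef /mmap [RHS]mevalE rmorph_sum /=.
apply: eq_bigr => m _; rewrite mevalM mevalC; congr (_ * _).
rewrite /mmap1 rmorph_prod; apply: eq_bigr => i _; rewrite rmorphXn; congr (_ ^+ _).
by rewrite /= mevalB mevalZ !mevalXU.
Qed.

(** Checked on values, which determine a polynomial over an infinite field; on points the two
    substitutions are visibly inverse because [lam ord_max] is 1. *)
Lemma shearK f : unshear (shear f) = f.
Proof.
apply/eqP; rewrite -subr_eq0; apply/eqP/mpoly_vanish => w _.
rewrite mevalB meval_unshear meval_shear; apply/eqP; rewrite subr_eq0; apply/eqP.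
apply: meval_eq => i; rewrite /shear_pt.
by case: unliftP => [j|] ->; rewrite ?lam1 ?add0r ?mul1r ?subrK.
Qed.

(** Each variable goes to a polynomial of degree at most 1 in Z with coefficient lam_i at Z, so a
    monomial of degree D contributes its value at lam to Z^D and a monomial of lower degree
    nothing. *)
Lemma topc_shear f D : (msize f <= D.+1)%N ->
  topc (shear f) D (pihomog mdeg D f).@[lam]%:MP.
Proof.
move=> sf.
have hv i : topc (shear_var i) 1 (lam i)%:MP.
  split; last by rewrite coefD coefC coefZ coefX mulr1 add0r.
  apply: leq_trans (size_polyD _ _) _; rewrite geq_max (leq_trans (size_polyC_leq1 _)) //=.
  by apply: leq_trans (size_scale_leq _ _) _; rewrite size_polyX.
have hm (m : 'X_{1..n.+1}) : topc (mmap1 shear_var m) (mdeg m) (\prod_i lam i ^+ m i)%:MP.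
  rewrite mdegE rmorph_prod /mmap1; apply: topc_prod => i.
  by rewrite rmorphXn /= -[X in topc _ X]muln1; apply: topcX.
rewrite /topc /shear /mmap; split.
  apply: (leq_trans (size_sum _ _ _)); apply/bigmax_leqP_seq => m mf _.
  rewrite mul_polyC; apply: leq_trans (size_scale_leq _ _) _.
  by case: (hm m) => s _; apply: leq_trans s _; apply: leq_trans sf; apply: msize_mdeg_lt.
rewrite coef_sum pihomogE (raddf_sum (meval lam)) (raddf_sum (@mpolyC n k)) [RHS]big_mkcond /= big_seq [RHS]big_seq.
apply: eq_bigr => m mf; rewrite coefCM.
have [<-|nD] := eqVneq (mdeg m) D.
  by case: (hm m) => _ ->; rewrite mevalZ mevalX mpolyCM.
rewrite nth_default ?mulr0 //; case: (hm m) => s _; apply: leq_trans s _.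
by rewrite ltn_neqAle nD -ltnS (leq_trans _ sf) // msize_mdeg_lt.
Qed.

Lemma unshear_ideal J : ideal J -> ideal (fun p => J (unshear p)).
Proof.
case=> J0 JD JM; split=> [|p q|p q].
- by rewrite /unshear rmorph0 horner0.
- by rewrite /unshear rmorphD hornerD; apply: JD.
by rewrite /unshear rmorphM hornerM; apply: JM.
Qed.

End CoordinateChange.

(** Induction on n. A nonzero f in J becomes monic up to a scalar under the shear along lam as soon
    as its top form does not vanish at lam; then [nullst_monic] eliminates the new variable. *)
Lemma weak_nullstellensatz n : nullst n.
Proof.
elim: n => [|n IH] J idJ nz; have [J0 JD JM] := idJ.
  have [f [Jf f0]] := nz (fun _ => 0); move: Jf f0.
  rewrite [f]nvar0_mpolyC mevalC; set c := f@_0 => Jc c0.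
  by have := JM (c^-1)%:MP _ Jc; rewrite -mpolyCM mulVf.
have [f [Jf fv]] := nz (fun _ => 0).
have f0 : f != 0 by apply: contraNneq fv => ->; rewrite meval0.
pose D := (msize f).-1.
have sD : msize f = D.+1 by rewrite mpolySpred.
have fD0 : pihomog mdeg D f != 0.
  apply/eqP => /(congr1 (mcoeff (mlead f))); rewrite mcoeff0 pihomogE.
  rewrite raddf_sum -big_filter /= (bigD1_seq (mlead f)) ?filter_uniq ?msupp_uniq //=; last first.
    by rewrite mem_filter mlead_supp // -eqSS mlead_deg // sD eqxx.
  rewrite mcoeffZ mcoeffX eqxx mulr1 big1 ?addr0 => [|m /negPf ml].
    by move/eqP; rewrite mleadc_eq0 (negPf f0).
  by rewrite mcoeffZ mcoeffX ml mulr0.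
have [x [x0 fx]] := mpoly_nonvanishing fD0.
(* All coordinates of x are nonzero, so the last one can be normalized to 1; the top form is
   homogeneous and stays nonzero. *)
pose lam i := x i / x ord_max.
have lam1 : lam ord_max = 1 by rewrite /lam divff.
have fl : (pihomog mdeg D f).@[lam] != 0.
  suff -> : (pihomog mdeg D f).@[lam] = (pihomog mdeg D f).@[x] / x ord_max ^+ D.
    by rewrite mulf_neq0 ?invr_eq0 ?expf_neq0.
  rewrite !mevalE mulr_suml big_seq [RHS]big_seq; apply: eq_bigr => m mf.
  rewrite -mulrA; congr (_ * _).
  have mD : mdeg m = D by apply: (dhomog_mf (pihomogP mdeg D f)).
  rewrite -mD mdegE expr_sum -prodf_div; apply: eq_bigr => i _.
  by rewrite /lam expr_div_n.
pose c := (pihomog mdeg D f).@[lam].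
have [sz top] := topc_shear lam (eq_leq sD).
have eu p : J p -> J (unshear lam (shear lam p)) by rewrite shearK.
suff : J (unshear lam 1) by rewrite /unshear rmorph1 hornerC.
have idJ' := unshear_ideal lam idJ; have [_ _ JM'] := idJ'.
apply: (nullst_monic IH idJ' (JM' (c^-1)%:MP%:P _ (eu _ Jf))).
  rewrite mul_polyC monicE /lead_coef.
  have top1 : ((c^-1)%:MP *: shear lam f)`_D = 1.
    by rewrite coefZ top -mpolyCM mulVf // mpolyC1.
  have -> : size ((c^-1)%:MP *: shear lam f) = D.+1.
    apply/eqP; rewrite eqn_leq (leq_trans (size_scale_leq _ _)) //=.
    by rewrite ltnNge; apply/negP => /leq_sizeP/(_ D (leqnn _))/eqP; rewrite top1 oner_eq0.
  by rewrite top1.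
move=> v d; have [h [Jh hw]] := nz (shear_pt lam v d).
by exists (shear lam h); split; [apply: eu | rewrite meval_shear].
Qed.

(** * Rabinowitsch trick *)

Section Rabinowitsch.
Variables (n : nat) (J : {mpoly k[n]} -> Prop) (F : {mpoly k[n]}).
Hypothesis idJ : ideal J.

(* The preimage of [J[1/F]] under [R[Z] -> R[1/F]]. *)
Definition rabin (p : {poly {mpoly k[n]}}) :=
  exists m j s, J j /\ (F ^+ m)%:P * p = j%:P + s * (1 - F%:P * 'X).

(** Modulo 1 - F Z the variable Z is inverse to F, so a power of F clears it. This is what lets
    [rabin] absorb products with polynomials in Z although its witness j has none. *)
Lemma rabin_reduce (r : {poly {mpoly k[n]}}) :
  exists l r0 s, (F ^+ l)%:P * r = r0%:P + s * (1 - F%:P * 'X).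
Proof.
elim/poly_ind: r => [|r c [l [r0 [s E]]]].
  by exists 0%N, 0, 0; rewrite mulr0 polyC0 mul0r addr0.
exists l.+1, (r0 + F ^+ l.+1 * c), (s * F%:P * 'X - r0%:P).
have -> : (F ^+ l.+1)%:P * (r * 'X + c%:P) =
    F%:P * 'X * ((F ^+ l)%:P * r) + (F ^+ l.+1)%:P * c%:P.
  by rewrite exprS polyCM; ring.
by rewrite E polyCD polyCM; ring.
Qed.

Lemma rabin_ideal : ideal rabin.
Proof.
have [J0 JD JM] := idJ; split.
- by exists 0%N, 0, 0; rewrite mulr0 polyC0 mul0r addr0.
- move=> p q [m [j [s [Jj E]]]] [m' [j' [s' [Jj' E']]]].
  exists (m + m')%N, (F ^+ m' * j + F ^+ m * j'), ((F ^+ m')%:P * s + (F ^+ m)%:P * s').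
  split; first by apply: JD; apply: JM.
  have -> : (F ^+ (m + m'))%:P * (p + q) =
      (F ^+ m')%:P * ((F ^+ m)%:P * p) + (F ^+ m)%:P * ((F ^+ m')%:P * q).
    by rewrite exprD polyCM; ring.
  by rewrite E E' polyCD !polyCM; ring.
move=> r p [m [j [s [Jj E]]]]; have [l [r0 [s' E']]] := rabin_reduce r.
exists (l + m)%N, (r0 * j), (s' * j%:P + (F ^+ l)%:P * r * s).
split; first exact: JM.
have -> : (F ^+ (l + m))%:P * (r * p) = (F ^+ l)%:P * r * ((F ^+ m)%:P * p).
  by rewrite exprD polyCM; ring.
have -> : (F ^+ l)%:P * r * ((F ^+ m)%:P * p) =
    (F ^+ l)%:P * r * j%:P + (F ^+ l)%:P * r * s * (1 - F%:P * 'X) by rewrite E; ring.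
by rewrite {1}E' polyCM; ring.
Qed.

(** For F nonzero, 1 - F Z has degree 1 in Z, so F^m - j = s (1 - F Z) with a constant left side
    forces F^m = j. *)
Lemma rabin1 : rabin 1 -> exists m, J (F ^+ m).
Proof.
move=> [m [j [s [Jj E]]]]; have [J0 JD JM] := idJ.
have [->|F0] := eqVneq F 0; first by exists 1%N; rewrite expr1.
exists m; suff -> : F ^+ m = j by [].
have sF : size (1 - F%:P * 'X) = 2%N.
  by rewrite -addrC -polyC1 -mulNr -polyCN size_MXaddC polyC_eq0 oppr_eq0 (negPf F0) size_polyC oppr_eq0 F0.
have [s0|s0] := eqVneq s 0.
  by move: E; rewrite s0 mul0r addr0 mulr1 => /polyC_inj.
have E' : s * (1 - F%:P * 'X) = (F ^+ m - j)%:P.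
  by move: E; rewrite mulr1 polyCB => ->; rewrite addrAC subrr add0r.
have := congr1 (fun p : {poly _} => size p) E'.
have q0 : 1 - F%:P * 'X != 0 by rewrite -size_poly_gt0 sF.
rewrite size_mul // sF size_polyC addn2 /= => h.
have : (0 < size s)%N by rewrite size_poly_gt0.
have := leq_b1 (F ^+ m - j != 0); rewrite -h.
by case: (size s).
Qed.

End Rabinowitsch.

(** The weak form in n + 1 variables applies to [rabin]: at a point (v, z) with F(v) z different
    from 1, the element 1 - F Z is nonzero; if F(v) z = 1, then F(v) is nonzero and some f in J is
    nonzero at v. *)
Lemma nullstellensatz n (J : {mpoly k[n]} -> Prop) (F : {mpoly k[n]}) :
  ideal J -> (forall v, F.@[v] != 0 -> exists f, J f /\ f.@[v] != 0) ->
  exists m, J (F ^+ m).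
Proof.
move=> idJ nz; have [J0 JD JM] := idJ; apply: rabin1 => //.
have [K0 KD KM] := rabin_ideal F idJ.
(* In this direction the shear mixes no variables: it is the plain identification of k[n+1] with
   polynomials in one variable over k[n]. *)
pose lam (i : 'I_n.+1) : k := (i == ord_max)%:R.
have lam1 : lam ord_max = 1 by rewrite /lam eqxx.
suff : rabin J F (shear lam 1) by rewrite /shear rmorph1.
apply: (@weak_nullstellensatz n.+1 (fun f => rabin J F (shear lam f))).
  split=> [|a b|a b].
  - by have -> : shear lam 0 = 0 by exact: rmorph0.
  - by have -> : shear lam (a + b) = shear lam a + shear lam b; [exact: rmorphD | exact: KD].
  by have -> : shear lam (a * b) = shear lam a * shear lam b; [exact: rmorphM | exact: KM].
move=> w; have wE f : f.@[w] = (map_poly (meval (fun j => w (lift ord_max j))) (shear lam f)).[w ord_max].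
  rewrite meval_shear; apply: meval_eq => i; rewrite /shear_pt /lam.
  by case: unliftP => [j|] ->; rewrite ?eqxx ?mul1r ?add0r // eq_sym (negPf (neq_lift _ _)) mul0r addr0.
pose v j := w (lift ord_max j).
have liftp p : rabin J F (shear lam p) -> (map_poly (meval v) (shear lam p)).[w ord_max] != 0 ->
    exists f, rabin J F (shear lam f) /\ f.@[w] != 0.
  by move=> Kp pw; exists p; rewrite wE.
have shearX i : shear lam 'X_i = shear_var lam i by rewrite /shear mmapX mmap1U.
have shear_lift f : exists h, shear lam h = f%:P.
  exists (mmap (@mpolyC n.+1 k) (fun j => 'X_(lift ord_max j)) f).
  rewrite [in RHS](mpolyE f) /mmap /shear raddf_sum /= [RHS]raddf_sum /=; apply: eq_bigr => m _.
  rewrite rmorphM /= mmapC /= -mul_mpolyC polyCM; congr (_ * _).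
  rewrite /mmap1 rmorph_prod mpolyXE_id rmorph_prod; apply: eq_bigr => j _.
  rewrite !rmorphXn /=; congr (_ ^+ _); rewrite -/(shear lam _) shearX /shear_var.
  by rewrite liftK /lam eq_sym (negPf (neq_lift _ _)) mpolyC0 scale0r addr0.
have shearXmax : shear lam 'X_ord_max = 'X.
  by rewrite shearX /shear_var unlift_none lam1 mpolyC1 scale1r add0r.
have [e|ne] := eqVneq (F.@[v] * w ord_max) 1; last first.
  have [h hE] := shear_lift F.
  have E : shear lam (1 - h * 'X_ord_max) = 1 - F%:P * 'X.
    by rewrite /shear rmorphB rmorph1 rmorphM /= -!/(shear lam _) hE shearXmax.
  apply: (liftp (1 - h * 'X_ord_max)); rewrite E.
    by exists 0%N, 0, 1; split; rewrite // expr0 polyC0 add0r mulrC.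
  rewrite rmorphB rmorph1 rmorphM /= map_polyC map_polyX /= hornerD hornerN hornerM !hornerC hornerX.
  by rewrite subr_eq0 eq_sym.
have [|f [Jf fv]] := nz v.
  by apply: contra_eq_neq e => ->; rewrite mul0r eq_sym oner_neq0.
have [h hE] := shear_lift f.
apply: (liftp h); rewrite hE; last by rewrite map_polyC hornerC.
by exists 0%N, f, 0; split; rewrite // expr0 mul0r addr0 mul1r.
Qed.

End Nullstellensatz.

(** * Sections of O(e) *)

Section RegularFunctions.
Variable k : closedFieldType.

Lemma poly_vanish (p : {poly k}) : (forall t, t != 0 -> p.[t] = 0) -> p = 0.
Proof.
move=> h; apply/eqP/negPn/negP => /exists_nonroot[t [t0]].
by rewrite rootE h ?eqxx.
Qed.

Lemma meval_scale n (f : {mpoly k[n]}) (x : 'I_n -> k) c :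
  f.@[fun i => c * x i] = (\sum_(i < msize f) (pihomog mdeg i f).@[x] *: 'X^i).[c].
Proof.
rewrite [in LHS](pihomog_partitionE (leqnn (msize f))) raddf_sum horner_sum.
apply: eq_bigr => i _ /=; rewrite hornerZ hornerXn !mevalE mulr_suml.
apply: eq_big_seq => m mf; rewrite -mulrA; congr (_ * _).
have <- : mdeg m = i by apply: (dhomog_mf (pihomogP mdeg i f)).
rewrite mdegE expr_sum -big_split /=; apply: eq_bigr => j _.
by rewrite exprMn mulrC.
Qed.

Lemma coef_sum_monomials N (F : 'I_N -> k) (i : nat) :
  (\sum_(j < N) F j *: 'X^j)`_i = if insub i is Some j then F j else 0.
Proof.
rewrite coef_sum; case: insubP => [j _ <-|Ni].
  rewrite (bigD1 j) //= coefZ coefXn eqxx mulr1 big1 ?addr0 // => l lj.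
  by rewrite coefZ coefXn eq_sym (negPf (lj : l != j :> nat)) mulr0.
rewrite big1 // => j _; rewrite coefZ coefXn.
by case: eqP => [e|]; rewrite ?mulr0 //; rewrite e ltn_ord in Ni.
Qed.

(** As a function of c, f(c x) is a polynomial whose coefficients are the values at x of the
    homogeneous parts of f; comparison with c^e f(x) leaves only degree e, and nothing if e is
    negative. Being pointwise, this also serves for f whose values are homogeneous only over some
    region. *)
Lemma meval_homog_part n (f : {mpoly k[n]}) (x : 'I_n -> k) (e : int) :
  (forall c, c != 0 -> f.@[fun i => c * x i] = c ^ e * f.@[x]) ->
  match e with Posz N => f.@[x] = (pihomog mdeg N f).@[x] | Negz _ => f.@[x] = 0 end.
Proof.
set p : {poly k} := \sum_(i < msize f) (pihomog mdeg i f).@[x] *: 'X^i => h.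
case: e h => N h.
  have /(congr1 (fun q : {poly k} => q`_N)) : p - f.@[x] *: 'X^N = 0.
    apply: poly_vanish => t t0; rewrite hornerD hornerN hornerZ hornerXn -meval_scale h //.
    by rewrite -exprnP mulrC subrr.
  rewrite coef0 coefD coefN coefZ coefXn eqxx mulr1 coef_sum_monomials.
  case: insubP => [j _ <- /eqP|Ni].
    by rewrite subr_eq0 => /eqP->.
  rewrite add0r => /eqP; rewrite oppr_eq0 => /eqP->.
  have -> : pihomog mdeg N f = 0; last by rewrite meval0.
  rewrite pihomogE big_seq_cond big_pred0 // => m; apply/negP => /andP[/msize_mdeg_lt mf /eqP mN].
  by rewrite -mN mf in Ni.
have /(congr1 (fun q : {poly k} => q`_0)) : p * 'X^(N.+1) - (f.@[x])%:P = 0.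
  apply: poly_vanish => t t0.
  rewrite hornerD hornerN hornerM hornerC hornerXn -meval_scale h //.
  by rewrite NegzE mulrAC -exprnN mulVf ?expf_neq0 // mul1r subrr.
rewrite coefD coefN coefMXn /= coefC coef0 sub0r => /eqP.
by rewrite oppr_eq0 => /eqP.
Qed.

Variable n : nat.
Implicit Types (U V W : region k n) (f g : 'rV[k]_n -> k) (x y : 'rV[k]_n).
Implicit Types (a b F : {mpoly k[n]}) (e : int).

Lemma pevalM a b x : peval (a * b) x = peval a x * peval b x.
Proof. exact: mevalM. Qed.
Lemma pevalD a b x : peval (a + b) x = peval a x + peval b x.
Proof. exact: mevalD. Qed.
Lemma peval1 x : peval 1 x = 1.
Proof. exact: meval1. Qed.
Lemma peval0 x : peval 0 x = 0.
Proof. exact: meval0. Qed.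
Lemma pevalX F m x : peval (F ^+ m) x = peval F x ^+ m.
Proof. exact: rmorphXn. Qed.

Lemma pevalZ d F c x : F \is d.-homog -> peval F (c *: x) = c ^+ d * peval F x.
Proof.
move=> Fd; rewrite /peval !mevalE mulr_sumr; apply: eq_big_seq => m mF.
have <- : mdeg m = d by apply: dhomog_mf mF.
rewrite mulrCA mdegE; congr (_ * _); rewrite expr_sum -big_split /=.
by apply: eq_bigr => j _; rewrite mxE exprMn.
Qed.

Lemma peval_homog_neq0 d F x : F \is d.-homog -> (0 < d)%N -> peval F x != 0 -> x != 0.
Proof.
move=> Fd d0; apply: contra_neq => ->.
by rewrite -(scale0r 0) (pevalZ _ _ Fd) expr0n gtn_eqF // mul0r.
Qed.

Lemma dhomogX1 (i : 'I_n) : ('X_i : {mpoly k[n]}) \is 1.-homog.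
Proof. by rewrite dhomogX /= mdeg1. Qed.

Lemma dhomog_prodn (I : Type) (s : seq I) (G : I -> {mpoly k[n]}) (d : I -> nat) :
  (forall i, G i \is (d i).-homog) ->
  \prod_(i <- s) G i \is (\sum_(i <- s) d i)%N.-homog.
Proof.
move=> h; elim: s => [|i s IH]; first by rewrite !big_nil dhomog1.
by rewrite !big_cons; apply: dhomogM.
Qed.

Definition nonzero_locus F : region k n := fun x => peval F x != 0.

Lemma zopen_nonzero_locus d F : F \is d.-homog -> (0 < d)%N -> zopen (nonzero_locus F).
Proof.
by move=> Fd d0 x Fx; split; [exact: (peval_homog_neq0 Fd d0 Fx) | exists d, F].
Qed.

Lemma zopenI U V : zopen U -> zopen V -> zopen (fun x => U x /\ V x).
Proof.
move=> oU oV x [Ux Vx]; have [x0 [m [f [fh fx fU]]]] := oU x Ux.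
have [_ [m' [f' [f'h f'x f'V]]]] := oV x Vx.
split=> //; exists (m + m')%N, (f * f'); split; first exact: dhomogM.
  by rewrite pevalM mulf_neq0.
by move=> y y0; rewrite pevalM mulf_eq0 negb_or => /andP[/(fU y y0) ? /(f'V y y0)].
Qed.

Lemma zopen_inter (I : Type) (U : I -> region k n) q (s : {ffun 'I_q.+1 -> I}) :
  (forall i, zopen (U i)) -> zopen (inter U s).
Proof.
move=> oU x Ux; have [x0 _] := oU _ _ (Ux ord0); split=> //.
have h i : exists mf : nat * {mpoly k[n]}, [/\ mf.2 \is mf.1.-homog, peval mf.2 x != 0
    & forall y, y != 0 -> peval mf.2 y != 0 -> U (s i) y].
  by have [_ [m [f hf]]] := oU _ _ (Ux i); exists (m, f).
have [mf mfP] := fin_all_exists h.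
exists (\sum_i (mf i).1)%N, (\prod_i (mf i).2); split.
- by apply: dhomog_prodn => i; have [] := mfP i.
- by rewrite /peval rmorph_prod; apply/prodf_neq0 => i _; have [] := mfP i.
move=> y y0; rewrite /peval rmorph_prod => /prodf_neq0 fy i.
by have [_ _ hU] := mfP i; apply: hU => //; apply: fy.
Qed.

Lemma zopen_neq0 : zopen (fun x : 'rV[k]_n => x != 0).
Proof. by move=> x x0; split=> //; exists 0%N, 1; rewrite dhomog1 peval1 oner_neq0. Qed.

Lemma zopenZ U c x : zopen U -> U x -> c != 0 -> U (c *: x).
Proof.
move=> oU Ux c0; have [x0 [m [f [fh fx fU]]]] := oU x Ux.
by apply: fU; rewrite ?(pevalZ _ _ fh) ?mulf_neq0 ?expf_neq0 // scaler_eq0 negb_or c0.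
Qed.

Lemma O_section_local e U f :
  (forall x, U x -> exists W, [/\ zopen W, W x, sub_region W U & O_section e W f]) ->
  O_section e U f.
Proof.
move=> h x Ux; have [W [oW Wx WU sW]] := h x Ux.
have [W' [oW' W'x W'W E]] := sW x Wx.
by exists W'; split=> // y /W'W /WU.
Qed.

Lemma O_sectionW e U V f : zopen V -> sub_region V U -> O_section e U f -> O_section e V f.
Proof.
move=> oV VU sf x Vx; have [W [oW Wx WU [p [q [a [b [ap bq pq E]]]]]]] := sf x (VU x Vx).
exists (fun x => W x /\ V x); split=> //; [exact: zopenI | by move=> y [] |].
by exists p, q, a, b; split=> // y [/E].
Qed.

Lemma eq_O_section e U f g : (forall x, U x -> f x = g x) ->
  O_section e U f -> O_section e U g.
Proof.
move=> fg sf x Ux; have [W [oW Wx WU [p [q [a [b [ap bq pq E]]]]]]] := sf x Ux.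
exists W; split=> //; exists p, q, a, b; split=> // y Wy.
by have [b0 <-] := E y Wy; split=> //; rewrite fg //; apply: WU.
Qed.

Lemma O_section_frac p q a b U : zopen U -> a \is p.-homog -> b \is q.-homog ->
  (forall x, U x -> peval b x != 0) ->
  O_section (p%:Z - q%:Z) U (fun x => peval a x / peval b x).
Proof.
move=> oU ap bq bU x Ux; exists U; split=> //.
by exists p, q, a, b; split=> // y Uy; split=> //; apply: bU.
Qed.

Lemma O_section_poly p a U : zopen U -> a \is p.-homog -> O_section p%:Z U (peval a).
Proof.
move=> oU ap; rewrite -[p%:Z]subr0; apply: eq_O_section (O_section_frac oU ap (dhomog1 _ _) _).
  by move=> x _; rewrite peval1 divr1.
by move=> x _; rewrite peval1 oner_neq0.
Qed.

Lemma O_section_inv q b U : zopen U -> b \is q.-homog -> (forall x, U x -> peval b x != 0) ->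
  O_section (- q%:Z) U (fun x => (peval b x)^-1).
Proof.
move=> oU bq bU; rewrite -[- _]add0r; apply: eq_O_section (O_section_frac oU (dhomog1 _ _) bq bU).
by move=> x _; rewrite peval1 mul1r.
Qed.

Lemma neq0_coord x : x != 0 -> exists i, x 0 i != 0.
Proof.
move=> x0; apply/existsP; apply: contraNT x0 => /existsPn x0.
by apply/eqP/rowP => i; rewrite mxE; apply/eqP/negPn/x0.
Qed.

Lemma O_section0 e U : zopen U -> O_section e U (fun _ => 0).
Proof.
move=> oU x Ux; have [x0 _] := oU x Ux; have [i xi] := neq0_coord x0.
exists (fun y => U y /\ nonzero_locus 'X_i y); split=> //.
- by apply: zopenI => //; apply: zopen_nonzero_locus (dhomogX1 i) _.
- by split=> //; rewrite /nonzero_locus /peval mevalXU.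
- by move=> y [].
(* Even the zero section needs a fraction of degree e; for negative e the denominator is a power of
   a coordinate that is nonzero at x. *)
case: e => m.
  exists m, 0%N, 0, 1; rewrite dhomog0 dhomog1 subr0; split=> // y _.
  by rewrite peval0 peval1 oner_neq0 mul0r.
exists 0%N, m.+1, 0, ('X_i ^+ m.+1); rewrite dhomog0; split=> //.
- by have := dhomogMn m.+1 (dhomogX1 i); rewrite mul1n.
- by rewrite NegzE sub0r.
by move=> y [_ yi]; rewrite peval0 mul0r pevalX expf_neq0.
Qed.

Lemma O_sectionD e U f g : O_section e U f -> O_section e U g ->
  O_section e U (fun x => f x + g x).
Proof.
move=> sf sg x Ux; have [W [oW Wx WU [p [q [a [b [ap bq pq E]]]]]]] := sf x Ux.
have [W' [oW' W'x W'U [p' [q' [a' [b' [ap' bq' pq' E']]]]]]] := sg x Ux.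
exists (fun x => W x /\ W' x); split=> //; [exact: zopenI | by move=> y [] /WU |].
exists (p + q')%N, (q + q')%N, (a * b' + a' * b), (b * b'); split.
- have -> : (p + q')%N = (q + p')%N by lia.
  apply: dhomogD; last by rewrite mulrC; apply: dhomogM.
  have <- : (p + q')%N = (q + p')%N by lia.
  exact: dhomogM.
- exact: dhomogM.
- lia.
move=> y [/E[by0 ->] /E'[b'y0 ->]]; rewrite pevalM mulf_neq0 //; split=> //.
by rewrite pevalD !pevalM addf_div.
Qed.

Lemma O_sectionM e e' U f g : O_section e U f -> O_section e' U g ->
  O_section (e + e') U (fun x => f x * g x).
Proof.
move=> sf sg x Ux; have [W [oW Wx WU [p [q [a [b [ap bq pq E]]]]]]] := sf x Ux.
have [W' [oW' W'x W'U [p' [q' [a' [b' [ap' bq' pq' E']]]]]]] := sg x Ux.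
exists (fun x => W x /\ W' x); split=> //; [exact: zopenI | by move=> y [] /WU |].
exists (p + p')%N, (q + q')%N, (a * a'), (b * b'); split; try exact: dhomogM.
  lia.
move=> y [/E[by0 ->] /E'[b'y0 ->]]; rewrite pevalM mulf_neq0 //; split=> //.
by rewrite pevalM mulf_div.
Qed.

Lemma O_section_cst c U : zopen U -> O_section 0 U (fun _ => c).
Proof.
move=> oU; have h : (c%:MP : {mpoly k[n]}) \is 0.-homog.
  by rewrite -[c]mulr1 mpolyCM mpolyC1 mul_mpolyC dhomogZ // dhomog1.
by apply: eq_O_section (O_section_poly oU h) => x _; rewrite /peval mevalC.
Qed.

Lemma O_sectionZ e c U f : O_section e U f -> O_section e U (fun x => c * f x).
Proof.
move=> sf x Ux; have [W [oW Wx WU [p [q [a [b [ap bq pq E]]]]]]] := sf x Ux.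
exists W; split=> //; exists p, q, (c *: a), b; split=> //; first exact: dhomogZ.
by move=> y /E[by0 ->]; split=> //; rewrite /peval mevalZ mulrA.
Qed.

Lemma O_section_sum e U (I : Type) (r : seq I) (P : pred I) (F : I -> 'rV[k]_n -> k) :
  zopen U -> (forall i, P i -> O_section e U (F i)) ->
  O_section e U (fun x => \sum_(i <- r | P i) F i x).
Proof.
move=> oU h; elim: r => [|i r IH].
  by apply: eq_O_section (O_section0 e oU) => x _; rewrite big_nil.
case Pi: (P i); last by apply: eq_O_section IH => x _; rewrite big_cons Pi.
apply: (eq_O_section (f := fun x => F i x + \sum_(j <- r | P j) F j x)).
  by move=> x _; rewrite big_cons Pi.
by apply: O_sectionD => //; apply: h.
Qed.

Lemma O_sectionX e U f m : zopen U -> O_section e U f -> O_section (e * m%:Z) U (fun x => f x ^+ m).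
Proof.
move=> oU sf; elim: m => [|m IH].
  by rewrite mulr0; apply: eq_O_section (O_section_cst 1 oU).
have -> : e * m.+1%:Z = e + e * m%:Z by rewrite -[m.+1]addn1 PoszD mulrDr mulr1 addrC.
by apply: eq_O_section (O_sectionM sf IH) => x _; rewrite exprS.
Qed.

Lemma O_section_prod U (I : Type) (r : seq I) (d : I -> int) (F : I -> 'rV[k]_n -> k) :
  zopen U -> (forall i, O_section (d i) U (F i)) ->
  O_section (\sum_(i <- r) d i) U (fun x => \prod_(i <- r) F i x).
Proof.
move=> oU h; elim: r => [|i r IH].
  by rewrite big_nil; apply: eq_O_section (O_section_cst 1 oU) => x _; rewrite big_nil.
rewrite big_cons; apply: eq_O_section (O_sectionM (h i) IH) => x _.
by rewrite big_cons.
Qed.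

Lemma O_section_meval U N (p : {mpoly k[N]}) d (a : int) (T : 'I_N -> 'rV[k]_n -> k) :
  zopen U -> p \is d.-homog -> (forall i, O_section a U (T i)) ->
  O_section (a * d%:Z) U (fun x => p.@[fun i => T i x]).
Proof.
move=> oU pd sT.
apply: (eq_O_section (f := fun x => \sum_(m <- msupp p | m \in msupp p)
    p@_m * \prod_i T i x ^+ m i)).
  by move=> x _; rewrite mevalE [RHS]big_seq_cond; apply: eq_bigl => m; rewrite andbT.
apply: O_section_sum => // m mp; apply: O_sectionZ.
have <- : mdeg m = d by apply: dhomog_mf mp.
have -> : a * (mdeg m)%:Z = \sum_i a * (m i)%:Z.
  by rewrite mdegE -mulr_sumr (big_morph Posz PoszD (erefl _)).
by apply: O_section_prod => // i; apply: O_sectionX.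
Qed.

Lemma O_section_meval0 U N (p : {mpoly k[N]}) (T : 'I_N -> 'rV[k]_n -> k) :
  zopen U -> (forall i, O_section 0 U (T i)) ->
  O_section 0 U (fun x => p.@[fun i => T i x]).
Proof.
move=> oU sT; rewrite (pihomog_partitionE (leqnn (msize p))).
apply: (eq_O_section (f := fun x =>
    \sum_(i <- index_enum (ordinal (msize p))) (pihomog mdeg i p).@[fun i => T i x])).
  by move=> x _; rewrite -raddf_sum.
apply: O_section_sum => // i _; rewrite -(mul0r i%:Z).
by apply: O_section_meval => //; apply: pihomogP.
Qed.

Lemma O_section_scale e U f x c : O_section e U f -> U x -> c != 0 ->
  f (c *: x) = c ^ e * f x.
Proof.
move=> sf Ux c0; have [W [oW Wx WU [p [q [a [b [ap bq <- E]]]]]]] := sf x Ux.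
have [_ ->] := E _ Wx; have [_ ->] := E _ (zopenZ oW Wx c0).
by rewrite (pevalZ _ _ ap) (pevalZ _ _ bq) expfzDr // -exprnN -exprnP mulf_div.
Qed.

(** The numerator a need not be homogeneous: since f scales by c^e, a may be replaced by its part of
    degree e + q without changing its values on U. *)
Lemma O_section_of_poly e U f q a b : zopen U -> b \is q.-homog ->
  (forall x, U x -> peval b x != 0 /\ f x = peval a x / peval b x) ->
  (forall x c, U x -> c != 0 -> f (c *: x) = c ^ e * f x) -> O_section e U f.
Proof.
move=> oU bq E sf.
have h x : U x -> match (e + q%:Z)%R with Posz N => peval a x = peval (pihomog mdeg N a) x
                                 | Negz _ => peval a x = 0 end.
  move=> Ux; apply: meval_homog_part => c c0.
  have := sf x c Ux c0; have [b0 ->] := E _ Ux; have [cb0 ->] := E _ (zopenZ oU Ux c0).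
  rewrite (pevalZ _ _ bq) => /(congr1 (fun z => z * (c ^+ q * peval b x))).
  rewrite divfK ?mulf_neq0 ?expf_neq0 // expfzDr // -exprnP => ae.
  rewrite (meval_eq _ (v2 := (c *: x) 0)); last by move=> i; rewrite mxE.
  by rewrite -/(peval a _) ae; field.
case eN : (e + q%:Z) h => [N|N] h.
  have -> : e = N%:Z - q%:Z by rewrite -eN addrK.
  apply: eq_O_section (O_section_frac oU (pihomogP mdeg N a) bq _) => x Ux.
    by rewrite -h //; case: (E x Ux).
  by case: (E x Ux).
apply: eq_O_section (O_section0 e oU) => x Ux.
by have [_ ->] := E x Ux; rewrite h ?mul0r.
Qed.

(** The polynomials b for which b f is polynomial on the locus of F form an ideal. Local
    denominators show that it has no common zero on this locus, so it contains a power of F. *)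
Lemma O_section_global d F e f : F \is d.-homog -> (0 < d)%N ->
  O_section e (nonzero_locus F) f ->
  exists m a, forall x, nonzero_locus F x -> peval F x ^+ m * f x = peval a x.
Proof.
move=> Fd d0 sf.
pose J b := exists a, forall x, nonzero_locus F x -> peval b x * f x = peval a x.
have idJ : ideal J.
  split=> [|a b [a' Ea] [b' Eb]|r a [a' Ea]].
  - by exists 0 => x _; rewrite peval0 mul0r.
  - by exists (a' + b') => x Fx; rewrite !pevalD mulrDl Ea ?Eb.
  by exists (r * a') => x Fx; rewrite !pevalM -mulrA Ea.
have [v Fv|m [a E]] := nullstellensatz idJ (F := F); last first.
  by exists m, a => x Fx; rewrite -pevalX; apply: E.
pose x : 'rV[k]_n := \row_i v i.
have ev b : peval b x = b.@[v] by apply: meval_eq => i; rewrite mxE.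
have Fx : nonzero_locus F x by rewrite /nonzero_locus ev.
have [W [oW Wx WU [p [q [a [b [ap bq pq E]]]]]]] := sf x Fx.
have [_ [m [h [hm hx hW]]]] := oW x Wx.
(* The fraction a / b is valid only on W; the factor h vanishes off W, so the identity holds
   trivially there. *)
exists (b * h); rewrite -ev pevalM mulf_neq0 //; last by case: (E x Wx).
split=> //; exists (a * h) => y Fy; rewrite !pevalM.
have [->|hy] := eqVneq (peval h y) 0; first by rewrite !mulr0 mul0r.
have [by0 ->] := E y (hW y (peval_homog_neq0 Fd d0 Fy) hy).
by field.
Qed.

(** Density of the torus: for a local fraction a / b on a neighbourhood containing the locus of h,
    the polynomial a h vanishes at every torus point, hence identically. *)
Lemma O_section_eq0 e U f : O_section e U f ->
  (forall x, U x -> (forall i, x 0 i != 0) -> f x = 0) -> forall x, U x -> f x = 0.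
Proof.
move=> sf f0 x Ux; have [W [oW Wx WU [p [q [a [b [ap bq pq E]]]]]]] := sf x Ux.
have [x0 [m [h [hm hx hW]]]] := oW x Wx; have [i xi] := neq0_coord x0.
have ah0 : a * h = 0.
  apply: mpoly_vanish => v v0; pose y : 'rV[k]_n := \row_i v i.
  have -> : (a * h).@[v] = peval (a * h) y by apply: meval_eq => j; rewrite mxE.
  rewrite pevalM; have [->|hy] := eqVneq (peval h y) 0; first by rewrite mulr0.
  have y0 : y != 0 by apply: contraNneq (v0 i) => /rowP/(_ i); rewrite !mxE => ->.
  have Wy := hW y y0 hy; have [by0 fy] := E y Wy.
  have /eqP : f y = 0 by apply: f0; [exact: WU | move=> j; rewrite mxE].
  by rewrite fy mulf_eq0 invr_eq0 (negPf by0) orbF => /eqP->; rewrite mul0r.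
have [_ ->] := E x Wx.
have /eqP : peval (a * h) x = 0 by rewrite ah0 peval0.
by rewrite pevalM mulf_eq0 (negPf hx) orbF => /eqP->; rewrite mul0r.
Qed.

End RegularFunctions.

(** * Sections of P(Omega)(e) *)

(** A functional on Hom(A, B), in the form that [pmap_poly] accepts: it turns polynomiality of
    [pmap] into polynomiality of the single functions phi (P(T) u). *)
Definition eval_functional (k : fieldType) (A B : vectType k) (phi : 'Hom(B, k^o)) (u : A)
  (f : 'Hom(A, B)) : k^o := phi (f u).
Lemma eval_functional_is_linear (k : fieldType) (A B : vectType k) (phi : 'Hom(B, k^o)) (u : A) : linear (@eval_functional k A B phi u).
Proof. by move=> c f g; rewrite /eval_functional add_lfunE scale_lfunE linearP. Qed.
HB.instance Definition _ (k : fieldType) (A B : vectType k) (phi : 'Hom(B, k^o)) (u : A) :=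
  GRing.isLinear.Build k 'Hom(A, B) k^o *:%R (@eval_functional k A B phi u)
    (@eval_functional_is_linear k A B phi u).

Section PolynomialFunctor.
Variables (k : closedFieldType) (d : nat) (P : poly_functor k d).

Definition pm m r (T : 'M[k]_(m, r)) : 'Hom(P 'cV[k]_r, P 'cV[k]_m) :=
  pmap P (linfun (mulmx T)).

Lemma pmM m r l (A : 'M[k]_(m, r)) (B : 'M[k]_(r, l)) u : pm (A *m B) u = pm A (pm B u).
Proof.
rewrite /pm -comp_lfunE -pmap_comp; congr (pmap P _ u).
by apply/lfunP => v; rewrite comp_lfunE !lfunE /= mulmxA.
Qed.

Lemma pm1 m u : pm (1%:M : 'M_m) u = u.
Proof.
rewrite /pm; have -> : linfun (mulmx (1%:M : 'M[k]_m)) = \1%VF :> 'Hom('cV_m, 'cV_m).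
  by apply/lfunP => v; rewrite lfunE /= mul1mx id_lfunE.
by rewrite pmap_id id_lfunE.
Qed.

Lemma pmZ m r c (A : 'M[k]_(m, r)) u : pm (c *: A) u = c ^+ d *: pm A u.
Proof.
have -> : c *: A = (c *: 1%:M) *m A by rewrite -scalemxAl mul1mx.
rewrite pmM; set w := pm A u; rewrite /pm.
have -> : linfun (mulmx (c *: 1%:M : 'M[k]_m)) = c *: \1%VF :> 'Hom('cV_m, 'cV_m).
  by apply/lfunP => v; rewrite lfunE /= scale_lfunE id_lfunE -scalemxAl mul1mx.
by rewrite pmap_scale scale_lfunE id_lfunE.
Qed.

(** L i is the i-th coordinate on Hom, written in matrix entries. Since P(c T) = c^d P(T), the
    polynomial from [pmap_poly] may be cut down to its part of degree d without changing values. *)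
Lemma pm_poly m r (phi : 'Hom(P 'cV[k]_m, k^o)) (u : P 'cV[k]_r) :
  exists N (p : {mpoly k[N]}) (L : 'I_N -> 'M[k]_(m, r)), p \is d.-homog /\
    forall T, phi (pm T u) = p.@[fun i => \sum_a \sum_b T a b * L i a b].
Proof.
have [p pE] := @pmap_poly k d P 'cV_r 'cV_m (linfun (eval_functional phi u)).
set X := vbasis _ in p pE.
pose L i : 'M[k]_(m, r) := \matrix_(a, b) coord X i (linfun (mulmx (delta_mx a b : 'M[k]_(m, r)))).
have LE i (T : 'M_(m, r)) : coord X i (linfun (mulmx T)) = \sum_a \sum_b T a b * L i a b.
  have -> : linfun (mulmx T) = \sum_a \sum_b T a b *: linfun (mulmx (delta_mx a b : 'M[k]_(m, r))) :> 'Hom('cV_r, 'cV_m).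
    apply/lfunP => v; rewrite lfunE /= {1}(matrix_sum_delta T) mulmx_suml sum_lfunE.
    apply: eq_bigr => a _; rewrite mulmx_suml sum_lfunE; apply: eq_bigr => b _.
    by rewrite scale_lfunE lfunE /= scalemxAl.
  rewrite linear_sum; apply: eq_bigr => a _; rewrite linear_sum; apply: eq_bigr => b _.
  by rewrite linearZ /= mxE.
have pE' T : phi (pm T u) = p.@[fun i => \sum_a \sum_b T a b * L i a b].
  have := pE (linfun (mulmx T)); rewrite lfunE /= /eval_functional => ->.
  by apply: meval_eq => i; rewrite LE.
exists _, (pihomog mdeg d p), L; split; first exact: pihomogP.
move=> T; rewrite pE'; apply: (meval_homog_part (e := d%:Z)) => c c0.
rewrite -exprnP -pE'; have <- : phi (c ^+ d *: pm T u) = c ^+ d * phi (pm T u) by rewrite linearZ.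
rewrite -pmZ pE'; apply: meval_eq => i.
rewrite mulr_sumr; apply: eq_bigr => a _; rewrite mulr_sumr; apply: eq_bigr => b _.
by rewrite [(c *: T) a b]mxE mulrA.
Qed.

Lemma coord_full (A : vectType k) (u : A) :
  u = \sum_i coord (vbasis fullv) i u *: (vbasis fullv)`_i.
Proof. exact/coord_vbasis/memvf. Qed.

Lemma functional_coord (A : vectType k) (phi : 'Hom(A, k^o)) u :
  phi u = \sum_i coord (vbasis fullv) i u * phi (vbasis fullv)`_i.
Proof. by rewrite {1}(coord_full u) linear_sum; apply: eq_bigr => i _; rewrite linearZ. Qed.

Variable n : nat.
Implicit Types (U V W : region k n) (x y : 'rV[k]_n).

Section Module.
Variable M : vectType k.
Implicit Types (f g : 'rV[k]_n -> M) (e : int).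

Lemma OM_sectionP e U f : zopen U ->
  (forall i, O_section e U (fun x => coord (vbasis fullv) i (f x))) <-> OM_section e U f.
Proof.
move=> oU; split=> [h phi|h i].
  apply: (eq_O_section (f := fun x => \sum_i coord (vbasis fullv) i (f x) * phi (vbasis fullv)`_i)).
    by move=> x _; rewrite [RHS]functional_coord.
  apply: O_section_sum => // i _; apply: (eq_O_section (f := fun x => phi (vbasis fullv)`_i * coord (vbasis fullv) i (f x))).
    by move=> x _; rewrite mulrC.
  exact: O_sectionZ.
apply: eq_O_section (h (linfun (coord (vbasis fullv) i : M -> k^o))) => x _.
by rewrite lfunE.
Qed.

Lemma OM_sectionW e U V f : zopen V -> sub_region V U -> OM_section e U f -> OM_section e V f.
Proof. by move=> oV VU h phi; apply: O_sectionW (h phi). Qed.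

Lemma eq_OM_section e U f g : (forall x, U x -> f x = g x) ->
  OM_section e U f -> OM_section e U g.
Proof. by move=> fg h phi; apply: eq_O_section (h phi) => x Ux; rewrite fg. Qed.

Lemma OM_section0 e U : zopen U -> OM_section e U (fun _ => 0 : M).
Proof. by move=> oU phi; apply: eq_O_section (O_section0 e oU) => x _; rewrite linear0. Qed.

Lemma OM_sectionD e U f g : OM_section e U f -> OM_section e U g ->
  OM_section e U (fun x => f x + g x).
Proof.
move=> sf sg phi; apply: eq_O_section (O_sectionD (sf phi) (sg phi)) => x _.
by rewrite linearD.
Qed.

Lemma OM_sectionZ e e' U (a : 'rV[k]_n -> k) f : O_section e' U a -> OM_section e U f ->
  OM_section (e' + e) U (fun x => a x *: f x).
Proof.
move=> sa sf phi; apply: eq_O_section (O_sectionM sa (sf phi)) => x _.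
by rewrite linearZ.
Qed.

Lemma OM_section_scale e U f x c : OM_section e U f -> U x -> c != 0 ->
  f (c *: x) = c ^ e *: f x.
Proof.
move=> sf Ux c0; rewrite [LHS]coord_full [in RHS](coord_full (f x)) scaler_sumr.
apply: eq_bigr => i _; rewrite scalerA; congr (_ *: _).
have := O_section_scale (sf (linfun (coord (vbasis fullv) i : M -> k^o))) Ux c0.
by rewrite !lfunE.
Qed.

Lemma OM_section_eq0 e U f : OM_section e U f ->
  (forall x, U x -> (forall i, x 0 i != 0) -> f x = 0) -> forall x, U x -> f x = 0.
Proof.
move=> sf f0 x Ux; rewrite (coord_full (f x)) big1 // => i _.
have : linfun (coord (vbasis fullv) i : M -> k^o) (f x) = 0.
  by apply: (O_section_eq0 (sf _)) Ux => y Uy y0; rewrite f0 ?linear0.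
by rewrite lfunE /= => ->; rewrite scale0r.
Qed.

End Module.

(** The matrix coefficients of P(T) are forms of degree d in the entries of T, so entries of degree
    a shift the degree by a d. *)
Lemma OM_section_pm m r e a U (T : 'rV[k]_n -> 'M[k]_(m, r)) (h : 'rV[k]_n -> P 'cV[k]_r) :
  zopen U -> (forall i j, O_section a U (fun x => T x i j)) -> OM_section e U h ->
  OM_section (e + a * d%:Z) U (fun x => pm (T x) (h x)).
Proof.
move=> oU sT sh phi.
apply: (eq_O_section (f := fun x => \sum_i coord (vbasis fullv) i (h x) * phi (pm (T x) (vbasis fullv)`_i))).
  move=> x _; rewrite [h x in RHS]coord_full !linear_sum; apply: eq_bigr => i _.
  by rewrite !linearZ.
have /(OM_sectionP _ _ oU) sh' := sh.
apply: O_section_sum => // i _.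
apply: (O_sectionM (f := fun x => coord (vbasis fullv) i (h x))
  (g := fun x => phi (pm (T x) (vbasis fullv)`_i))); first exact: sh'.
have [N [p [L [ph pE]]]] := pm_poly phi (vbasis (fullv : {vspace P 'cV[k]_r}))`_i.
apply: (eq_O_section (f := fun x => p.@[fun i => \sum_a \sum_b T x a b * L i a b])).
  by move=> x _; rewrite pE.
apply: (O_section_meval (T := fun i x => \sum_a0 \sum_b T x a0 b * L i a0 b)) => // j.
apply: O_section_sum => // a' _; apply: O_section_sum => // b _.
by apply: eq_O_section (O_sectionZ (L j a' b) (sT a' b)) => x _; rewrite mulrC.
Qed.

(* [1 - v x] is the projection onto [ker x] along [v]. *)
Definition in_POmega x (s : P 'cV[k]_n) :=
  forall v : 'cV[k]_n, x *m v = 1%:M -> pm (1%:M - v *m x) s = s.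

Definition coord_locus (j : 'I_n) : region k n := fun x => x 0 j != 0.

Lemma zopen_coord_locus j : zopen (coord_locus j).
Proof.
have := zopen_nonzero_locus (dhomogX1 k j) isT; rewrite /nonzero_locus => h x xj.
have [|x0 [m [f [fm fx fU]]]] := h x; first by rewrite /peval mevalXU.
split=> //; exists m, f; split=> // y y0 /fU; rewrite /peval mevalXU; exact.
Qed.

Lemma O_section_coord U j : zopen U -> O_section 1 U (fun x => x 0 j).
Proof.
move=> oU; apply: eq_O_section (O_section_poly oU (dhomogX1 k j)) => x _.
by rewrite /peval mevalXU.
Qed.

Lemma O_section_coordV U j : zopen U -> (forall x, U x -> x 0 j != 0) ->
  O_section (- 1) U (fun x => (x 0 j)^-1).
Proof.
move=> oU Uj; apply: eq_O_section (O_section_inv oU (dhomogX1 k j) _) => x Ux.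
  by rewrite /peval mevalXU.
by rewrite /peval mevalXU; apply: Uj.
Qed.

(** The inclusion of the span of the basis vectors other than e_j; its transpose is the projection V
    -> V / V_j in coordinates. *)
Definition skip_mx j : 'M[k]_(n, n.-1) := \matrix_(a, i) (a == lift j i)%:R.

(* The projection onto [ker x] along [delta_mx j 0]. *)
Definition lift_ker j x : 'M[k]_n := 1%:M - (x 0 j)^-1 *: (delta_mx j 0 *m x).

(** The columns project the e_i, i <> j, to ker x; the factor 1 / x_j gives them degree -1, as Omega
    lies in V (x) O(-1). [Omega_chart_inv] is a left inverse of degree 1, and the opposite product
    is the projection [lift_ker]. *)
Definition Omega_chart j x := (x 0 j)^-1 *: (lift_ker j x *m skip_mx j).
Definition Omega_chart_inv j x := x 0 j *: (skip_mx j)^T.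

Lemma skip_mxK j : (skip_mx j)^T *m skip_mx j = 1%:M.
Proof.
apply/matrixP => a b; rewrite !mxE (bigD1 (lift j a)) //= !mxE eqxx mul1r.
rewrite big1 ?addr0 => [|c /negPf ca]; last by rewrite !mxE ca mul0r.
by rewrite (inj_eq lift_inj).
Qed.

Lemma skip_mx_delta j : (skip_mx j)^T *m delta_mx j (0 : 'I_1) = 0.
Proof.
apply/matrixP => a b; rewrite !mxE big1 // => c _; rewrite !mxE.
by case: eqP => [->|]; rewrite ?mul0r // eq_sym (negPf (neq_lift _ _)) mulr0.
Qed.

Lemma skip_mxKC j : skip_mx j *m (skip_mx j)^T = 1%:M - delta_mx j (0 : 'I_1) *m delta_mx 0 j.
Proof.
apply/matrixP => a b; rewrite mul_delta_mx !mxE.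
under eq_bigr do rewrite !mxE.
case: (unliftP j a) => [i|] ->; last first.
  rewrite big1 => [|i _]; last by rewrite (negPf (neq_lift _ _)) mul0r.
  by rewrite eqxx /= eq_sym subrr.
rewrite (bigD1 i) //= eqxx mul1r big1 ?addr0 => [|l li]; last first.
  by rewrite (inj_eq lift_inj) eq_sym (negPf li) mul0r.
by rewrite [_ == j]eq_sym (negPf (neq_lift _ _)) subr0 eq_sym.
Qed.

Lemma mulmx_delta_coord j x : x *m delta_mx j (0 : 'I_1) = (x 0 j)%:M.
Proof. by rewrite -colE; apply/matrixP => a b; rewrite !mxE !ord1 eqxx mulr1n. Qed.

Section Chart.
Variables (j : 'I_n) (x : 'rV[k]_n).
Hypothesis xj : x 0 j != 0.

Lemma lift_ker_proj : x *m ((x 0 j)^-1 *: delta_mx j 0) = 1%:M.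
Proof. by rewrite -scalemxAr mulmx_delta_coord scale_scalar_mx mulVf. Qed.

Lemma lift_kerE : lift_ker j x = 1%:M - ((x 0 j)^-1 *: delta_mx j 0) *m x.
Proof. by rewrite /lift_ker scalemxAl. Qed.

Lemma mulmx_lift_ker : x *m lift_ker j x = 0.
Proof. by rewrite lift_kerE mulmxBr mulmx1 mulmxA lift_ker_proj mul1mx subrr. Qed.

Lemma lift_ker_delta : lift_ker j x *m delta_mx j (0 : 'I_1) = 0.
Proof.
rewrite /lift_ker mulmxBl mul1mx -scalemxAl -mulmxA mulmx_delta_coord mul_mx_scalar.
by rewrite scalerA mulVf // scale1r subrr.
Qed.

Lemma lift_ker_skip : lift_ker j x *m (skip_mx j *m (skip_mx j)^T) = lift_ker j x.
Proof. by rewrite skip_mxKC mulmxBr mulmx1 mulmxA lift_ker_delta mul0mx subr0. Qed.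

Lemma skip_lift_ker : (skip_mx j)^T *m lift_ker j x = (skip_mx j)^T.
Proof.
by rewrite /lift_ker mulmxBr mulmx1 -scalemxAr mulmxA skip_mx_delta mul0mx scaler0 subr0.
Qed.

Lemma Omega_chartK : Omega_chart_inv j x *m Omega_chart j x = 1%:M.
Proof.
rewrite /Omega_chart /Omega_chart_inv -scalemxAl -scalemxAr scalerA divff // scale1r.
by rewrite mulmxA skip_lift_ker skip_mxK.
Qed.

Lemma Omega_chart_invK : Omega_chart j x *m Omega_chart_inv j x = lift_ker j x.
Proof.
rewrite /Omega_chart /Omega_chart_inv -scalemxAl -scalemxAr scalerA mulVf // scale1r.
by rewrite -mulmxA lift_ker_skip.
Qed.

Lemma mulmx_Omega_chart : x *m Omega_chart j x = 0.
Proof. by rewrite -scalemxAr mulmxA mulmx_lift_ker mul0mx scaler0. Qed.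

End Chart.

Section ChartSections.
Variables (j : 'I_n) (U : region k n).
Hypotheses (oU : zopen U) (Uj : forall x, U x -> x 0 j != 0).

Lemma O_section_lift_ker a b : O_section 0 U (fun x => lift_ker j x a b).
Proof.
apply: (eq_O_section (f := fun x => (a == b)%:R + (- (a == j)%:R) * ((x 0 j)^-1 * x 0 b))).
  move=> x _; rewrite /lift_ker !mxE big_ord1 !mxE andbT.
  by rewrite mulNr mulrCA; congr (_ + _); case: (a == b).
apply: O_sectionD; first exact: O_section_cst.
apply: O_sectionZ; rewrite -[X in O_section X](addNr (1 : int)).
by apply: O_sectionM; [apply: O_section_coordV | apply: O_section_coord].
Qed.

Lemma O_section_Omega_chart a b : O_section (-1) U (fun x => Omega_chart j x a b).
Proof.
apply: (eq_O_section (f := fun x => (x 0 j)^-1 * lift_ker j x a (lift j b))).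
  move=> x _; rewrite [RHS]mxE; congr (_ * _); rewrite [RHS]mxE (bigD1 (lift j b)) //=.
  rewrite [skip_mx j _ _]mxE eqxx mulr1 big1 ?addr0 // => c /negPf cb.
  by rewrite [skip_mx j _ _]mxE cb mulr0.
rewrite -[-1]addr0; apply: O_sectionM; first exact: O_section_coordV.
exact: O_section_lift_ker.
Qed.

Lemma O_section_Omega_chart_inv a b : O_section 1 U (fun x => Omega_chart_inv j x a b).
Proof.
apply: (eq_O_section (f := fun x => (skip_mx j)^T a b * x 0 j)).
  by move=> x _; rewrite [RHS]mxE mulrC.
by apply: O_sectionZ; apply: O_section_coord.
Qed.

End ChartSections.

Lemma matrix_functional m r (phi : 'Hom('M[k]_(m, r), k^o)) A :
  phi A = \sum_a \sum_b phi (delta_mx a b) * A a b.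
Proof.
rewrite {1}(matrix_sum_delta A) linear_sum; apply: eq_bigr => a _.
by rewrite linear_sum; apply: eq_bigr => b _; rewrite linearZ /= mulrC.
Qed.

Lemma OM_section_mx m r e U (T : 'rV[k]_n -> 'M[k]_(m, r)) : zopen U ->
  (forall a b, O_section e U (fun x => T x a b)) <-> OM_section e U T.
Proof.
move=> oU; split=> [sT phi|sT a b].
  apply: (eq_O_section (f := fun x => \sum_a \sum_b phi (delta_mx a b) * T x a b)).
    by move=> x _; rewrite [RHS]matrix_functional.
  apply: O_section_sum => // a _; apply: O_section_sum => // b _.
  exact: O_sectionZ.
have lin : linear (fun A : 'M[k]_(m, r) => A a b : k^o) by move=> c A B; rewrite !mxE.
pose L := GRing.isLinear.Build k 'M[k]_(m, r) k^o *:%R (fun A : 'M[k]_(m, r) => A a b : k^o) lin.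
pose F : {linear 'M[k]_(m, r) -> k^o} := HB.pack (fun A : 'M[k]_(m, r) => A a b : k^o) L.
by apply: eq_O_section (sT (linfun F)) => x _; rewrite lfunE.
Qed.

Lemma mulmx_O_section m r l e e' U (A : 'rV[k]_n -> 'M[k]_(m, r)) (B : 'rV[k]_n -> 'M[k]_(r, l)) :
  zopen U -> (forall a b, O_section e U (fun x => A x a b)) ->
  (forall a b, O_section e' U (fun x => B x a b)) ->
  forall a b, O_section (e + e') U (fun x => (A x *m B x) a b).
Proof.
move=> oU sA sB a b; apply: (eq_O_section (f := fun x => \sum_c A x a c * B x c b)).
  by move=> x _; rewrite mxE.
by apply: O_section_sum => // c _; apply: O_sectionM.
Qed.

Lemma Omega_frame_chart j U : zopen U -> (forall x, U x -> x 0 j != 0) ->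
  Omega_frame U (Omega_chart j).
Proof.
move=> oU Uj; split=> [i|V s oV VU [sV sx]|V a oV VU sa ta x Vx].
- split; first apply/OM_section_mx => // a b.
    apply: eq_O_section (O_section_Omega_chart oU Uj a i) => x _; by rewrite [RHS]mxE.
  move=> x Ux; rewrite colE mulmxA mulmx_Omega_chart ?mul0mx //; exact: Uj.
- have Vj x : V x -> x 0 j != 0 by move/VU/Uj.
  exists (fun x => Omega_chart_inv j x *m s x); split.
    apply/OM_section_mx => // a b; rewrite -[X in O_section X](subrr (1 : int)).
    apply: mulmx_O_section => //; last by apply/OM_section_mx.
    exact: O_section_Omega_chart_inv.
  move=> x Vx; rewrite mulmxA Omega_chart_invK ?Vj // lift_kerE mulmxBl mul1mx.
  by rewrite -mulmxA sx // mulmx0 subr0.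
have := congr1 (mulmx (Omega_chart_inv j x)) (ta x Vx).
by rewrite mulmxA Omega_chartK ?mul1mx ?mulmx0 //; apply/Uj/VU.
Qed.

(** Forward: x kills the columns of a frame t, so (1 - v x) t = t for every admissible v, and the
    entries of t have degree -1. Backward: where x_j is nonzero, P of the chart composed with P of
    its inverse is P of a projection onto ker x, which fixes s x; so the chart is a frame exhibiting
    s. *)
Theorem POmega_sectionP e U (s : 'rV[k]_n -> P 'cV[k]_n) : zopen U ->
  POmega_section e U s <->
  OM_section (e - d%:Z) U s /\ forall x, U x -> in_POmega x (s x).
Proof.
move=> oU; split=> [h|[sU sx]].
  split=> [phi|x Ux v xv].
    apply: O_section_local => x Ux; have [W [r [t [u [oW Wx WU [t1 _ _] [sh sE]]]]]] := h x Ux.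
    exists W; split=> //; have -> : e - d%:Z = e + (-1) * d%:Z by rewrite mulN1r.
    have st a b : O_section (-1) W (fun x => t x a b).
      have [/(OM_section_mx _ _ oW) st _] := t1 b.
      by apply: eq_O_section (st a 0) => y _; rewrite mxE.
    by apply: eq_O_section (OM_section_pm oW st sh phi) => y Wy; rewrite sE.
  have [W [r [t [u [oW Wx WU [t1 _ _] [sh sE]]]]]] := h x Ux.
  rewrite sE // -/(pm (t x)) -pmM mulmxBl mul1mx -mulmxA; suff -> : x *m t x = 0.
    by rewrite mulmx0 subr0.
  apply/matrixP => a b; have [_ /(_ x Wx)/matrixP/(_ a 0)] := t1 b.
  by rewrite !mxE => h0; rewrite -[RHS]h0; apply: eq_bigr => c _; rewrite mxE.
move=> x Ux; have [x0 _] := oU x Ux; have [j xj] := neq0_coord x0.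
pose W y := U y /\ coord_locus j y.
have oW : zopen W by apply: zopenI => //; apply: zopen_coord_locus.
have Wj y : W y -> y 0 j != 0 by case.
exists W, n.-1, (Omega_chart j), (fun y => pm (Omega_chart_inv j y) (s y)); split=> //.
- by move=> y [].
- exact: Omega_frame_chart.
split.
  have {1}-> : e = (e - d%:Z) + 1 * d%:Z by rewrite mul1r subrK.
  apply: OM_section_pm => //; first exact: O_section_Omega_chart_inv.
  by apply: OM_sectionW sU => // y [].
move=> y Wy; have yj := Wj y Wy; case: Wy => Uy _.
rewrite -/(pm (Omega_chart j y)) -pmM Omega_chart_invK // lift_kerE sx //.
exact: lift_ker_proj.
Qed.

End PolynomialFunctor.

(** * Prism homotopy and Čech classes *)

(** f p a stands for the signed a-th face of the p-th prism. The faces a = p and a = p + 1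
    telescope; all others are prisms over a face of the base, and the triangles a < p and a > p + 1
    reassemble the full double sum of X. *)
Lemma prism_sum (M : zmodType) l (f : nat -> nat -> M) (C : nat -> M) (X : nat -> nat -> M) :
  (forall p a, (a < p)%N -> (p < l.+1)%N -> f p a = - X p.-1 a) ->
  (forall p, (p < l.+1)%N -> f p p = C p) ->
  (forall p, (p < l.+1)%N -> f p p.+1 = - C p.+1) ->
  (forall p a, (p.+1 < a)%N -> (a < l.+2)%N -> f p a = - X p a.-1) ->
  \sum_(0 <= p < l.+1) \sum_(0 <= a < l.+2) f p a =
  C 0%N - C l.+1 - \sum_(0 <= p < l) \sum_(0 <= a < l.+1) X p a.
Proof.
move=> f1 f2 f3 f4.
have E p : (p < l.+1)%N -> \sum_(0 <= a < l.+2) f p a =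
    (C p - C p.+1) - (\sum_(0 <= a < p) X p.-1 a + \sum_(p.+1 <= a < l.+1) X p a).
  move=> pl; rewrite (big_cat_nat (n := p)) ?(ltnW (ltn_trans pl _)) //=.
  rewrite [\sum_(p <= _ < _) _]big_ltn ?(ltn_trans pl) //.
  rewrite [\sum_(p.+1 <= _ < _) _]big_ltn ?ltnS // f2 // f3 // big_add1 /=.
  have -> : \sum_(0 <= a < p) f p a = - \sum_(0 <= a < p) X p.-1 a.
    by rewrite -sumrN; apply: eq_big_nat => a /andP[_ ap]; rewrite f1.
  have -> : \sum_(p.+1 <= a < l.+1) f p a.+1 = - \sum_(p.+1 <= a < l.+1) X p a.
    by rewrite -sumrN; apply: eq_big_nat => a /andP[pa al]; rewrite f4.
  by rewrite opprD !addrA; congr (_ - _); rewrite -addrA addrC.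
rewrite (eq_big_nat _ _ (F2 := fun p => (C p - C p.+1) -
  (\sum_(0 <= a < p) X p.-1 a + \sum_(p.+1 <= a < l.+1) X p a))); last by move=> p /andP[_] /E.
rewrite sumrB; congr (_ - _).
  under eq_bigr do rewrite -opprB.
  by rewrite sumrN telescope_sumr // opprB.
rewrite big_split /= big_ltn // (big_geq (m := 0) (n := 0)) // add0r big_add1 /=.
rewrite [X in _ + X]big_nat_recr //= [X in _ + (_ + X)]big_geq // addr0 -big_split /=.
apply: eq_big_nat => p /andP[_ pl].
by rewrite [RHS](big_cat_nat (n := p.+1)) //= ltnS ltnW.
Qed.

(** Tuples are treated as functions on [nat] here, which reduces identities between faces to
    arithmetic of indices. *)
Definition face {T} (a : nat) (v : nat -> T) (i : nat) := v (bump a i).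

Section Prism.
Variables (K J : Type) (r r' : J -> K).

(** The tuple (r u_0, ..., r u_p, r' u_p, r' u_(p+1), ...), the p-th simplex of a triangulated
    prism; [split_tuple] gives the faces shared by consecutive simplices. *)
Definition prism (p : nat) (u : nat -> J) (i : nat) : K :=
  if (i <= p)%N then r (u i) else r' (u i.-1).
Definition split_tuple (p : nat) (u : nat -> J) (i : nat) : K :=
  if (i < p)%N then r (u i) else r' (u i).

Lemma face_prism_lt a p u i : (a < p)%N -> face a (prism p u) i = prism p.-1 (face a u) i.
Proof.
case: p => // p ap; rewrite /face /prism /bump /=; case: (leqP i p) => ip.
  by have -> : ((a <= i) + i <= p.+1)%N by case: (a <= i)%N; lia.
have -> : (a <= i)%N by lia.
have -> : (a <= i.-1)%N by lia.
have -> : (true + i <= p.+1)%N = false by lia.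
by congr (r' (u _)); lia.
Qed.

Lemma face_prism_gt a p u i : (p.+1 < a)%N -> face a (prism p u) i = prism p (face a.-1 u) i.
Proof.
case: a => // a pa; rewrite /face /prism /bump /=; case: (leqP a.+1 i) => ai.
  have -> : (true + i <= p)%N = false by lia.
  have -> : (i <= p)%N = false by lia.
  have -> : (a <= i.-1)%N by lia.
  by congr (r' (u _)); lia.
rewrite add0n; case: (leqP i p) => ip.
  by have -> : (a <= i)%N = false by lia.
by have -> : (a <= i.-1)%N = false by lia.
Qed.

Lemma face_prism_eq p u i : face p (prism p u) i = split_tuple p u i.
Proof.
rewrite /face /prism /split_tuple /bump; case: (leqP p i) => ip; rewrite ?add1n ?add0n.
  by rewrite ltnNge ip.
by rewrite ltnW // ip.
Qed.

Lemma face_prism_succ p u i : face p.+1 (prism p u) i = split_tuple p.+1 u i.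
Proof.
rewrite /face /prism /split_tuple /bump ltnS; case: (leqP p.+1 i) => ip; rewrite ?add1n ?add0n.
  by rewrite (leqNgt i.+1) ltnS (ltnW ip) /= leqNgt ip.
by rewrite -ltnS ip.
Qed.

End Prism.

Definition ffun_of m (T : Type) (v : nat -> T) : {ffun 'I_m -> T} := [ffun i : 'I_m => v i].

Lemma eq_ffun_of m T (v w : nat -> T) : (forall i, (i < m)%N -> v i = w i) ->
  ffun_of m v = ffun_of m w.
Proof. by move=> h; apply/ffunP => i; rewrite !ffunE h. Qed.

Lemma ffun_of_face m T (v : nat -> T) (a : 'I_m.+1) :
  [ffun j => ffun_of m.+1 v (lift a j)] = ffun_of m (face a v).
Proof. by apply/ffunP => j; rewrite !ffunE. Qed.

Lemma ffun_ofP m T (s : {ffun 'I_m.+1 -> T}) : ffun_of m.+1 (fun i => s (inord i)) = s.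
Proof. by apply/ffunP => i; rewrite ffunE inord_val. Qed.

Section CechComplex.
Variables (k : closedFieldType) (n : nat) (M : lmodType k).
Implicit Types (x : 'rV[k]_n).

Lemma coboundary_ffun_of (I : Type) q (c : cochain n M I q) (v : nat -> I) x :
  coboundary c (ffun_of q.+2 v) x =
  \sum_(0 <= a < q.+2) (-1) ^+ a *: c (ffun_of q.+1 (face a v)) x.
Proof. by rewrite big_mkord; apply: eq_bigr => a _; rewrite ffun_of_face. Qed.

Section Homotopy.
Variables (K J : Type) (r r' : J -> K).

Definition homotopy q (c : cochain n M K q.+1) : cochain n M J q :=
  fun s x => \sum_(0 <= p < q.+1)
    (-1) ^+ p *: c (ffun_of q.+2 (prism r r' p (fun i => s (inord i)))) x.

Lemma homotopy_ffun_of q (c : cochain n M K q.+1) u x : homotopy c (ffun_of q.+1 u) x =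
  \sum_(0 <= p < q.+1) (-1) ^+ p *: c (ffun_of q.+2 (prism r r' p u)) x.
Proof.
apply: eq_big_nat => p /andP[_ pq]; congr (_ *: c _ x); apply: eq_ffun_of => i iq.
rewrite /prism; case: ifP => ip; rewrite ffunE inordK //; lia.
Qed.

(** The vanishing of the coboundary of c is needed only on the prisms over u; what [prism_sum]
    leaves is the difference of the two ends and the coboundary of the homotopy. *)
Lemma homotopyP q (c : cochain n M K q.+1) (u : nat -> J) x :
  (forall p, (p < q.+2)%N -> coboundary c (ffun_of q.+3 (prism r r' p u)) x = 0) ->
  c (ffun_of q.+2 (r' \o u)) x - c (ffun_of q.+2 (r \o u)) x =
  coboundary (homotopy c) (ffun_of q.+2 u) x.
Proof.
move=> dc.
pose f p a := (-1) ^+ (p + a) *: c (ffun_of q.+2 (face a (prism r r' p u))) x.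
pose C p := c (ffun_of q.+2 (split_tuple r r' p u)) x.
pose X p a := (-1) ^+ (p + a) *: c (ffun_of q.+2 (prism r r' p (face a u))) x.
have := @prism_sum M q.+1 f C X.
have -> : \sum_(0 <= p < q.+2) \sum_(0 <= a < q.+3) f p a = 0.
  rewrite big_nat big1 // => p /andP[_ pq]; have := dc p pq.
  rewrite coboundary_ffun_of => /(congr1 (fun z => (-1) ^+ p *: z)).
  rewrite scaler0 scaler_sumr => h; rewrite -[RHS]h; apply: eq_bigr => a _.
  by rewrite scalerA -exprD.
move=> h; have {}h : C 0%N - C q.+2 = \sum_(0 <= p < q.+1) \sum_(0 <= a < q.+2) X p a.
  apply/eqP; rewrite -subr_eq0 -h //.
  - move=> p a ap pq; rewrite /f /X -scaleNr; congr (_ *: c _ x).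
      by case: p ap {pq} => // p _; rewrite addSn exprS mulN1r.
    by apply: eq_ffun_of => i _; apply: face_prism_lt.
  - move=> p pq; rewrite /f /C addnn -mul2n exprM sqrrN expr1n expr1n scale1r; congr (c _ x).
    by apply: eq_ffun_of => i _; apply: face_prism_eq.
  - move=> p pq; rewrite /f /C addnS exprS addnn -mul2n exprM sqrrN expr1n expr1n mulr1 scaleN1r.
    by congr (- c _ x); apply: eq_ffun_of => i _; apply: face_prism_succ.
  move=> p a pa aq; rewrite /f /X -scaleNr; congr (_ *: c _ x).
    by case: a pa {aq} => // a _; rewrite addnS exprS mulN1r.
  by apply: eq_ffun_of => i _; apply: face_prism_gt.
have -> : c (ffun_of q.+2 (r' \o u)) x = C 0%N by [].
have -> : c (ffun_of q.+2 (r \o u)) x = C q.+2.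
  by congr (c _ x); apply: eq_ffun_of => i iq; rewrite /split_tuple iq.
rewrite h coboundary_ffun_of exchange_big_nat; apply: eq_bigr => a _.
rewrite homotopy_ffun_of scaler_sumr; apply: eq_bigr => p _.
by rewrite /X scalerA -exprD addnC.
Qed.

Lemma homotopy0 (c : cochain n M K 0) (u : nat -> J) x :
  coboundary c (ffun_of 2 (prism r r' 0 u)) x = 0 ->
  c (ffun_of 1 (r' \o u)) x - c (ffun_of 1 (r \o u)) x = 0.
Proof.
rewrite coboundary_ffun_of !big_nat_recr //= big_geq // add0r expr0 expr1 scale1r scaleN1r => <-.
congr (c _ x - c _ x); apply: eq_ffun_of => -[] //.
Qed.
End Homotopy.

End CechComplex.

Section CechCohomology.
Variables (k : closedFieldType) (n : nat) (M : lmodType k).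
Variable F : region k n -> ('rV[k]_n -> M) -> Prop.
Implicit Types (x : 'rV[k]_n).

(** The first clause combines restriction with a change of values outside V, since only the values
    on the region matter. *)
Definition linear_presheaf := [/\
  forall U V s t, zopen U -> zopen V -> sub_region V U -> (forall x, V x -> s x = t x) ->
    F U s -> F V t,
  forall U, zopen U -> F U (fun _ => 0),
  forall U s t, zopen U -> F U s -> F U t -> F U (fun x => s x + t x)
  & forall U s c, zopen U -> F U s -> F U (fun x => c *: s x)].

Hypothesis psF : linear_presheaf.

Lemma presheafW U V s t : F U s -> zopen U -> zopen V -> sub_region V U ->
  (forall x, V x -> s x = t x) -> F V t.
Proof. by case: psF => res _ _ _ Fs oU oV VU st; apply: (res U V s t). Qed.

Section Cover.
Variables (I : Type) (U : I -> region k n).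
Hypothesis oU : forall i, zopen (U i).

Lemma zopen_inter_cover q (s : {ffun 'I_q.+1 -> I}) : zopen (inter U s).
Proof. exact: zopen_inter. Qed.

Lemma inter_face q (s : {ffun 'I_q.+2 -> I}) (a : 'I_q.+2) :
  sub_region (inter U s) (inter U [ffun j => s (lift a j)]).
Proof. by move=> x sx i; rewrite ffunE. Qed.

Lemma eq_coboundary q (c c' : cochain n M I q) :
  cochain_eq U c c' -> cochain_eq U (coboundary c) (coboundary c').
Proof.
by move=> h s x sx; apply: eq_bigr => a _; rewrite h //; apply: inter_face.
Qed.

Lemma coboundaryD q (c c' : cochain n M I q) s x :
  coboundary (fun s x => c s x + c' s x) s x = coboundary c s x + coboundary c' s x.
Proof. by rewrite /coboundary -big_split; apply: eq_bigr => a _; rewrite scalerDr. Qed.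

Lemma coboundaryZ q l (c : cochain n M I q) s x :
  coboundary (fun s x => l *: c s x) s x = l *: coboundary c s x.
Proof.
by rewrite /coboundary scaler_sumr; apply: eq_bigr => a _; rewrite !scalerA mulrC.
Qed.

Lemma coboundary0 q (s : {ffun 'I_q.+2 -> I}) x :
  coboundary ((fun _ _ => 0) : cochain n M I q) s x = 0.
Proof. by rewrite /coboundary big1 // => a _; rewrite scaler0. Qed.

Lemma eq_is_cochain q (c c' : cochain n M I q) :
  cochain_eq U c c' -> is_cochain F U c -> is_cochain F U c'.
Proof.
move=> cc' h s; apply: presheafW (h s) _ _ _ _ => //; try exact: zopen_inter_cover.
exact: cc'.
Qed.

Lemma is_cochain0 q : is_cochain F U (fun (_ : {ffun 'I_q.+1 -> I}) _ => 0).
Proof. by case: psF => _ h _ _ s; apply/h/zopen_inter_cover. Qed.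

Lemma is_cochainD q (c c' : cochain n M I q) : is_cochain F U c -> is_cochain F U c' ->
  is_cochain F U (fun s x => c s x + c' s x).
Proof. by case: psF => _ _ h _ cF c'F s; apply: h (cF s) (c'F s); apply: zopen_inter_cover. Qed.

Lemma is_cochainZ q l (c : cochain n M I q) : is_cochain F U c ->
  is_cochain F U (fun s x => l *: c s x).
Proof. by case: psF => _ _ _ h cF s; apply: h (cF s); apply: zopen_inter_cover. Qed.

Lemma eq_is_cocycle q (c c' : cochain n M I q) :
  cochain_eq U c c' -> is_cocycle F U c -> is_cocycle F U c'.
Proof.
move=> cc' [cF dc]; split; first exact: eq_is_cochain cF.
by move=> s x sx; rewrite -(eq_coboundary cc') // dc.
Qed.

Lemma is_cocycleD q (c c' : cochain n M I q) : is_cocycle F U c -> is_cocycle F U c' ->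
  is_cocycle F U (fun s x => c s x + c' s x).
Proof.
move=> [cF dc] [c'F dc']; split; first exact: is_cochainD.
by move=> s x sx; rewrite coboundaryD dc // dc' // addr0.
Qed.

Lemma is_cocycleZ q l (c : cochain n M I q) : is_cocycle F U c ->
  is_cocycle F U (fun s x => l *: c s x).
Proof.
move=> [cF dc]; split; first exact: is_cochainZ.
by move=> s x sx; rewrite coboundaryZ dc // scaler0.
Qed.

Lemma is_cocycle0 q : is_cocycle F U (fun (_ : {ffun 'I_q.+1 -> I}) _ => 0).
Proof. by split; [apply: is_cochain0 | move=> s x _; rewrite coboundary0]. Qed.

Lemma eq_is_coboundary q (c c' : cochain n M I q) :
  cochain_eq U c c' -> is_coboundary F U c -> is_coboundary F U c'.
Proof.
case: q c c' => [|q] c c' cc' /=; first by move=> h s x sx; rewrite -cc' // h.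
by move=> [b [bF cb]]; exists b; split=> // s x sx; rewrite -cc' // cb.
Qed.

Lemma is_coboundary0 q : is_coboundary F U (fun (_ : {ffun 'I_q.+1 -> I}) _ => 0).
Proof.
case: q => [|q] //=; exists (fun _ _ => 0); split; first exact: is_cochain0.
by move=> s x _; rewrite coboundary0.
Qed.

Lemma is_coboundaryD q (c c' : cochain n M I q) :
  is_coboundary F U c -> is_coboundary F U c' -> is_coboundary F U (fun s x => c s x + c' s x).
Proof.
case: q c c' => [|q] c c' /=; first by move=> h h' s x sx; rewrite h // h' // addr0.
move=> [b [bF cb]] [b' [b'F cb']]; exists (fun s x => b s x + b' s x).
by split; [apply: is_cochainD | move=> s x sx; rewrite coboundaryD cb // cb'].
Qed.

Lemma is_coboundaryZ q l (c : cochain n M I q) :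
  is_coboundary F U c -> is_coboundary F U (fun s x => l *: c s x).
Proof.
case: q c => [|q] c /=; first by move=> h s x sx; rewrite h // scaler0.
move=> [b [bF cb]]; exists (fun s x => l *: b s x).
by split; [apply: is_cochainZ | move=> s x sx; rewrite coboundaryZ cb].
Qed.

Lemma is_coboundaryN q (c : cochain n M I q) :
  is_coboundary F U c -> is_coboundary F U (fun s x => - c s x).
Proof.
by move/(is_coboundaryZ (-1)); apply: eq_is_coboundary => s x _; rewrite scaleN1r.
Qed.

End Cover.

Section Refinement.
Variables (K J : Type) (U : K -> region k n) (W : J -> region k n) (r : J -> K).
Hypotheses (oU : forall i, zopen (U i)) (oW : forall j, zopen (W j)).
Hypothesis rW : forall j, sub_region (W j) (U (r j)).

Lemma inter_refine q (s : {ffun 'I_q.+1 -> J}) : sub_region (inter W s) (inter U [ffun i => r (s i)]).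
Proof. by move=> x sx i; rewrite ffunE; apply: rW. Qed.

Lemma is_cochain_refine q (c : cochain n M K q) : is_cochain F U c -> is_cochain F W (refine r c).
Proof.
move=> cF s; apply: presheafW (cF [ffun i => r (s i)]) _ _ _ _ => //; try exact: zopen_inter_cover.
exact: inter_refine.
Qed.

Lemma coboundary_refine q (c : cochain n M K q) s x :
  coboundary (refine r c) s x = refine r (coboundary c) s x.
Proof.
apply: eq_bigr => a _; congr (_ *: c _ x).
by apply/ffunP => i; rewrite !ffunE.
Qed.

Lemma is_coboundary_refine q (c : cochain n M K q) :
  is_coboundary F U c -> is_coboundary F W (refine r c).
Proof.
case: q c => [|q] c /=.
  by move=> h s x sx; apply: h; apply: inter_refine.
move=> [b [bF cb]]; exists (refine r b); split; first exact: is_cochain_refine.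
by move=> s x sx; rewrite coboundary_refine; apply: cb; apply: inter_refine.
Qed.

End Refinement.

(** The prism homotopy applies because W_j lies in both U_(r j) and U_(r' j), so every mixed tuple
    is defined on the intersection of the W_j. *)
Lemma cocycle_refine (K J : Type) (U : K -> region k n) (W : J -> region k n)
    (r r' : J -> K) q (c : cochain n M K q) :
  (forall i, zopen (U i)) -> (forall j, zopen (W j)) ->
  (forall j, sub_region (W j) (U (r j))) -> (forall j, sub_region (W j) (U (r' j))) ->
  is_cocycle F U c ->
  is_coboundary F W (fun s x => refine r' c s x - refine r c s x).
Proof.
move=> oU oW rW r'W [cF dc].
have prismW p m (s : {ffun 'I_m.+1 -> J}) : sub_region (inter W s)
    (inter U (ffun_of m.+2 (prism r r' p (fun i => s (inord i))))).
  move=> x sx i; rewrite ffunE /prism; case: ifP => _; [apply: rW | apply: r'W]; exact: sx.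
have refineE m (c' : cochain n M K m) (s : {ffun 'I_m.+1 -> J}) (r0 : J -> K) x :
    refine r0 c' s x = c' (ffun_of m.+1 (r0 \o (fun i => s (inord i)))) x.
  by congr (c' _ x); apply/ffunP => i; rewrite !ffunE /= inord_val.
case: q c cF dc => [|q] c cF dc /=.
  move=> s x sx; rewrite !refineE; apply: homotopy0; apply: dc; exact: prismW.
exists (homotopy r r' c); split.
  move=> s; rewrite /homotopy.
  have [res h0 hD hZ] := psF; have os : zopen (inter W s) by exact: zopen_inter_cover.
  elim: (index_iota _ _) => [|p l IH].
    by apply: (presheafW (h0 _ os) os os) => // x _; rewrite big_nil.
  set t := ffun_of q.+2 (prism r r' p (fun i => s (inord i))).
  have h1 : F (inter W s) (c t).
    by apply: (presheafW (cF t) (zopen_inter (s := t) oU) os) => //; apply: prismW.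
  apply: (presheafW (hD _ _ _ os (hZ _ _ ((-1) ^+ p) os h1) IH) os os) => // x _.
  by rewrite big_cons.
move=> s x sx; rewrite !refineE homotopyP ?ffun_ofP // => p _.
by apply: dc; apply: prismW.
Qed.

Lemma zcoverI (I J : Type) (U : I -> region k n) (W : J -> region k n) :
  zcover U -> zcover W -> zcover (fun ij : I * J => fun x => U ij.1 x /\ W ij.2 x).
Proof.
move=> [oU cU] [oW cW]; split=> [[i j]|x x0]; first exact: zopenI.
by have [[i Ui] [j Wj]] := (cU x x0, cW x x0); exists (i, j).
Qed.

Lemma same_class_sym q (z z' : cech_rep n M q) : same_class F z z' -> same_class F z' z.
Proof.
move=> [J [W [r [r' [[oW cW] rW r'W h]]]]]; exists J, W, r', r; split=> //.
by apply: eq_is_coboundary (is_coboundaryN oW h) => s x _; rewrite opprB.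
Qed.

(** On the product of the two comparison covers there are two refinement maps to the cover of z'; as
    z' is a cocycle, [cocycle_refine] bridges them. *)
Lemma same_class_trans q (z z' z'' : cech_rep n M q) : is_class F z' ->
  same_class F z z' -> same_class F z' z'' -> same_class F z z''.
Proof.
move=> [[oU cU] zc] [J [W [r [r' [cW rW r'W h]]]]] [J' [W' [s [s' [cW' sW s'W h']]]]].
have cc := zcoverI cW cW'; have [oV _] := cc; have [oW _] := cW; have [oW' _] := cW'.
exists (J * J')%type, (fun ij x => W ij.1 x /\ W' ij.2 x), (fun j => r j.1), (fun j => s' j.2); split=> //.
- by move=> [j j'] x [/rW].
- by move=> [j j'] x [_ /s'W].
have W1 (j : J * J') : sub_region (fun x => W j.1 x /\ W' j.2 x) (W j.1) by move=> x [].
have W2 (j : J * J') : sub_region (fun x => W j.1 x /\ W' j.2 x) (W' j.2) by move=> x [].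
have h1 := is_coboundary_refine oW oV W1 h.
have h2 := is_coboundary_refine oW' oV W2 h'.
have h3 : is_coboundary F (fun ij : J * J' => fun x => W ij.1 x /\ W' ij.2 x)
    (fun t x => refine (fun j => r' j.1) (@ccoch _ _ _ _ z') t x
              - refine (fun j => s j.2) (@ccoch _ _ _ _ z') t x).
  apply: (@cocycle_refine _ _ (@ccov _ _ _ _ z')) => //.
    by move=> [j j'] x [_ /sW].
  by move=> [j j'] x [/r'W].
apply: eq_is_coboundary (is_coboundaryD oV (is_coboundaryD oV h1 h3) h2) => t x tx.
have E (T T' T'' : Type) (c : cochain n M T'' q) (f : T -> T') (g : T' -> T'') u :
    refine f (refine g c) u x = refine (fun j => g (f j)) c u x.
  by congr (c _ x); apply/ffunP => i; rewrite !ffunE.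
have E2 (T T' : Type) (c c' : cochain n M T q) (f : T' -> T) u :
    refine f (fun s x => c s x - c' s x) u x = refine f c u x - refine f c' u x by [].
by rewrite !E2 !E !addrA !subrK.
Qed.

Lemma same_class_refine (I : Type) (U : I -> region k n) (J : Type) (W : J -> region k n)
    (r : J -> I) q (c : cochain n M I q) :
  zcover W -> (forall j, sub_region (W j) (U (r j))) ->
  same_class F (CechRep U c) (CechRep W (refine r c)).
Proof.
move=> cW rW; exists J, W, r, id; split=> //; first by move=> j x.
have [oW _] := cW; have h0 := @is_coboundary0 J W oW q.
apply: eq_is_coboundary h0 => s x sx /=.
by apply/esym/eqP; rewrite subr_eq0; apply/eqP; congr (c _ x); apply/ffunP => i; rewrite !ffunE.
Qed.

Lemma same_class_coboundary (I : Type) (U : I -> region k n) q (c c' : cochain n M I q) :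
  zcover U -> is_coboundary F U (fun s x => c s x - c' s x) ->
  same_class F (CechRep U c) (CechRep U c').
Proof.
move=> cU h; exists I, U, id, id; split=> //; try by move=> j x.
apply: eq_is_coboundary h => s x sx /=.
by congr (c _ x - c' _ x); apply/ffunP => i; rewrite !ffunE.
Qed.

End CechCohomology.

(** * Reduction to the standard cover *)

Section StandardCover.
Variables (k : closedFieldType) (d : nat) (P : poly_functor k d) (n : nat).
Implicit Types (U V W : region k n) (x y : 'rV[k]_n) (e : int).
Local Notation M := (P 'cV[k]_n).

Lemma pm_add m r (A : 'M[k]_(m, r)) s t : pm P A (s + t) = pm P A s + pm P A t.
Proof. exact: linearD. Qed.
Lemma pm_scale m r (A : 'M[k]_(m, r)) c s : pm P A (c *: s) = c *: pm P A s.
Proof. exact: linearZ. Qed.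
Lemma pm_zero m r (A : 'M[k]_(m, r)) : pm P A 0 = 0.
Proof. exact: linear0. Qed.
Lemma pm_sum m r (A : 'M[k]_(m, r)) (T : Type) (l : seq T) (Q : pred T) F :
  pm P A (\sum_(t <- l | Q t) F t) = \sum_(t <- l | Q t) pm P A (F t).
Proof. exact: linear_sum. Qed.

Lemma in_POmega0 x : in_POmega x (0 : M).
Proof. by move=> v _; rewrite pm_zero. Qed.

Lemma in_POmegaD x (s t : M) : in_POmega x s -> in_POmega x t -> in_POmega x (s + t).
Proof. by move=> sx tx v xv; rewrite pm_add sx ?tx. Qed.

Lemma in_POmegaZ x c (s : M) : in_POmega x s -> in_POmega x (c *: s).
Proof. by move=> sx v xv; rewrite pm_scale sx. Qed.

Lemma OM_section_cstZ (V : vectType k) e U c (s : 'rV[k]_n -> V) :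
  zopen U -> OM_section e U s -> OM_section e U (fun x => c *: s x).
Proof. by move=> oU sU; rewrite -[e]add0r; apply: OM_sectionZ => //; apply: O_section_cst. Qed.

Lemma POmega_presheaf e : linear_presheaf (@POmega_section k n d P e).
Proof.
split=> [U V s t oU oV VU st|U oU|U s t oU|U s c oU].
- move=> /(POmega_sectionP _ _ oU) [sU sx]; apply/POmega_sectionP => //; split.
    by apply: eq_OM_section (OM_sectionW oV VU sU).
  by move=> x Vx; rewrite -st //; apply/sx/VU.
- apply/POmega_sectionP => //; split; first exact: OM_section0.
  by move=> x _; apply: in_POmega0.
- move=> /(POmega_sectionP _ _ oU) [sU sx] /(POmega_sectionP _ _ oU) [tU tx].
  apply/POmega_sectionP => //; split; first exact: OM_sectionD.
  by move=> x Ux; apply: in_POmegaD; [apply: sx | apply: tx].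
move=> /(POmega_sectionP _ _ oU) [sU sx]; apply/POmega_sectionP => //; split.
  exact: OM_section_cstZ.
by move=> x Ux; apply/in_POmegaZ/sx.
Qed.

(** For each j, the combinations of finitely many forms whose loci lie in members of the cover form
    an ideal without common zero where x_j is nonzero; a power of X_j thus involves finitely many
    forms, and these cover D(x_j). *)
Lemma finite_cover (I : Type) (U : I -> region k n) : zcover U ->
  exists (T : finType) (f : T -> {mpoly k[n]}) (D : T -> nat) (i : T -> I),
    [/\ forall a, f a \is (D a).-homog, forall a, (0 < D a)%N,
        forall a, sub_region (nonzero_locus (f a)) (U (i a))
      & forall x, x != 0 -> exists a, peval (f a) x != 0].
Proof.
move=> [oU cU].
pose good (T : finType) (f : T -> {mpoly k[n]}) (D : T -> nat) (i : T -> I) := forall a,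
  [/\ f a \is (D a).-homog, (0 < D a)%N & sub_region (nonzero_locus (f a)) (U (i a))].
have H (j : 'I_n) : exists (T : finType), exists f D i, @good T f D i /\
    forall x, x 0 j != 0 -> exists a, peval (f a) x != 0.
  pose J p := exists (T : finType) f D i (g : T -> {mpoly k[n]}),
    @good T f D i /\ p = \sum_a g a * f a.
  have idJ : ideal J.
    split=> [|p q [T [f [D [i [g [h ->]]]]]] [T' [f' [D' [i' [g' [h' ->]]]]]]|r p].
    - exists void, (of_void _), (of_void _), (of_void _), (of_void _).
      by split=> [[]|]; rewrite big1 // => -[].
    - exists (T + T')%type, (fun a => match a with inl b => f b | inr b => f' b end),
        (fun a => match a with inl b => D b | inr b => D' b end),
        (fun a => match a with inl b => i b | inr b => i' b end),
        (fun a => match a with inl b => g b | inr b => g' b end).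
      by split=> [[]|] //; rewrite big_sumType.
    move=> [T [f [D [i [g [h ->]]]]]]; exists T, f, D, i, (fun a => r * g a); split=> //.
    by rewrite mulr_sumr; apply: eq_bigr => a _; rewrite mulrA.
  have [v|m [T [f [D [i [g [h E]]]]]]] := nullstellensatz idJ (F := 'X_j).
    rewrite mevalXU => vj; pose x : 'rV[k]_n := \row_l v l.
    have ev p : peval p x = p.@[v] by apply: meval_eq => l; rewrite mxE.
    have [|i Ui] := cU x; first by apply: contraNneq vj => /rowP/(_ j); rewrite !mxE => ->.
    have [_ [m [f [fm fx fU]]]] := oU i x Ui.
    (* The factor X_j makes the degree positive, so that the locus avoids the origin. *)
    exists (f * 'X_j); split; last by rewrite mevalM mevalXU mulf_neq0 // -ev.
    exists unit, (fun _ => f * 'X_j), (fun _ => m.+1), (fun _ => i), (fun _ => 1).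
    split; last by rewrite (big_pred1 tt) ?mul1r // => -[].
    have h : f * 'X_j \is (m.+1).-homog.
      by rewrite -addn1; apply: dhomogM => //; exact: dhomogX1.
    move=> _; split=> // y Fy; apply: fU; first exact: peval_homog_neq0 h _ Fy.
    by move: Fy; rewrite /nonzero_locus pevalM mulf_eq0 negb_or => /andP[].
  exists T, f, D, i; split=> // x xj; apply: NNPP => nx.
  have : peval ('X_j ^+ m) x = 0.
    rewrite E /peval raddf_sum big1 // => a _; rewrite /= mevalM.
    suff -> : (f a).@[x 0] = 0 by rewrite mulr0.
    by apply/eqP/negPn/negP => fa; apply: nx; exists a.
  by rewrite pevalX /peval mevalXU => /eqP; rewrite expf_eq0 (negPf xj) andbF.
have [T HT] := fin_all_exists H; have [f {}HT] := fin_all_exists HT.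
have [D {}HT] := fin_all_exists HT; have [i {}HT] := fin_all_exists HT.
exists {j : 'I_n & T j}, (fun a => f (tag a) (tagged a)), (fun a => D (tag a) (tagged a)),
  (fun a => i (tag a) (tagged a)); split=> [[j a]|[j a]|[j a]|x /neq0_coord[j xj]] /=.
- by have [/(_ a)[]] := HT j.
- by have [/(_ a)[]] := HT j.
- by have [/(_ a)[]] := HT j.
by have [_ /(_ x xj)[a fa]] := HT j; exists (Tagged T a).
Qed.

(** The successor makes the exponent exceed every [m i], so both sides vanish where F does and the
    identity holds for all x, not only on the locus of F. *)
Lemma OM_section_global (V : vectType k) F D e (h : 'rV[k]_n -> V) :
  F \is D.-homog -> (0 < D)%N -> OM_section e (nonzero_locus F) h ->
  exists m, forall m', (m <= m')%N -> forall i, exists p, forall x,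
    peval F x ^+ m' * coord (vbasis fullv) i (h x) = peval p x.
Proof.
move=> Fd D0 sh; have oF := zopen_nonzero_locus Fd D0.
have /(OM_sectionP _ _ oF) sh' := sh.
have [m mP] := fin_all_exists (fun i => O_section_global Fd D0 (sh' i)).
exists (\max_i m i).+1 => m' mm' i; have [a aE] := mP i.
have mi : (m i < m')%N by apply: leq_ltn_trans mm'; apply: leq_bigmax.
exists (F ^+ (m' - m i) * a) => x; rewrite pevalM pevalX.
have [Fx|Fx] := eqVneq (peval F x) 0.
  by rewrite Fx !expr0n !eqn0Ngt subn_gt0 mi (leq_ltn_trans _ mi) //= !mul0r.
by rewrite -aE // mulrA -exprD subnK // ltnW.
Qed.

Lemma OM_section_clear (V : vectType k) F D e (h : 'rV[k]_n -> V) m :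
  F \is D.-homog -> (0 < D)%N -> OM_section e (nonzero_locus F) h -> (0 < m)%N ->
  (forall i, exists p, forall x,
    peval F x ^+ m * coord (vbasis fullv) i (h x) = peval p x) ->
  OM_section (e + (D * m)%:Z) (fun x => x != 0) (fun x => peval F x ^+ m *: h x).
Proof.
move=> Fd D0 sh m0 hp; have oN := @zopen_neq0 k n; apply/OM_sectionP => // i.
have [p pE] := hp i.
apply: (@O_section_of_poly _ _ _ _ _ 0%N p 1) => //; first exact: dhomog1.
  by move=> x _; rewrite peval1 oner_neq0 divr1 linearZ /= pE.
move=> x c _ c0; rewrite !linearZ /= (pevalZ _ _ Fd).
have [Fx|Fx] := eqVneq (peval F x) 0.
  by rewrite Fx mulr0 expr0n eqn0Ngt m0 /= !mul0r mulr0.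
rewrite (OM_section_scale sh) // linearZ /= exprMn -exprM expfzDr // -exprnP; ring.
Qed.

End StandardCover.

Definition insert_at (T : Type) m (a : 'I_m.+1) (ti : T * {ffun 'I_m -> T}) : {ffun 'I_m.+1 -> T} :=
  [ffun l => if unlift a l is Some l' then ti.2 l' else ti.1].

Lemma insert_at_eq (T : Type) m (a : 'I_m.+1) (ti : T * {ffun 'I_m -> T}) : insert_at a ti a = ti.1.
Proof. by rewrite ffunE unlift_none. Qed.

Lemma insert_at_lift (T : Type) m (a : 'I_m.+1) (ti : T * {ffun 'I_m -> T}) l :
  insert_at a ti (lift a l) = ti.2 l.
Proof. by rewrite ffunE liftK. Qed.

Lemma sum_insert_at (M : nmodType) (T : finType) m (a : 'I_m.+1) (G : {ffun 'I_m.+1 -> T} -> M) :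
  \sum_i G i = \sum_t \sum_i G (insert_at a (t, i)).
Proof.
rewrite pair_big /= (reindex (insert_at a)); last first.
  exists (fun i : {ffun 'I_m.+1 -> T} => (i a, [ffun l : 'I_m => i (lift a l)])) => [[t i] _|i _] /=.
    by rewrite insert_at_eq; congr (_, _); apply/ffunP => l; rewrite ffunE insert_at_lift.
  by apply/ffunP => l; rewrite ffunE; case: unliftP => [l'|] -> //=; rewrite ffunE.
by apply: eq_bigr => -[t i].
Qed.

Lemma OM_section_sum (k : closedFieldType) n (V : vectType k) e (U : region k n)
    (I : Type) (r : seq I) (G : I -> 'rV[k]_n -> V) :
  zopen U -> (forall i, OM_section e U (G i)) -> OM_section e U (fun x => \sum_(i <- r) G i x).
Proof.
move=> oU h; elim: r => [|i r IH].
  have h0 : OM_section e U (fun _ => 0 : V) by exact: OM_section0.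
  by apply: eq_OM_section h0 => x _; rewrite big_nil.
by apply: eq_OM_section (OM_sectionD (h i) IH) => x _; rewrite big_cons.
Qed.

Section StandardCover.
Variables (k : closedFieldType) (d : nat) (P : poly_functor k d) (n : nat) (e : int).
Implicit Types (U V W : region k n) (x y : 'rV[k]_n).
Local Notation M := (P 'cV[k]_n).
Local Notation F := (@POmega_section k n d P e).

(* A partition of unity subordinate to the cover by the [nonzero_locus (f a)]
   on each member of a cover [V], used as a "fuzzy" refinement map from [V]:
   replacing every index by its average over [T] is a cochain map. *)
Section FuzzyRefinement.
Variables (T : finType) (f : T -> {mpoly k[n]}) (D : T -> nat).
Hypotheses (fD : forall a, f a \is (D a).-homog) (D0 : forall a, (0 < D a)%N).
Variables (K : Type) (V : K -> region k n).
Hypothesis oV : forall i, zopen (V i).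
Variables (R Q : K -> T -> 'rV[k]_n -> k) (m : nat).
Hypothesis m0 : (0 < m)%N.
Hypothesis RQ : forall i a x, V i x -> R i a x = Q i a x * peval (f a) x ^+ m.
Hypothesis sQ : forall i a, O_section (- (D a * m)%:Z) (V i) (Q i a).
Hypothesis sumR : forall i x, V i x -> \sum_a R i a x = 1.
Let W a := nonzero_locus (f a).

Definition fuzzy q (c : cochain n M T q) : cochain n M K q :=
  fun s x => \sum_(i : {ffun 'I_q.+1 -> T}) (\prod_l R (s l) (i l) x) *: c i x.

Lemma interW q (i : {ffun 'I_q.+1 -> T}) x :
  inter W i x <-> nonzero_locus (\prod_l f (i l)) x.
Proof.
rewrite /nonzero_locus /peval rmorph_prod; split=> [h|/prodf_neq0 h l]; last exact: h.
by apply/prodf_neq0 => l _; apply: h.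
Qed.

Lemma fuzzy_weight_eq0 q (s : {ffun 'I_q.+1 -> K}) (i : {ffun 'I_q.+1 -> T}) x :
  inter V s x -> ~ inter W i x -> \prod_l R (s l) (i l) x = 0.
Proof.
move=> sx ix; apply/eqP/negPn/negP => /prodf_neq0 h; apply: ix => l.
have := h l isT; rewrite RQ // mulf_eq0 negb_or => /andP[_].
by rewrite expf_eq0 m0.
Qed.

(** The weights contain f_a^m, which clears the denominators of [c i]; the weighted term thus
    extends by zero over the whole intersection of the V. The negative degrees of the Q make up for
    the degree gained by clearing. *)
Lemma fuzzy_section q (c : cochain n M T q) : is_cochain F W c ->
  (forall (i : {ffun 'I_q.+1 -> T}) l, exists p, forall x,
    peval (\prod_l f (i l)) x ^+ m * coord (vbasis fullv) l (c i x) = peval p x) ->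
  is_cochain F V (fuzzy c).
Proof.
move=> cF hp s; have os := zopen_inter (s := s) oV.
have oW a : zopen (W a) by apply: zopen_nonzero_locus (fD a) (D0 a).
apply/POmega_sectionP => //; split; last first.
  move=> x sx; rewrite /fuzzy; elim/big_ind: _ => [|u v ux vx|i _].
  - exact: in_POmega0.
  - exact: in_POmegaD.
  have [ix|ix] := classic (inter W i x); last by rewrite fuzzy_weight_eq0 // scale0r; apply: in_POmega0.
  apply: in_POmegaZ; have /POmega_sectionP[|_ h] := cF i; last exact: h.
  exact: zopen_inter.
rewrite /fuzzy; apply: (@OM_section_sum _ _ _ _ _ _ _ (fun (i : {ffun 'I_q.+1 -> T}) x =>
  (\prod_l R (s l) (i l) x) *: c i x)) => // i.
pose G := \prod_l f (i l).
apply: (eq_OM_section (f := fun x => (\prod_l Q (s l) (i l) x) *: (peval G x ^+ m *: c i x))).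
  move=> x sx; rewrite scalerA; congr (_ *: _); rewrite /G /peval rmorph_prod -prodrXl -big_split /=.
  by apply: eq_bigr => l _; rewrite RQ.
have Gh : G \is (\sum_l D (i l)).-homog by apply: dhomog_prodn => l; apply: fD.
have G0 : (0 < \sum_l D (i l))%N by rewrite (bigD1 ord0) //= addn_gt0 D0.
have -> : e - d%:Z = \sum_(l < q.+1) (- (D (i l) * m)%:Z) + ((e - d%:Z) + ((\sum_l D (i l)) * m)%:Z).
  rewrite sumrN big_distrl /= (big_morph Posz PoszD (erefl _)); ring.
apply: OM_sectionZ.
  apply: (@O_section_prod _ _ _ _ _ (fun l => - (D (i l) * m)%:Z)
    (fun l => Q (s l) (i l))) => // l.
  by apply: O_sectionW (@sQ (s l) (i l)) => // x; apply.
have /POmega_sectionP[|sc _] := cF i; first exact: zopen_inter.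
apply: (OM_sectionW (U := fun x => x != 0)) => // [x sx|].
  by have [] := os x sx.
apply: (OM_section_clear Gh G0 _ m0 (hp i)).
by apply: OM_sectionW sc => [|x /interW//]; apply: zopen_nonzero_locus Gh G0.
Qed.

(** The a-th face term of [c] does not involve the a-th averaged index, whose weights sum to 1. *)
Lemma coboundary_fuzzy q (c : cochain n M T q) s x : inter V s x ->
  coboundary (fuzzy c) s x = fuzzy (coboundary c) s x.
Proof.
move=> sx; rewrite /coboundary /fuzzy.
under [RHS]eq_bigr do rewrite scaler_sumr.
rewrite exchange_big; apply: eq_bigr => a _.
rewrite (sum_insert_at a) exchange_big /= scaler_sumr; apply: eq_bigr => i _.
have -> : \sum_t (\prod_l R (s l) (insert_at a (t, i) l) x) *:
      ((-1) ^+ a *: c [ffun j => insert_at a (t, i) (lift a j)] x) =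
    (\sum_t R (s a) t x) *: ((\prod_l R (s (lift a l)) (i l) x) *: ((-1) ^+ a *: c i x)).
  rewrite scaler_suml; apply: eq_bigr => t _; rewrite scalerA (bigD1_ord a) //= insert_at_eq.
  congr (_ * _ *: (_ *: c _ x)); last by apply/ffunP => j; rewrite ffunE insert_at_lift.
  by apply: eq_bigr => l _; rewrite insert_at_lift.
rewrite sumR ?scale1r; last exact: sx.
rewrite !scalerA mulrC; congr (_ * _ *: _).
by apply: eq_bigr => l _; rewrite ffunE.
Qed.

Lemma fuzzy_cocycle q (c : cochain n M T q) : is_cocycle F W c ->
  (forall (i : {ffun 'I_q.+1 -> T}) l, exists p, forall x,
    peval (\prod_l f (i l)) x ^+ m * coord (vbasis fullv) l (c i x) = peval p x) ->
  is_cocycle F V (fuzzy c).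
Proof.
move=> [cF dc] hp; split; first exact: fuzzy_section.
move=> s x sx; rewrite coboundary_fuzzy // /fuzzy big1 // => i _.
have [ix|ix] := classic (inter W i x); first by rewrite dc ?scaler0.
by rewrite fuzzy_weight_eq0 ?scale0r.
Qed.

End FuzzyRefinement.

Lemma zcover_coord_locus : zcover (@coord_locus k n).
Proof. by split=> [j|x /neq0_coord//]; apply: zopen_coord_locus. Qed.

(** Some X_j^l is a combination of the f_a^m. Evaluation at x / x_j turns X_j into 1 and makes the
    coefficients, which need not be homogeneous, functions of degree 0; the powers of 1 / x_j coming
    out of f_a^m go into Q. *)
Lemma standard_partition (T : finType) (f : T -> {mpoly k[n]}) (D : T -> nat) m :
  (forall a, f a \is (D a).-homog) -> (forall x, x != 0 -> exists a, peval (f a) x != 0) ->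
  forall j : 'I_n, exists Q : T -> 'rV[k]_n -> k,
    (forall a, O_section (- (D a * m)%:Z) (coord_locus j) (Q a)) /\
    forall x, x 0 j != 0 -> \sum_a Q a x * peval (f a) x ^+ m = 1.
Proof.
move=> fD cf j; have oj := @zopen_coord_locus k n j.
pose J p := exists g : T -> {mpoly k[n]}, p = \sum_a g a * f a ^+ m.
have idJ : ideal J.
  split=> [|p q [g ->] [g' ->]|r p [g ->]].
  - by exists (fun _ => 0); rewrite big1 // => a _; rewrite mul0r.
  - by exists (fun a => g a + g' a); rewrite -big_split; apply: eq_bigr => a _; rewrite mulrDl.
  by exists (fun a => r * g a); rewrite mulr_sumr; apply: eq_bigr => a _; rewrite mulrA.
have [v|l [g gE]] := nullstellensatz idJ (F := 'X_j).
  rewrite mevalXU => vj; pose x : 'rV[k]_n := \row_l v l.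
  have [|a fa] := cf x; first by apply: contraNneq vj => /rowP/(_ j); rewrite !mxE => ->.
  exists (f a ^+ m); split; last first.
    rewrite rmorphXn expf_neq0 //; apply: contra_neq fa => <-.
    by apply: meval_eq => i; rewrite mxE.
  exists (fun b => (b == a)%:R); rewrite (bigD1 a) //= eqxx mul1r big1 ?addr0 // => b /negPf->.
  by rewrite mul0r.
exists (fun a x => (g a).@[fun i => x 0 i * (x 0 j)^-1] * (x 0 j)^-1 ^+ (D a * m)%N).
split=> [a|x xj].
  rewrite -[- _]add0r; apply: O_sectionM.
    apply: (@O_section_meval0 _ _ _ _ (g a) (fun i x => x 0 i * (x 0 j)^-1)) => // i.
    rewrite -[X in O_section X](subrr (1 : int)); apply: O_sectionM.
      exact: O_section_coord.
    exact: O_section_coordV.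
  rewrite -mulN1r; apply: (@O_sectionX _ _ (-1) _ (fun x => (x 0 j)^-1)) => //.
  exact: O_section_coordV.
have := congr1 (meval (fun i => (x 0 j)^-1 * x 0 i)) gE.
rewrite rmorphXn /= mevalXU mulVf // expr1n raddf_sum => {1}->.
apply: eq_bigr => a _; rewrite /= mevalM rmorphXn /=.
have -> : (f a).@[fun i => (x 0 j)^-1 * x 0 i] = (x 0 j)^-1 ^+ D a * peval (f a) x.
  by rewrite -(pevalZ _ _ (fD a)); apply: meval_eq => i; rewrite mxE.
rewrite exprMn exprM -mulrA; congr (_ * _).
by apply: meval_eq => i; rewrite mulrC.
Qed.

(** The averaging is done on the disjoint union V of the finite cover W and the standard one, with
    delta weights on W. The averaged cocycle then restricts to the given one on W and to a cocycle
    on the standard cover, so both represent its class. *)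
Theorem standard_cover_class q (z : cech_rep n M q) : is_class F z ->
  exists c : cochain n M 'I_n q, is_cocycle F (@coord_locus k n) c /\
    same_class F z (CechRep (@coord_locus k n) c).
Proof.
have psF := POmega_presheaf P n e.
case: z => I U c [cU zc] /=; have [oU _] := cU.
have [T [f [D [r [fD D0 fU cf]]]]] := finite_cover cU.
pose W a := nonzero_locus (f a).
have oW a : zopen (W a) by apply: zopen_nonzero_locus (fD a) (D0 a).
have cW : zcover W by split.
have wc : is_cocycle F W (refine r c).
  have [cF dc] := zc; split; first exact: is_cochain_refine.
  move=> s x sx; rewrite coboundary_refine; apply: dc; exact: (inter_refine fU).
have hm (i : {ffun 'I_q.+1 -> T}) : exists m, forall m', (m <= m')%N -> forall l, exists p,
    forall x, peval (\prod_l f (i l)) x ^+ m' * coord (vbasis fullv) l (refine r c i x) = peval p x.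
  have Gh : \prod_l f (i l) \is (\sum_l D (i l)).-homog by apply: dhomog_prodn => l; apply: fD.
  have G0 : (0 < \sum_l D (i l))%N by rewrite (bigD1 ord0) //= addn_gt0 D0.
  apply: (OM_section_global Gh G0 (e := e - d%:Z)); have [/(_ i) ci _] := wc.
  have /POmega_sectionP[|sc _] := ci; first exact: zopen_inter.
  by apply: OM_sectionW sc => [|x /interW//]; apply: zopen_nonzero_locus Gh G0.
have [m mP] := fin_all_exists hm; pose m0 := (\max_i m i).+1.
have hp (i : {ffun 'I_q.+1 -> T}) l : exists p, forall x,
    peval (\prod_l f (i l)) x ^+ m0 * coord (vbasis fullv) l (refine r c i x) = peval p x.
  by apply: mP; apply: leqW; apply: leq_bigmax.
have [Q QP] := fin_all_exists (standard_partition m0 fD cf).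
pose V (i : T + 'I_n) := match i with inl a => W a | inr j => @coord_locus k n j end.
pose Q' (i : T + 'I_n) a x := match i with inl b => (a == b)%:R * (peval (f b) x ^+ m0)^-1
  | inr j => Q j a x end.
pose R (i : T + 'I_n) a x := match i with inl b => (a == b)%:R
  | inr j => Q j a x * peval (f a) x ^+ m0 end.
have oV i : zopen (V i) by case: i => [a|j]; [apply: oW | apply: zopen_coord_locus].
have cV : zcover V by split=> // x x0; have [a fa] := cf x x0; exists (inl a).
have m00 : (0 < m0)%N by [].
have RQ i a x : V i x -> R i a x = Q' i a x * peval (f a) x ^+ m0.
  case: i => [b|j] //= bx; rewrite /R /Q'; case: eqP => [->|]; last by rewrite !mul0r.
  by rewrite mul1r mulVf // expf_neq0.
have sQ i a : O_section (- (D a * m0)%:Z) (V i) (Q' i a).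
  case: i => [b|j] /=; last by have [] := QP j.
  rewrite /Q'; case: eqP => [->|_].
    apply: (eq_O_section (f := fun x => (peval (f b ^+ m0) x)^-1)).
      by move=> x _; rewrite mul1r pevalX.
    apply: O_section_inv => //; first exact: dhomogMn.
    by move=> x bx; rewrite pevalX expf_neq0.
  by apply: eq_O_section (O_section0 _ (oW b)) => x _; rewrite mul0r.
have sumR i x : V i x -> \sum_a R i a x = 1.
  case: i => [b|j] /= xi; last by have [_] := QP j; apply.
  by rewrite (bigD1 b) //= eqxx big1 ?addr0 // => a /negPf->.
have vc : is_cocycle F V (fuzzy R (refine r c)) by apply: (fuzzy_cocycle fD D0 oV m00 RQ sQ sumR wc hp).
exists (refine inr (fuzzy R (refine r c))).
have sc : is_cocycle F (@coord_locus k n) (refine inr (fuzzy R (refine r c))).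
  have [oX _] := zcover_coord_locus; have [cF dc] := vc; split.
    by apply: (is_cochain_refine psF oV oX) => // j x.
  move=> s x sx; rewrite coboundary_refine; apply: dc => l; rewrite ffunE; exact: sx.
split=> //.
apply: (same_class_trans psF (z' := CechRep W (refine r c))) => //.
  exact: same_class_refine.
have inlE : cochain_eq W (fun s x => refine r c s x - refine inl (fuzzy R (refine r c)) s x) (fun _ _ => 0).
  move=> s x sx; apply/eqP; rewrite subr_eq0; apply/eqP.
  rewrite /refine /fuzzy (bigD1 s) //= [\prod_l _]big1 => [|l _]; last by rewrite ffunE /R eqxx.
  rewrite scale1r big1 ?addr0 // => i /eqP is_; have [l il] : exists l, i l != s l.
    by apply/existsP; apply: contraT => /existsPn h; case: is_; apply/ffunP => l; apply/eqP/negPn/h.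
  by rewrite (bigD1 l) //= ffunE /R (negPf il) mul0r scale0r.
have wc' : is_cocycle F W (refine inl (fuzzy R (refine r c))).
  apply: (eq_is_cocycle psF oW) wc => s x sx; apply/eqP; rewrite -subr_eq0; apply/eqP; exact: inlE.
apply: (same_class_trans psF (z' := CechRep W (refine inl (fuzzy R (refine r c))))) => //.
  apply: same_class_coboundary => //.
  have h0 := @is_coboundary0 _ _ _ _ psF T W oW q.
  by apply: eq_is_coboundary h0 => s x sx; rewrite inlE.
apply: (same_class_trans psF (z' := CechRep V (fuzzy R (refine r c)))) => //.
  by apply/same_class_sym => //; apply: same_class_refine => // a x.
by apply: (same_class_refine psF); [exact: zcover_coord_locus | move=> j x].
Qed.

End StandardCover.

(** * Group actions and torus weights *)

Section LinearAction.
Variables (k : closedFieldType) (n : nat).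
Implicit Types (U V W : region k n) (x y : 'rV[k]_n).

(** The substituted polynomial is replaced by its part of degree m, which has the same values
    because these scale by c^m. *)
Lemma peval_linear m (f : {mpoly k[n]}) (g : 'M[k]_n) : f \is m.-homog ->
  exists h : {mpoly k[n]}, h \is m.-homog /\ forall x, peval h x = peval f (x *m g).
Proof.
move=> fm; pose h := f \mPo [tuple \sum_i g i j *: 'X_i | j < n].
have hE x : peval h x = peval f (x *m g).
  rewrite /peval comp_mpoly_meval; apply: meval_eq => j; rewrite tnth_mktuple raddf_sum !mxE.
  by apply: eq_bigr => i _; rewrite /= mevalZ mevalXU mulrC.
exists (pihomog mdeg m h); split; first exact: pihomogP.
move=> x; rewrite -hE; apply/esym/(meval_homog_part (e := m%:Z)) => c c0.
have := hE (c *: x); rewrite -scalemxAl (pevalZ _ _ fm) -hE => <-.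
by apply: meval_eq => i; rewrite mxE.
Qed.

Variable g : 'M[k]_n.
Hypothesis ug : g \in unitmx.

Lemma mulmx_unit_neq0 x : (x *m g != 0) = (x != 0).
Proof.
apply/idP/idP; first by apply: contra_neq => ->; rewrite mul0mx.
by apply: contra_neq => e0; rewrite -(mulmxK ug x) e0 mul0mx.
Qed.

Lemma zopen_linear U : zopen U -> zopen (fun x => U (x *m g)).
Proof.
move=> oU x /oU [x0 [m [f [fm fx fU]]]]; split; first by rewrite -mulmx_unit_neq0.
have [h [hm hE]] := peval_linear g fm; exists m, h; split; rewrite ?hE // => y y0.
by rewrite hE; apply: fU; rewrite mulmx_unit_neq0.
Qed.

Lemma O_section_linear e U f : O_section e U f ->
  O_section e (fun x => U (x *m g)) (fun x => f (x *m g)).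
Proof.
move=> sf x /sf [W [oW Wx WU [p [q [a [b [ap bq pq E]]]]]]].
exists (fun x => W (x *m g)); split=> //; first exact: zopen_linear.
  by move=> y /WU.
have [a' [a'p a'E]] := peval_linear g ap; have [b' [b'q b'E]] := peval_linear g bq.
by exists p, q, a', b'; split=> // y; rewrite a'E b'E; apply: E.
Qed.

Lemma zcover_linear (I : Type) (U : I -> region k n) : zcover U ->
  zcover (fun i x => U i (x *m g)).
Proof.
move=> [oU cU]; split=> [i|x x0]; first exact: zopen_linear.
by apply: cU; rewrite mulmx_unit_neq0.
Qed.

Variables (d : nat) (P : poly_functor k d).
Local Notation M := (P 'cV[k]_n).

(** g intertwines the projection onto ker (x g) along g^-1 v with the projection onto ker x along
    v. *)
Lemma in_POmega_linear x (s : M) : in_POmega (x *m g) s -> in_POmega x (pm P g s).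
Proof.
move=> sx v xv; rewrite -pmM.
have -> : (1%:M - v *m x) *m g = g *m (1%:M - (invmx g *m v) *m (x *m g)).
  by rewrite mulmxBl mulmxBr mul1mx mulmx1 !mulmxA mulmxV // mul1mx.
by rewrite pmM sx // mulmxA mulmxK.
Qed.

Lemma POmega_section_linear e U s : zopen U -> @POmega_section k n d P e U s ->
  POmega_section e (fun x => U (x *m g)) (fun x => pm P g (s (x *m g))).
Proof.
move=> oU /(POmega_sectionP _ _ oU) [sU sx]; have oU' := zopen_linear oU.
apply/(POmega_sectionP _ _ oU'); split; last by move=> x Ux; apply/in_POmega_linear/sx.
rewrite -[e - _]addr0 -(mul0r d%:Z).
apply: (@OM_section_pm _ _ P _ _ _ _ _ _ (fun _ => g) (fun x => s (x *m g)) oU').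
  by move=> i j; apply: O_section_cst.
move=> phi; exact: (O_section_linear (sU phi)).
Qed.

Definition act_cochain (I : Type) q (c : cochain n M I q) : cochain n M I q :=
  fun s x => pm P g (c s (x *m g)).

Lemma coboundary_act (I : Type) q (c : cochain n M I q) s x :
  coboundary (act_cochain c) s x = act_cochain (coboundary c) s x.
Proof.
rewrite /act_cochain /coboundary pm_sum; apply: eq_bigr => a _.
by rewrite pm_scale.
Qed.

Section Classes.
Variable e : int.
Local Notation F := (@POmega_section k n d P e).

Lemma is_cochain_act (I : Type) (U : I -> region k n) q (c : cochain n M I q) :
  (forall i, zopen (U i)) -> is_cochain F U c ->
  is_cochain F (fun i x => U i (x *m g)) (act_cochain c).
Proof.
by move=> oU cF s; apply: (POmega_section_linear (U := inter U s)) => //; apply: zopen_inter.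
Qed.

Lemma is_cocycle_act (I : Type) (U : I -> region k n) q (c : cochain n M I q) :
  (forall i, zopen (U i)) -> is_cocycle F U c ->
  is_cocycle F (fun i x => U i (x *m g)) (act_cochain c).
Proof.
move=> oU [cF dc]; split; first exact: is_cochain_act.
by move=> s x sx; rewrite coboundary_act /act_cochain dc ?pm_zero.
Qed.

Lemma is_coboundary_act (I : Type) (U : I -> region k n) q (c : cochain n M I q) :
  (forall i, zopen (U i)) -> is_coboundary F U c ->
  is_coboundary F (fun i x => U i (x *m g)) (act_cochain c).
Proof.
move=> oU; case: q c => [|q] c /=; first by move=> h s x sx; rewrite /act_cochain h ?pm_zero.
move=> [b [bF cb]]; exists (act_cochain b); split; first exact: is_cochain_act.
by move=> s x sx; rewrite coboundary_act /act_cochain cb.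
Qed.

Lemma is_class_gl_act q (z : cech_rep n M q) : is_class F z -> is_class F (gl_act g z).
Proof.
by move=> [cU zc]; split; [apply: zcover_linear | have [oU _] := cU; apply: is_cocycle_act].
Qed.

Lemma same_class_gl_act q (z z' : cech_rep n M q) :
  same_class F z z' -> same_class F (gl_act g z) (gl_act g z').
Proof.
move=> [J [W [r [r' [cW rW r'W h]]]]]; exists J, (fun j x => W j (x *m g)), r, r'; split.
- exact: zcover_linear.
- by move=> j x; apply: rW.
- by move=> j x; apply: r'W.
have [oW _] := cW; apply: eq_is_coboundary (is_coboundary_act oW h) => s x sx.
by rewrite /act_cochain [LHS](linearB (pm P g)).
Qed.

End Classes.

End LinearAction.

Section ActionLaws.
Variables (k : closedFieldType) (n d : nat) (P : poly_functor k d).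
Local Notation M := (P 'cV[k]_n).

Lemma gl_actM g h q (z : cech_rep n M q) : gl_act (g *m h) z = gl_act g (gl_act h z).
Proof.
rewrite /gl_act /=; congr CechRep; apply: functional_extensionality => i.
  by apply: functional_extensionality => x; rewrite mulmxA.
by apply: functional_extensionality => x; rewrite -/(pm P _) pmM mulmxA.
Qed.

Lemma gl_act1 q (z : cech_rep n M q) : gl_act 1%:M z = z.
Proof.
case: z => I U c; rewrite /gl_act /=; congr CechRep; apply: functional_extensionality => i.
  by apply: functional_extensionality => x; rewrite mulmx1.
by apply: functional_extensionality => x; rewrite -/(pm P _) pm1 mulmx1.
Qed.

End ActionLaws.

Section Interpolation.
Variable k : closedFieldType.

Lemma exists_distinct N : exists tau : 'I_N -> k, injective tau /\ forall l, tau l != 0.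
Proof.
suff [s [us ss s0]] : exists s : seq k, [/\ uniq s, size s = N & 0 \notin s].
  exists (fun l => nth 0 s l); split=> [l l' /eqP|l].
    by rewrite nth_uniq ?ss // => /eqP/val_inj.
  by apply: contraNneq s0 => <-; rewrite mem_nth ?ss.
elim: N => [|N [s [us ss s0]]]; first by exists [::].
have p0 : \prod_(a <- s) ('X - a%:P) != 0 :> {poly k}.
  exact/monic_neq0/monic_prod_XsubC.
have [t [t0 pt]] := exists_nonroot p0; exists (t :: s); split=> /=.
- by rewrite us andbT -root_prod_XsubC.
- by rewrite ss.
by rewrite inE negb_or s0 eq_sym t0.
Qed.

(** Inverse Vandermonde matrix. The weights [lam] do not depend on p; this is what makes a weight
    component one combination of translates, the same for all indices and points. *)
Lemma interpolation N (tau : 'I_N -> k) : injective tau ->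
  exists lam : 'I_N -> 'I_N -> k, forall p : {poly k}, (size p <= N)%N ->
    forall a : 'I_N, p`_a = \sum_l lam a l * p.[tau l].
Proof.
move=> tau_inj; pose V := (Vandermonde N (\row_l tau l))^T.
have uV : V \in unitmx.
  rewrite unitmx_tr unitmxE det_Vandermonde unitfE; apply/prodf_neq0 => i _.
  apply/prodf_neq0 => j ij; rewrite !mxE subr_eq0 (inj_eq tau_inj).
  by apply: contraTneq ij => ->; rewrite ltnn.
exists (fun a l => invmx V a l) => p sp a.
have E : V *m (\col_b p`_b) = \col_l p.[tau l].
  apply/colP => l; rewrite !mxE (horner_coef_wide _ sp); apply: eq_bigr => b _.
  by rewrite !mxE mulrC.
have := mulKmx uV (\col_b p`_b); rewrite E => /colP/(_ a); rewrite !mxE => <-.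
by apply: eq_bigr => l _; rewrite mxE.
Qed.

(** The degree bound depends on p alone, so it is uniform over all lines. *)
Lemma meval_affine N (p : {mpoly k[N]}) (u w : 'I_N -> k) :
  exists q : {poly k}, (size q <= msize p)%N /\
    forall t, q.[t] = p.@[fun i => u i + t * w i].
Proof.
exists (mmap (@polyC k) (fun i => (u i)%:P + w i *: 'X) p); split.
  rewrite /mmap; apply: (leq_trans (size_sum _ _ _)); apply/bigmax_leqP_seq => m mp _.
  rewrite mul_polyC; apply: leq_trans (size_scale_leq _ _) _.
  apply: leq_trans (msize_mdeg_lt mp); rewrite mdegE /mmap1.
  have := @topc_prod k 'I_N (index_enum _) (fun i => ((u i)%:P + w i *: 'X) ^+ m i) m (fun i => w i ^+ m i).
  case=> // i; rewrite -[X in topc _ X]muln1; apply: topcX; split.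
    apply: leq_trans (size_polyD _ _) _; rewrite geq_max (leq_trans (size_polyC_leq1 _)) //=.
    by apply: leq_trans (size_scale_leq _ _) _; rewrite size_polyX.
  by rewrite coefD coefC coefZ coefX mulr1 add0r.
move=> t; rewrite /mmap mevalE horner_sum; apply: eq_bigr => m _.
rewrite hornerM hornerC; congr (_ * _); rewrite /mmap1 horner_prod; apply: eq_bigr => i _.
by rewrite horner_exp hornerD hornerC hornerZ hornerX mulrC.
Qed.

End Interpolation.

Section Torus.
Variables (k : closedFieldType) (n : nat).
Implicit Types (x y : 'rV[k]_n) (j : 'I_n) (t u : k).

Definition tor j t : 'M[k]_n := diag_mx (\row_i (if i == j then t else 1)).

Lemma mulmx_tor j t x i : (x *m tor j t) 0 i = if i == j then t * x 0 i else x 0 i.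
Proof. by rewrite mul_mx_diag !mxE; case: eqP => _; rewrite ?mulr1 // mulrC. Qed.

Lemma tor1 j : tor j 1 = 1%:M.
Proof. by apply/matrixP => a b; rewrite !mxE; case: eqP; rewrite ?if_same. Qed.

Lemma torM j t u : tor j (t * u) = tor j t *m tor j u.
Proof.
rewrite mulmx_diag; congr diag_mx; apply/rowP => i; rewrite !mxE.
by case: eqP => _; rewrite ?mulr1.
Qed.

Lemma torC j t i u : tor j t *m tor i u = tor i u *m tor j t.
Proof.
by rewrite !mulmx_diag; congr diag_mx; apply/rowP => l; rewrite !mxE mulrC.
Qed.

Lemma unit_tor j t : t != 0 -> tor j t \in unitmx.
Proof.
move=> t0; have : tor j t *m tor j t^-1 = 1%:M by rewrite -torM divff // tor1.
by case/mulmx1_unit.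
Qed.

Local Notation X := (@coord_locus k n).

Lemma inter_tor q (s : {ffun 'I_q.+1 -> 'I_n}) j t x : t != 0 ->
  inter X s (x *m tor j t) <-> inter X s x.
Proof.
move=> t0; split=> h l; have := h l; rewrite /coord_locus mulmx_tor.
  by case: (s l =P j) => // _; rewrite mulf_eq0 negb_or => /andP[].
by case: (s l =P j) => // _ xl; rewrite mulf_neq0.
Qed.

Lemma inter_coord_locus q (s : {ffun 'I_q.+1 -> 'I_n}) x :
  inter X s x <-> nonzero_locus (\prod_l 'X_(s l)) x.
Proof.
rewrite /nonzero_locus /peval rmorph_prod; split=> [h|/prodf_neq0 h l].
  by apply/prodf_neq0 => l _; rewrite /= mevalXU; apply: h.
by have := h l isT; rewrite /= mevalXU.
Qed.

Lemma homog_coords q (s : {ffun 'I_q.+1 -> 'I_n}) :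
  (\prod_l 'X_(s l) : {mpoly k[n]}) \is (\sum_(l < q.+1) 1)%N.-homog.
Proof. by apply: dhomog_prodn => l; apply: dhomogX1. Qed.

Lemma homog_coords_gt0 q : (0 < \sum_(l < q.+1) 1)%N.
Proof. by rewrite sum1_card card_ord. Qed.

Lemma zopen_std i : zopen (X i).
Proof. exact: zopen_coord_locus. Qed.

Variables (d : nat) (P : poly_functor k d) (e : int).
Local Notation M := (P 'cV[k]_n).
Local Notation F := (@POmega_section k n d P e).

Lemma std_global q (c : cochain n M 'I_n q) : is_cochain F X c ->
  exists m, forall (s : {ffun 'I_q.+1 -> 'I_n}) i, exists p, forall x,
    peval (\prod_l 'X_(s l)) x ^+ m * coord (vbasis fullv) i (c s x) = peval p x.
Proof.
move=> cF.
have hm (s : {ffun 'I_q.+1 -> 'I_n}) : exists m, forall m', (m <= m')%N -> forall i, exists p,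
    forall x, peval (\prod_l 'X_(s l)) x ^+ m' * coord (vbasis fullv) i (c s x) = peval p x.
  apply: (OM_section_global (homog_coords s) (homog_coords_gt0 q) (e := e - d%:Z)).
  have os : zopen (inter X s) by apply: zopen_inter => i; apply: zopen_std.
  have /(POmega_sectionP _ _ os)[sc _] := cF s.
  apply: OM_sectionW sc => [|x /inter_coord_locus//].
  exact: zopen_nonzero_locus (homog_coords s) (homog_coords_gt0 q).
have [m mP] := fin_all_exists hm; exists (\max_s m s) => s i.
by apply: mP; apply: leq_bigmax.
Qed.

Lemma pm_tor_poly j (u : M) i : exists rho : {poly k}, forall t,
  coord (vbasis fullv) i (pm P (tor j t) u) = rho.[t].
Proof.
have [N [p [L [_ pE]]]] := pm_poly (linfun (coord (vbasis fullv) i : M -> k^o)) u.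
pose A a := \sum_i \sum_b (if (i == b) && (i != j) then 1 else 0) * L a i b.
have [r [_ rE]] := meval_affine p A (fun a => L a j j).
exists r => t; have := pE (tor j t); rewrite lfunE /= => ->; rewrite rE.
apply: meval_eq => a; rewrite /A (bigD1 j) //= [in RHS](bigD1 j) //=.
have -> : \sum_b (if (j == b) && (j != j) then 1 else 0) * L a j b = 0.
  by rewrite big1 // => b _; rewrite eqxx andbF mul0r.
rewrite add0r addrC; congr (_ + _).
  apply: eq_bigr => l lj; apply: eq_bigr => b _; rewrite !mxE lj andbT (negPf lj).
  by case: (l == b).
rewrite (bigD1 j) //= big1 ?addr0 => [|b bj]; rewrite !mxE ?eqxx //.
by rewrite eq_sym (negPf bj) mul0r.
Qed.

(** Both the exponent K that clears the poles in t and the size bound N are uniform in s, x and i,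
    so that fixed interpolation nodes suffice. *)
Lemma torus_poly j q (c : cochain n M 'I_n q) : is_cochain F X c ->
  exists K N, forall (s : {ffun 'I_q.+1 -> 'I_n}) x, inter X s x -> forall i, exists p : {poly k}, (size p <= N)%N /\
    forall t, t != 0 -> t ^+ K * coord (vbasis fullv) i (act_cochain (tor j t) c s x) = p.[t].
Proof.
move=> cF; have [m mP] := std_global cF.
have [p pE] := fin_all_exists (fun s => fin_all_exists (mP s)).
pose b (i' : 'I_(\dim (fullv : {vspace M}))) := (vbasis (fullv : {vspace M}))`_i'.
have [rho rhoE] := fin_all_exists (fun i => fin_all_exists (fun i' => pm_tor_poly j (b i') i)).
(* x_j occurs at most q + 1 times in the product of the coordinates indexed by s, whose m-th power
   is the denominator. *)
pose K := (m * q.+1)%N.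
pose N1 := \max_s \max_i msize (p s i); pose N2 := \max_i \max_i' size (rho i i').
exists K, (K + N1 + N2)%N => s x sx i.
pose mu := (\sum_l (s l == j))%N.
have muK : (m * mu <= K)%N.
  rewrite leq_mul2l; apply/orP; right; rewrite -[q.+1]card_ord -sum1_card.
  by apply: leq_sum => l _; case: (_ == _).
have Fy t : peval (\prod_l 'X_(s l)) (x *m tor j t) = t ^+ mu * peval (\prod_l 'X_(s l)) x.
  rewrite /peval !rmorph_prod /mu expr_sum -big_split; apply: eq_bigr => l _ /=.
  by rewrite !mevalXU mulmx_tor; case: eqP; rewrite ?expr1 ?expr0 ?mul1r.
have Fx : peval (\prod_l 'X_(s l)) x != 0 by apply/inter_coord_locus.
(* The point x [tor j t] runs through an affine line in t. *)
have [pi piE] := fin_all_exists (fun i' => meval_affine (p s i')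
  (fun l => if l == j then 0 else x 0 l) (fun l => if l == j then x 0 l else 0)).
exists (\sum_i' (peval (\prod_l 'X_(s l)) x ^+ m)^-1 *: ('X^(K - m * mu) * pi i' * rho i i')); split.
  apply: (leq_trans (size_sum _ _ _)); apply/bigmax_leqP => i' _.
  apply: leq_trans (size_scale_leq _ _) _; apply: leq_trans (size_polyMleq _ _) _.
  have h1 : (size (rho i i') <= N2)%N.
    by apply: leq_trans (leq_bigmax i); apply: (leq_bigmax (F := fun i' => size (rho i i'))).
  have h2 : (size (pi i') <= N1)%N.
    have [h _] := piE i'; apply: leq_trans h _.
    by apply: leq_trans (leq_bigmax s); apply: (leq_bigmax (F := fun i => msize (p s i))).
  have h3 : (size ('X^(K - m * mu) * pi i')%R <= (K - m * mu) + size (pi i'))%N.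
    by apply: leq_trans (size_polyMleq _ _) _; rewrite size_polyXn.
  by move: h1 h2 h3; rewrite /K; lia.
move=> t t0; rewrite horner_sum; set y := x *m tor j t.
have cy i' : t ^+ K * coord (vbasis fullv) i' (c s y) =
    (peval (\prod_l 'X_(s l)) x ^+ m)^-1 * t ^+ (K - m * mu) * (pi i').[t].
  have -> : (pi i').[t] = peval (p s i') y.
    have [_ ->] := piE i'; apply: meval_eq => l; rewrite mulmx_tor.
    by case: eqP => _; rewrite ?add0r // mulr0 addr0.
  rewrite -pE Fy exprMn -exprM [(mu * m)%N]mulnC -[in LHS](subnK muK) exprD.
  by field; rewrite expf_neq0.
rewrite /act_cochain -/y [c s y]coord_full pm_sum linear_sum mulr_sumr.
apply: eq_bigr => i' _; rewrite pm_scale linearZ /= -/(b i') rhoE mulrA cy.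
by rewrite hornerZ !hornerM hornerXn !mulrA.
Qed.

Lemma is_cocycle_tor j t q (c : cochain n M 'I_n q) : t != 0 -> is_cocycle F X c ->
  is_cocycle F X (act_cochain (tor j t) c).
Proof.
move=> t0 /(is_cocycle_act (unit_tor j t0) zopen_std) [cF dc]; split=> s.
  have psF := POmega_presheaf P n e.
  apply: (presheafW psF (cF s)) => //; last by move=> x /(inter_tor _ j _ t0) h l; apply: h.
    apply: zopen_inter => i; apply: (zopen_linear (U := X i) (unit_tor j t0)).
    exact: zopen_std.
  by apply: zopen_inter => i; apply: zopen_std.
by move=> x /(inter_tor _ j _ t0) sx; apply: dc.
Qed.

Lemma act_cochainM (I : Type) q (c : cochain n M I q) (g h : 'M[k]_n) s x :
  act_cochain (g *m h) c s x = act_cochain g (act_cochain h c) s x.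
Proof. by rewrite /act_cochain pmM mulmxA. Qed.

Definition eigen_cochain j (b : int) q (c : cochain n M 'I_n q) :=
  forall t, t != 0 -> cochain_eq X (act_cochain (tor j t) c) (fun s x => t ^ b *: c s x).

Lemma coord_ext (u v : M) :
  (forall i, coord (vbasis fullv) i u = coord (vbasis fullv) i v) -> u = v.
Proof. by move=> h; rewrite [u]coord_full [v]coord_full; apply: eq_bigr => i _; rewrite h. Qed.

(** c_a is the a-th coefficient of the polynomial t^K times the translate of c by t, hence of weight
    a - K; interpolation at the nodes tau expresses it by translates. *)
Theorem torus_decomposition j q (c : cochain n M 'I_n q) : is_cocycle F X c ->
  exists N (lam : 'I_N -> 'I_N -> k) (tau : 'I_N -> k) (b : 'I_N -> int),
    let c_ a := fun s x => \sum_l lam a l *: act_cochain (tor j (tau l)) c s x in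
    [/\ forall l, tau l != 0, cochain_eq X c (fun s x => \sum_a c_ a s x)
      & forall a, eigen_cochain j (b a) (c_ a)].
Proof.
move=> [cF _]; have [K [N pE]] := torus_poly j cF.
have [tau [tau_inj tau0]] := exists_distinct k N.
have [lam lamE] := interpolation tau_inj.
exists N, (fun a l => lam a l * tau l ^+ K), tau, (fun a => a%:Z - K%:Z) => c_.
have coordc a s x i (p : {poly k}) : (size p <= N)%N ->
    (forall t, t != 0 -> t ^+ K * coord (vbasis fullv) i (act_cochain (tor j t) c s x) = p.[t]) ->
    coord (vbasis fullv) i (c_ a s x) = p`_a.
  move=> sp h; rewrite lamE // linear_sum; apply: eq_bigr => l _.
  by rewrite linearZ /= -mulrA h.
split=> // [s x sx|a t t0 s x sx]; apply: coord_ext => i; have [p [sp ph]] := pE s x sx i.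
  rewrite linear_sum (eq_bigr (fun a : 'I_N => p`_a)); last by move=> a _; apply: coordc.
  have := ph 1 (oner_neq0 _); rewrite expr1n mul1r /act_cochain tor1 pm1 mulmx1 => ->.
  by rewrite (horner_coef_wide _ sp); apply: eq_bigr => a _; rewrite expr1n mulr1.
rewrite linearZ /= (coordc _ _ _ _ p) //.
(* Translating c by t replaces p(X) by p(t X), up to the factor t^K. *)
pose q' := \poly_(l < N) (p`_l * t ^+ l).
have q'E u : q'.[u] = p.[t * u].
  rewrite (horner_coef_wide _ sp) horner_poly; apply: eq_bigr => l _.
  by rewrite exprMn mulrA.
have : q'`_a = p`_a * t ^+ a by rewrite coef_poly ltn_ord.
rewrite lamE ?size_poly // => E.
have -> : t ^ (a%:Z - K%:Z) * p`_a = t ^- K * (p`_a * t ^+ a).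
  by rewrite expfzDr // -exprnN -exprnP; ring.
rewrite -E mulr_sumr /act_cochain pm_sum linear_sum; apply: eq_bigr => l _.
have := ph _ (mulf_neq0 t0 (tau0 l)); rewrite q'E => <-.
rewrite torM act_cochainM pm_scale linearZ /= exprMn.
by field; rewrite expf_neq0.
Qed.

End Torus.

(** * Laurent polynomials of negative weight *)

Section Monomials.
Variables (k : closedFieldType) (n : nat).
Implicit Types (x y : 'rV[k]_n) (j : 'I_n) (t u : k).
Local Notation X := (@coord_locus k n).

Lemma exp_inj (a b : int) : (forall t : k, t != 0 -> t ^ a = t ^ b) -> a = b.
Proof.
wlog ab : a b / a <= b.
  by move=> h E; case: (lerP a b) => [/h|/ltW/h H]; [apply | apply/esym/H => t /E].
move=> E; apply/eqP; rewrite -subr_eq0; apply: contraT => ba.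
have [N NE] : exists N, b - a = N.+1%:Z.
  have : 0 <= b - a by rewrite subr_ge0.
  case e : (b - a) => [[|N]|N] // _; last by exists N.
  by move: ba; rewrite -[a - b]opprB e oppr0 eqxx.
have /(congr1 (fun p : {poly k} => size p)) : 'X^(N.+1) - 1%:P = 0 :> {poly k}.
  apply: poly_vanish => t t0; rewrite hornerD hornerN hornerXn hornerC exprnP -NE.
  by rewrite expfzDr // -invr_expz -(E t t0) mulfV ?subrr // E // expfz_neq0.
by rewrite size_XnsubC // size_poly0.
Qed.

Lemma peval_big (I : Type) (r : seq I) (G : I -> {mpoly k[n]}) x :
  peval (\sum_(i <- r) G i) x = \sum_(i <- r) peval (G i) x.
Proof. exact: (raddf_sum (meval (x 0))). Qed.

Lemma peval_scale a (p : {mpoly k[n]}) x : peval (a *: p) x = a * peval p x.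
Proof. exact: mevalZ. Qed.

Lemma peval_sum (A : {mpoly k[n]}) x : peval A x = \sum_(m <- msupp A) A@_m * peval 'X_[m] x.
Proof.
by rewrite {1}(mpolyE A) peval_big; apply: eq_bigr => m _; rewrite peval_scale.
Qed.

Lemma pevalXm (m : 'X_{1..n}) x : peval 'X_[m] x = \prod_l x 0 l ^+ m l.
Proof. exact: mevalX. Qed.

Lemma peval_vanish (A : {mpoly k[n]}) :
  (forall x, (forall l, x 0 l != 0) -> peval A x = 0) -> A = 0.
Proof.
move=> h; apply: mpoly_vanish => v v0; rewrite -(h (\row_l v l)).
  by apply: meval_eq => l; rewrite mxE.
by move=> l; rewrite mxE.
Qed.

(** The sum of A_m (t^(h m) - t^b) X^m vanishes on the torus, so every coefficient is 0, for each t.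
    [act] is later one torus factor or the scaling of x. *)
Lemma monomial_weight (A : {mpoly k[n]}) (h : 'X_{1..n} -> nat) (act : k -> 'rV[k]_n -> 'rV[k]_n)
    (b : int) :
  (forall t x m, peval 'X_[m] (act t x) = t ^+ h m * peval 'X_[m] x) ->
  (forall t x, t != 0 -> (forall l, x 0 l != 0) -> peval A (act t x) = t ^ b * peval A x) ->
  forall m, A@_m != 0 -> (h m)%:Z = b.
Proof.
move=> hX hA m Am; apply: exp_inj => t t0.
have : \sum_(m <- msupp A) (A@_m * (t ^+ h m - t ^ b)) *: 'X_[m] = 0 :> {mpoly k[n]}.
  apply: peval_vanish => x x0; have := hA t x t0 x0; rewrite (peval_sum A (act t x)) (peval_sum A x) mulr_sumr => /eqP.
  rewrite -subr_eq0 -sumrB => /eqP e0; rewrite -[RHS]e0 peval_big.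
  by apply: eq_bigr => m' _; rewrite peval_scale hX; ring.
move/(congr1 (mcoeff m)); rewrite mcoeff0 raddf_sum (bigD1_seq m) ?msupp_uniq ?mcoeff_msupp //=.
rewrite mcoeffZ mcoeffX eqxx mulr1 big1 => [|m' /negPf mm].
  by rewrite addr0 => /eqP; rewrite mulf_eq0 (negPf Am) subr_eq0 => /eqP.
by rewrite mcoeffZ mcoeffX mm mulr0.
Qed.

Lemma O_section_expz (z : int) (U : region k n) l : zopen U ->
  (0 <= z \/ forall x, U x -> x 0 l != 0) -> O_section z U (fun x => x 0 l ^ z).
Proof.
move=> oU; case: z => N h.
  by have := O_sectionX N oU (O_section_coord l oU); rewrite mul1r.
case: h => // Ul; have := O_sectionX N.+1 oU (O_section_coordV oU Ul).
rewrite mulN1r -NegzE; apply: eq_O_section => x _.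
by rewrite NegzE -exprnN exprVn.
Qed.

(** Exponents are stored shifted by K, so that ordinary monomials index the Laurent monomials. *)
Definition laurent (K : nat) (m : 'X_{1..n}) x : k := \prod_l x 0 l ^ ((m l)%:Z - K%:Z).

Lemma laurentE K m x : (forall l, x 0 l != 0) ->
  laurent K m x * (\prod_l x 0 l) ^+ K = peval 'X_[m] x.
Proof.
move=> x0; rewrite pevalXm -prodrXl -big_split; apply: eq_bigr => l _ /=.
by rewrite [_ ^+ K]exprnP -expfzDr // subrK.
Qed.

Lemma prod_coords q (s : {ffun 'I_q -> 'I_n}) x :
  \prod_a x 0 (s a) = \prod_l x 0 l ^+ (\sum_a (s a == l))%N.
Proof.
under [RHS]eq_bigr do rewrite expr_sum.
rewrite exchange_big; apply: eq_bigr => a _; rewrite (bigD1 (s a)) //= eqxx expr1.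
by rewrite big1 ?mulr1 // => l /negPf; rewrite eq_sym => ->; rewrite expr0.
Qed.

End Monomials.

Section ScalarChart.
Variables (k : closedFieldType) (n q : nat).
Implicit Types (x y : 'rV[k]_n) (t u : k).
Local Notation X := (@coord_locus k n).
Variables (c : cochain n k^o 'I_n q) (e b : int) (j : 'I_n).
Hypothesis cO : forall s, O_section e (inter X s) (c s).

(* [c s] as a Laurent polynomial, with a denominator independent of [s];
   only coordinates in [s] occur with negative exponents. *)
Lemma laurent_numerators : exists K (A : {ffun 'I_q.+1 -> 'I_n} -> {mpoly k[n]}),
  (forall (s : {ffun 'I_q.+1 -> 'I_n}) x, (forall l, x 0 l != 0) -> (\prod_l x 0 l) ^+ K * c s x = peval (A s) x) /\
  (forall (s : {ffun 'I_q.+1 -> 'I_n}) l, (forall a, s a != l) -> forall m, (A s)@_m != 0 -> (K <= m l)%N).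
Proof.
have H (s : {ffun 'I_q.+1 -> 'I_n}) : exists m a, forall x, inter X s x -> peval (\prod_a 'X_(s a)) x ^+ m * c s x = peval a x.
  have [|m [a aE]] := O_section_global (homog_coords k s) (homog_coords_gt0 q) (e := e) (f := c s).
    apply: O_sectionW (@cO s) => [|x /inter_coord_locus//].
    exact: zopen_nonzero_locus (homog_coords k s) (homog_coords_gt0 q).
  by exists m, a => x /inter_coord_locus; apply: aE.
have [m {}H] := fin_all_exists H; have [a aE] := fin_all_exists H.
pose K := ((\max_s m s) * q.+1)%N.
pose mult (s : {ffun 'I_q.+1 -> 'I_n}) l := (\sum_a (s a == l))%N.
have mK s l : (m s * mult s l <= K)%N.
  apply: leq_mul; first exact: leq_bigmax.
  rewrite -[q.+1]card_ord -sum1_card; apply: leq_sum => i _.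
  by case: (_ == _).
(* Raises the denominator of [c s] to the common (x_0 ... x_(n-1))^K. A coordinate absent from s
   receives the full K, whence the second claim. *)
pose nu s := [multinom (K - m s * mult s l)%N | l < n].
exists K, (fun s => a s * 'X_[nu s]); split=> [s x x0|s l sl mu].
  rewrite pevalM -aE; last by move=> i; apply: x0.
  rewrite pevalXm mulrAC; congr (_ * _).
  have -> : peval (\prod_a 'X_(s a)) x = \prod_a x 0 (s a).
    by rewrite /peval rmorph_prod; apply: eq_bigr => i _; rewrite /= mevalXU.
  rewrite prod_coords -!prodrXl -big_split; apply: eq_bigr => i _ /=.
  by rewrite mnmE -exprM -exprD mulnC subnKC // mK.
rewrite -mcoeff_msupp (perm_mem (msuppMX _ _)) => /mapP[mu' _ ->].
rewrite mnmDE mnmE /mult big1 ?muln0 ?subn0 ?leq_addr // => i _.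
by rewrite (negPf (sl i)).
Qed.

Hypothesis dc : cochain_eq X (coboundary c) (fun _ _ => 0).
Hypothesis cj : forall (s : {ffun 'I_q.+1 -> 'I_n}) x t, inter X s x -> t != 0 -> c s (x *m tor j t) = t ^ b * c s x.
Hypothesis b0 : b < 0.
Hypothesis qe : (q < n.-1)%N \/ - n%:Z + 1 <= e.

Section Numerators.
Variables (K : nat) (A : {ffun 'I_q.+1 -> 'I_n} -> {mpoly k[n]}).
Hypothesis AE : forall (s : {ffun 'I_q.+1 -> 'I_n}) x, (forall l, x 0 l != 0) ->
  (\prod_l x 0 l) ^+ K * c s x = peval (A s) x.
Hypothesis Adiv : forall (s : {ffun 'I_q.+1 -> 'I_n}) l, (forall a, s a != l) -> forall m, (A s)@_m != 0 -> (K <= m l)%N.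

Lemma torus_inter (s : {ffun 'I_q.+1 -> 'I_n}) x : (forall l, x 0 l != 0) -> inter X s x.
Proof. by move=> x0 a; apply: x0. Qed.

Lemma numerator_weight s m : (A s)@_m != 0 -> (m j)%:Z = b + K%:Z.
Proof.
apply: (monomial_weight (h := fun m => m j) (act := fun t x => x *m tor j t)).
  move=> t x mu; rewrite !pevalXm (bigD1 j) //= [in RHS](bigD1 j) //= mulmx_tor eqxx exprMn -!mulrA.
  by congr (_ * (_ * _)); apply: eq_bigr => l /negPf lj; rewrite mulmx_tor lj.
move=> t x t0 x0; rewrite -!AE //; last first.
  by move=> l; rewrite mulmx_tor; case: (l == j); rewrite ?mulf_neq0.
rewrite cj //; last exact: torus_inter.
have -> : \prod_l (x *m tor j t) 0 l = t * \prod_l x 0 l.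
  rewrite (bigD1 j) //= [in RHS](bigD1 j) //= mulmx_tor eqxx -mulrA; congr (_ * (_ * _)).
  by apply: eq_bigr => l /negPf lj; rewrite mulmx_tor lj.
rewrite exprMn expfzDr // -exprnP; ring.
Qed.

Lemma numerator_degree s m : (A s)@_m != 0 -> (mdeg m)%:Z = e + (n * K)%:Z.
Proof.
apply: (monomial_weight (h := fun m => mdeg m) (act := fun t x => t *: x)).
  move=> t x mu; rewrite !pevalXm mdegE expr_sum -big_split; apply: eq_bigr => l _ /=.
  by rewrite mxE exprMn.
move=> t x t0 x0; rewrite -!AE //; last by move=> l; rewrite mxE mulf_neq0.
rewrite (O_section_scale (@cO s)) //; last exact: torus_inter.
have -> : \prod_l (t *: x) 0 l = t ^+ n * \prod_l x 0 l.
  rewrite -[n in t ^+ n]card_ord -prodr_const -big_split.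
  by apply: eq_bigr => l _; rewrite mxE.
rewrite exprMn -exprM expfzDr // -exprnP; ring.
Qed.

Lemma numerator_cocycle (s : {ffun 'I_q.+2 -> 'I_n}) m :
  \sum_(a < q.+2) (-1) ^+ a * (A [ffun l => s (lift a l)])@_m = 0.
Proof.
have : \sum_(a < q.+2) (-1) ^+ a *: A [ffun l => s (lift a l)] = 0.
  apply: peval_vanish => x x0; have sx : inter X s x by move=> a; apply: x0.
  have := dc sx; rewrite /coboundary => /(congr1 (fun z => (\prod_l x 0 l) ^+ K * z)).
  rewrite mulr0 mulr_sumr => h; rewrite -[RHS]h peval_big.
  by apply: eq_bigr => a _; rewrite peval_scale -AE // mulrCA.
move/(congr1 (mcoeff m)); rewrite mcoeff0 raddf_sum => h; rewrite -[RHS]h.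
by apply: eq_bigr => a _; rewrite /= mcoeffZ.
Qed.

(** Otherwise all exponents are negative after the shift (m_j because b < 0). By [Adiv] every
    coordinate then occurs in s, so n <= q + 1; and the degree is at most n (K - 1), so e <= - n.
    Each alternative of [qe] excludes one of these. In the application e - d stands for this e. *)
Lemma numerator_good s m : (A s)@_m != 0 -> exists i, (i != j) && (K <= m i)%N.
Proof.
move=> Am; apply/existsP; apply: contraT => /existsPn h.
have mj := numerator_weight Am; have md := numerator_degree Am.
have mK l : (m l < K)%N.
  have [->|lj] := eqVneq l j; first lia.
  by have := h l; rewrite lj -ltnNge.
have [sl|sl] := boolP [forall l, [exists a, s a == l]]; last first.
  move: sl => /forallPn[l /existsPn sl].
  by have := Adiv sl Am; rewrite leqNgt mK.
have nq : (n <= q.+1)%N.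
  have [f fE] := fin_all_exists (fun l => existsP (forallP sl l)).
  rewrite -[n]card_ord -[q.+1]card_ord; apply: (leq_card f) => l l' ff.
  by rewrite -(eqP (fE l)) ff (eqP (fE l')).
case: qe => [qn|en]; first lia.
have : (mdeg m <= n * K.-1)%N.
  rewrite mdegE -[n in (n * _)%N]card_ord -sum_nat_const; apply: leq_sum => l _.
  by rewrite -ltnS prednK // (leq_ltn_trans _ (mK l)).
have : (0 < K)%N by rewrite (leq_ltn_trans _ (mK j)).
by move: md en; case: (K) => // K' md en _ /=; rewrite mulnS in md; lia.
Qed.

End Numerators.

End ScalarChart.

Section ScalarChart.
Variables (k : closedFieldType) (n : nat).
Implicit Types (x y : 'rV[k]_n) (t u : k).
Local Notation X := (@coord_locus k n).

Lemma zopen_inter_std q (s : {ffun 'I_q.+1 -> 'I_n}) : zopen (inter X s).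
Proof. by apply: zopen_inter => i; apply: zopen_coord_locus. Qed.

Lemma cons_face0 (T : Type) q (i : T) (s : {ffun 'I_q -> T}) :
  [ffun l => insert_at ord0 (i, s) (lift ord0 l)] = s.
Proof. by apply/ffunP => l; rewrite ffunE insert_at_lift. Qed.

Lemma cons_faceS (T : Type) q (i : T) (s : {ffun 'I_q.+1 -> T}) (a : 'I_q.+1) :
  [ffun l => insert_at ord0 (i, s) (lift (lift ord0 a) l)] =
  insert_at ord0 (i, [ffun l => s (lift a l)]).
Proof.
apply/ffunP => l; rewrite [LHS]ffunE; case: (unliftP ord0 l) => [l'|] ->.
  rewrite [RHS]insert_at_lift [RHS]ffunE.
  have -> : lift (lift ord0 a) (lift ord0 l') = lift ord0 (lift a l').
    by apply: val_inj; rewrite /= bumpS.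
  by rewrite insert_at_lift.
have -> : lift (lift ord0 a) ord0 = ord0 by apply: val_inj.
by rewrite !insert_at_eq.
Qed.

Section Homotopy.
Variables (q : nat) (c : cochain n k^o 'I_n q) (e b : int) (j : 'I_n).
Hypothesis cO : forall s, O_section e (inter X s) (c s).
Hypothesis dc : cochain_eq X (coboundary c) (fun _ _ => 0).
Hypothesis cj : forall (s : {ffun 'I_q.+1 -> 'I_n}) x t, inter X s x -> t != 0 ->
  c s (x *m tor j t) = t ^ b * c s x.
Hypothesis b0 : b < 0.
Hypothesis qe : (q < n.-1)%N \/ - n%:Z + 1 <= e.
Variables (K : nat) (A : {ffun 'I_q.+1 -> 'I_n} -> {mpoly k[n]}).
Hypothesis AE : forall (s : {ffun 'I_q.+1 -> 'I_n}) x, (forall l, x 0 l != 0) ->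
  (\prod_l x 0 l) ^+ K * c s x = peval (A s) x.
Hypothesis Adiv : forall (s : {ffun 'I_q.+1 -> 'I_n}) l, (forall a, s a != l) ->
  forall m, (A s)@_m != 0 -> (K <= m l)%N.

(** The exponent of x_j is b < 0 after the shift, and only coordinates in s may have negative
    exponents. *)
Lemma numerator_mem s m : (A s)@_m != 0 -> exists a, s a = j.
Proof.
move=> Am; have mj := numerator_weight cj AE Am.
have [/existsP[a /eqP sa]|/existsPn sj] := boolP [exists a, s a == j]; first by exists a.
by move: (Adiv sj Am) mj b0; clear; lia.
Qed.

(* A coordinate other than [j] that the Laurent monomial [m / \prod_l x_l ^+ K]
   contains with nonnegative exponent; coning with it is a contraction. *)
Definition cone_index (m : 'X_{1..n}) : 'I_n :=
  if [pick i | (i != j) && (K <= m i)%N] is Some i then i else j.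

Lemma cone_indexP s m : (A s)@_m != 0 -> (cone_index m != j) && (K <= m (cone_index m))%N.
Proof.
move=> Am; have [i ij] := numerator_good cO cj b0 qe AE Adiv Am.
by rewrite /cone_index; case: pickP => // /(_ i); rewrite ij.
Qed.

Definition bound := (\max_s msize (A s)).+1.

Lemma laurent_expansion s x : (forall l, x 0 l != 0) ->
  c s x = \sum_(m : 'X_{1..n < bound}) (A s)@_m * laurent K m x.
Proof.
move=> x0; have p0 : (\prod_l x 0 l) ^+ K != 0 by rewrite expf_neq0 //; apply/prodf_neq0 => l _.
apply: (mulfI p0); rewrite AE // {1}(mpolywE (k := bound) (p := A s)); last first.
  by apply: leqW; apply: leq_bigmax.
rewrite peval_big mulr_sumr; apply: eq_bigr => m _.
by rewrite peval_scale -(laurentE K m x0); ring.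
Qed.

Lemma O_section_laurent_term s (m : 'X_{1..n}) (U : region k n) :
  zopen U -> (A s)@_m != 0 ->
  (forall l, (m l < K)%N -> forall x, U x -> x 0 l != 0) ->
  O_section e U (fun x => laurent K m x).
Proof.
move=> oU Am h.
have -> : e = \sum_l ((m l)%:Z - K%:Z).
  have := numerator_degree cO AE Am; rewrite mdegE (big_morph Posz PoszD (erefl _)) => E.
  rewrite sumrB E sumr_const card_ord -mulr_natr natz PoszM; ring.
apply: (@O_section_prod _ _ _ _ _ (fun l => (m l)%:Z - K%:Z) (fun l x => x 0 l ^ ((m l)%:Z - K%:Z))) => // l.
apply: O_section_expz => //; case: (leqP K (m l)) => mK; [by left; rewrite subr_ge0 lez_nat | right].
exact: h.
Qed.

End Homotopy.

(** The cocycle condition on the pair (l, s), l the cone index, equates the coefficients of m in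
    [A s] and in [A] at the single index l; a nonzero one would need j = l. *)
Lemma scalar_chart0 (c : cochain n k^o 'I_n 0) e b j :
  (forall s, O_section e (inter X s) (c s)) ->
  cochain_eq X (coboundary c) (fun _ _ => 0) ->
  (forall (s : {ffun 'I_1 -> 'I_n}) x t, inter X s x -> t != 0 ->
    c s (x *m tor j t) = t ^ b * c s x) ->
  b < 0 -> (0 < n.-1)%N \/ - n%:Z + 1 <= e -> cochain_eq X c (fun _ _ => 0).
Proof.
move=> cO dc cj b0 qe; have [K [A [AE Adiv]]] := laurent_numerators cO.
move=> s; apply: (O_section_eq0 (@cO s)) => x sx x0.
rewrite (laurent_expansion AE) // big1 // => m _.
have [->|Am] := eqVneq (A s)@_m 0; first by rewrite mul0r.
have := numerator_cocycle dc AE (insert_at ord0 (cone_index j K m, s)) m.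
rewrite big_ord_recl big_ord1 /= cons_face0 expr0 mul1r expr1 mulN1r => /eqP.
rewrite subr_eq0 => /eqP E; move: (Am); rewrite E => Am'.
have [a] := numerator_mem cj b0 AE Adiv Am'.
rewrite ffunE; have -> : lift (lift ord0 ord0) (a : 'I_1) = ord0 :> 'I_2.
  by rewrite (ord1 a); apply: val_inj.
rewrite insert_at_eq /= => ij.
by have := cone_indexP cO cj b0 qe AE Adiv Am; rewrite ij eqxx.
Qed.

(** h takes the coefficient of each monomial m from the tuple with the cone index of m prepended. If
    s omits j, so does this tuple, the cone index being different from j, and the coefficient is 0;
    this vanishing is what permits lifting h to P(Omega). *)
Lemma scalar_chartS q (c : cochain n k^o 'I_n q.+1) e b j :
  (forall s, O_section e (inter X s) (c s)) ->
  cochain_eq X (coboundary c) (fun _ _ => 0) ->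
  (forall (s : {ffun 'I_q.+2 -> 'I_n}) x t, inter X s x -> t != 0 ->
    c s (x *m tor j t) = t ^ b * c s x) ->
  b < 0 -> (q.+1 < n.-1)%N \/ - n%:Z + 1 <= e ->
  exists h : cochain n k^o 'I_n q, [/\ forall s, O_section e (inter X s) (h s),
    forall (s : {ffun 'I_q.+1 -> 'I_n}) x, (forall a, s a != j) -> h s x = 0 & cochain_eq X c (coboundary h)].
Proof.
move=> cO dc cj b0 qe; have [K [A [AE Adiv]]] := laurent_numerators cO.
pose io m := cone_index j K m; pose B := bound A.
pose h : cochain n k^o 'I_n q := fun s x =>
  \sum_(m : 'X_{1..n < B}) (A (insert_at ord0 (io m, s)))@_m * laurent K m x.
have hO s : O_section e (inter X s) (h s).
  have os := @zopen_inter_std q s; apply: O_section_sum => // m _.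
  have [E|Am] := eqVneq (A (insert_at ord0 (io m, s)))@_m 0.
    by apply: eq_O_section (O_section0 e os) => x _; rewrite E mul0r.
  apply: O_sectionZ; apply: (O_section_laurent_term cO AE os Am).
  (* A coordinate with negative exponent occurs in the extended tuple by [Adiv] and is not the cone
     index, whose exponent is nonnegative; so it occurs in s. *)
  move=> l ml x sx; have /andP[_ mi] := cone_indexP cO cj b0 qe AE Adiv Am.
  have [/existsP[a /eqP <-]|/existsPn sl] := boolP [exists a, s a == l]; first exact: sx.
  exfalso; suff : (K <= m l)%N by rewrite leqNgt ml.
  apply: (@Adiv (insert_at ord0 (io m, s)) l _ m Am) => a.
  case: (unliftP ord0 a) => [a'|] ->.
    by rewrite insert_at_lift sl.
  by rewrite insert_at_eq /=; apply: contraTneq ml => <-; rewrite -leqNgt.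
exists h; split=> //.
  move=> s x sj; rewrite /h big1 // => m _.
  have [->|Am] := eqVneq (A (insert_at ord0 (io m, s)))@_m 0; first by rewrite mul0r.
  have [a] := numerator_mem cj b0 AE Adiv Am.
  case: (unliftP ord0 a) => [a'|] ->; first by rewrite insert_at_lift => /eqP; rewrite (negPf (sj a')).
  rewrite insert_at_eq => /= ij.
  by have := cone_indexP cO cj b0 qe AE Adiv Am; rewrite -/(io m) ij eqxx.
move=> s x sx; apply/eqP; rewrite -subr_eq0; apply/eqP; move: x sx.
have os := @zopen_inter_std q.+1 s.
apply: (O_section_eq0 (U := inter X s) (e := e)) => [|x sx x0].
  apply: O_sectionD => //.
  apply: (eq_O_section (f := fun x => (-1) * \sum_(a < q.+2) (-1) ^+ a * h [ffun l => s (lift a l)] x)).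
    by move=> x _; rewrite mulN1r.
  apply: O_sectionZ; apply: O_section_sum => // a _; apply: O_sectionZ.
  by apply: O_sectionW (hO _) => // x sx i; rewrite ffunE.
rewrite (laurent_expansion AE) //; apply/eqP; rewrite subr_eq0; apply/eqP.
have -> : coboundary h s x = \sum_(m : 'X_{1..n < B})
    (\sum_(a < q.+2) (-1) ^+ a * (A (insert_at ord0 (io m, [ffun l => s (lift a l)])))@_m) * laurent K m x.
  under [RHS]eq_bigr do rewrite mulr_suml.
  rewrite exchange_big; apply: eq_bigr => a _; rewrite scaler_sumr.
  by apply: eq_bigr => m _; rewrite -mulrA.
apply: eq_bigr => m _; congr (_ * _).
(* The cone index depends on m only, so all faces of s are coned with the same index and the cocycle
   condition on the extended tuple is the desired identity. *)
have := numerator_cocycle dc AE (insert_at ord0 (io m, s)) m.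
rewrite big_ord_recl /= cons_face0 expr0 mul1r => /eqP; rewrite addr_eq0 => /eqP->.
rewrite -sumrN; apply: eq_bigr => a _; rewrite cons_faceS /bump /= add1n exprS.
by rewrite mulN1r mulNr opprK.
Qed.

End ScalarChart.

(** * Cohomology of the standard cover *)

Section StandardCohomology.
Variables (k : closedFieldType) (n d : nat) (P : poly_functor k d) (e : int).
Implicit Types (x y : 'rV[k]_n) (t u : k).
Local Notation X := (@coord_locus k n).
Local Notation M := (P 'cV[k]_n).
Local Notation F := (@POmega_section k n d P e).

Let psF := POmega_presheaf P n e.
Let oX := @zopen_std k n.

Definition skip_proj (j : 'I_n) : 'M[k]_n := skip_mx k j *m (skip_mx k j)^T.

Lemma skip_proj_tor j t : skip_proj j *m tor j t = skip_proj j.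
Proof.
rewrite /skip_proj -mulmxA; congr (_ *m _); apply/matrixP => a b.
rewrite mul_mx_diag !mxE; case: (b =P lift j a) => [->|_]; last by rewrite mul0r.
by rewrite mul1r eq_sym (negPf (neq_lift _ _)).
Qed.

Lemma pm_lift_ker j x (s : M) : x 0 j != 0 -> in_POmega x s -> pm P (lift_ker j x) s = s.
Proof. by move=> xj sx; rewrite lift_kerE sx ?lift_ker_proj. Qed.

Lemma POmega_chartK j x (s : M) : x 0 j != 0 -> in_POmega x s ->
  pm P (lift_ker j x) (pm P (skip_proj j) s) = s.
Proof. by move=> xj sx; rewrite -pmM lift_ker_skip // pm_lift_ker. Qed.

Section Chart.
Variables (q : nat) (c : cochain n M 'I_n q) (j : 'I_n) (b : int).
Hypothesis zc : is_cocycle F X c.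
Hypothesis cb : eigen_cochain j b c.

Definition chart_coord i : cochain n k^o 'I_n q :=
  fun s x => coord (vbasis fullv) i (pm P (skip_proj j) (c s x)).

Lemma cocycle_section s : OM_section (e - d%:Z) (inter X s) (c s).
Proof.
by have [cF _] := zc; have /(POmega_sectionP _ _ (@zopen_inter_std _ _ _ _))[] := cF s.
Qed.

Lemma cocycle_in_POmega s x : inter X s x -> in_POmega x (c s x).
Proof.
have [cF _] := zc; have /(POmega_sectionP _ _ (@zopen_inter_std _ _ _ _))[_ h] := cF s.
exact: h.
Qed.

Lemma chart_coord_section i s : O_section (e - d%:Z) (inter X s) (chart_coord i s).
Proof.
have os := @zopen_inter_std k n q s.
have h : OM_section (e - d%:Z) (inter X s) (fun x => pm P (skip_proj j) (c s x)).
  rewrite -[e - _]addr0 -(mul0r d%:Z).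
  apply: (@OM_section_pm _ _ P _ _ _ _ _ _ (fun _ => skip_proj j) (c s) os).
    by move=> a a'; apply: O_section_cst.
  exact: cocycle_section.
by have /(OM_sectionP _ _ os) h' := h; apply: h'.
Qed.

Lemma chart_coord_cocycle i : cochain_eq X (coboundary (chart_coord i)) (fun _ _ => 0).
Proof.
move=> s x sx; have [_ dc] := zc.
have := congr1 (fun z => coord (vbasis fullv) i (pm P (skip_proj j) z)) (dc s x sx).
rewrite pm_zero linear0 => h; rewrite -[RHS]h /coboundary pm_sum linear_sum.
by apply: eq_bigr => a _; rewrite pm_scale linearZ.
Qed.

(** The torus factor at j acts trivially on V / V_j, so in the chart the weight b is exactly the
    degree in x_j. *)
Lemma chart_coord_weight i (s : {ffun 'I_q.+1 -> 'I_n}) x t : inter X s x -> t != 0 ->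
  chart_coord i s (x *m tor j t) = t ^ b * chart_coord i s x.
Proof.
move=> sx t0; have := cb t0 sx; rewrite /act_cochain => /(congr1 (pm P (skip_proj j))).
by rewrite -pmM skip_proj_tor pm_scale /chart_coord => ->; rewrite linearZ.
Qed.

(** s need not contain j: at torus points x_j is nonzero and the chart is injective, and torus
    points are dense. *)
Lemma cocycle_chart_eq0 s : (forall i x, inter X s x -> chart_coord i s x = 0) ->
  forall x, inter X s x -> c s x = 0.
Proof.
move=> h; apply: (OM_section_eq0 (@cocycle_section s)) => x sx x0.
rewrite -(POmega_chartK (x0 j) (cocycle_in_POmega sx)).
suff -> : pm P (skip_proj j) (c s x) = 0 by rewrite pm_zero.
by apply: coord_ext => i; rewrite linear0; apply: h.
Qed.

End Chart.

(** The scalar contractions, one per coordinate of the target of [skip_proj], are assembled and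
    lifted by [lift_ker], which is regular only where x_j is nonzero. On tuples without j both the
    contraction and c vanish, so the lift is a cochain everywhere. *)
Theorem negative_weight_coboundary q (c : cochain n M 'I_n q) j b :
  is_cocycle F X c -> eigen_cochain j b c -> b < 0 ->
  (q < n.-1)%N \/ - n%:Z + 1 <= e - d%:Z -> is_coboundary F X c.
Proof.
move=> zc cb b0 qe.
have cO := chart_coord_section j zc; have dc := chart_coord_cocycle j zc.
have cw := chart_coord_weight cb.
case: q c zc cb qe cO dc cw => [|q] c zc cb qe cO dc cw.
  move=> s x sx; apply: (cocycle_chart_eq0 zc (j := j)) sx => i y sy.
  exact: (scalar_chart0 (cO i) (dc i) (@cw i) b0 qe).
have [h hP] := fin_all_exists (fun i => scalar_chartS (cO i) (dc i) (@cw i) b0 qe).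
pose hbar s x : M := \sum_i h i s x *: (vbasis (fullv : {vspace M}))`_i.
have hbar0 (s : {ffun 'I_q.+1 -> 'I_n}) x : (forall a, s a != j) -> hbar s x = 0.
  by move=> sj; rewrite /hbar big1 // => i _; have [_ h0 _] := hP i; rewrite h0 // scale0r.
have cE (s : {ffun 'I_q.+2 -> 'I_n}) x : inter X s x -> pm P (skip_proj j) (c s x) =
    \sum_(a < q.+2) (-1) ^+ a *: hbar [ffun l => s (lift a l)] x.
  move=> sx; rewrite [LHS]coord_full /hbar.
  under [RHS]eq_bigr do rewrite scaler_sumr.
  rewrite exchange_big; apply: eq_bigr => i _ /=.
  have [_ _ /(_ s x sx) hE] := hP i; rewrite -/(chart_coord c j i s x) hE scaler_suml.
  by apply: eq_bigr => a _; rewrite scalerA.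
exists (fun s x => pm P (lift_ker j x) (hbar s x)); split=> [s|s x sx].
  have os := @zopen_inter_std k n q s.
  have [/existsP[a /eqP sa]|/existsPn sj] := boolP [exists a, s a == j]; last first.
    have [_ h0 _ _] := psF; apply: (presheafW psF (h0 _ os)) => // x _.
    by rewrite hbar0 // pm_zero.
  have xj x : inter X s x -> x 0 j != 0 by rewrite -sa; apply.
  apply/POmega_sectionP => //; split; last first.
    move=> x sx v xv; rewrite -pmM mulmxBl mul1mx -mulmxA mulmx_lift_ker ?mulmx0 ?subr0 //.
    exact: xj.
  rewrite -[e - _]addr0 -(mul0r d%:Z).
  apply: (@OM_section_pm _ _ P _ _ _ _ _ _ (lift_ker j) (hbar s) os).
    exact: O_section_lift_ker.
  apply: OM_section_sum => // i; rewrite -[e - _]addr0; apply: OM_sectionZ.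
    by have [hO _ _] := hP i.
  by move=> phi; apply: O_section_cst.
(* If s contains j, lifting the chart identity recovers c; its faces may omit j, but there [hbar] is
   0. Otherwise c vanishes because its chart coordinates are coboundaries of cochains that vanish on
   all faces. *)
have [/existsP[a /eqP sa]|/existsPn sj] := boolP [exists a, s a == j].
  have xj : x 0 j != 0 by rewrite -sa; apply: sx.
  rewrite -[LHS](POmega_chartK xj (cocycle_in_POmega zc sx)) cE // pm_sum.
  by apply: eq_bigr => a' _; rewrite pm_scale.
have -> : c s x = 0.
  apply: (cocycle_chart_eq0 zc (j := j)) sx => i y sy.
  have [_ h0 ->] := hP i => //; rewrite /coboundary big1 // => a _.
  by rewrite h0 ?scaler0 // => a'; rewrite ffunE.
rewrite /coboundary big1 // => a _; rewrite hbar0 ?pm_zero ?scaler0 // => a'.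
by rewrite ffunE.
Qed.

(** Torus elements commute, so splitting along j keeps the weights already obtained along i. *)
Lemma eigen_combination q (c : cochain n M 'I_n q) i b j N (lam tau : 'I_N -> k) :
  (forall l, tau l != 0) -> eigen_cochain i b c ->
  eigen_cochain i b (fun s x => \sum_l lam l *: act_cochain (tor j (tau l)) c s x).
Proof.
move=> tau0 cb t t0 s x sx; rewrite {1}/act_cochain pm_sum scaler_sumr; apply: eq_bigr => l _.
rewrite pm_scale -[pm P (tor i t) _]act_cochainM torC act_cochainM /act_cochain.
rewrite -[pm P (tor i t) _]/(act_cochain (tor i t) c s _) cb //; last exact/inter_tor.
by rewrite pm_scale !scalerA mulrC.
Qed.

Lemma is_cocycle_combination q (c : cochain n M 'I_n q) j N (lam tau : 'I_N -> k) :
  (forall l, tau l != 0) -> is_cocycle F X c ->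
  is_cocycle F X (fun s x => \sum_l lam l *: act_cochain (tor j (tau l)) c s x).
Proof.
move=> tau0 zc; elim: (index_enum _) => [|l r IH].
  have h0 := @is_cocycle0 _ _ _ _ psF 'I_n X oX q.
  by apply: (eq_is_cocycle psF oX) h0 => s x _; rewrite big_nil.
have h1 := is_cocycleZ psF oX (lam l) (is_cocycle_tor j (tau0 l) zc).
by apply: (eq_is_cocycle psF oX) (is_cocycleD psF oX h1 IH) => s x _; rewrite big_cons.
Qed.

(** Splits along one coordinate at a time, r being the list of those still to be treated. Components
    of negative weight are discarded at once as coboundaries. *)
Lemma standard_reduction q (Q : cochain n M 'I_n q -> Prop) :
  (q < n.-1)%N \/ - n%:Z + 1 <= e - d%:Z ->
  (forall c c', cochain_eq X c c' -> Q c -> Q c') ->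
  (forall c c', Q c -> Q c' -> Q (fun s x => c s x + c' s x)) ->
  (forall c, is_coboundary F X c -> Q c) ->
  (forall c, is_cocycle F X c -> (forall j, exists b : nat, eigen_cochain j b%:Z c) -> Q c) ->
  forall c, is_cocycle F X c -> Q c.
Proof.
move=> qe Qeq QD Qb Q0 c zc.
suff H (r : seq 'I_n) c' : is_cocycle F X c' ->
    (forall j, j \notin r -> exists b : nat, eigen_cochain j b%:Z c') -> Q c'.
  by apply: (H (enum 'I_n) c zc) => j; rewrite mem_enum.
elim: r c' => [|j r IH] c' zc' hc'; first by apply: Q0 => // j; apply: hc'.
have [N [lam [tau [b [tau0 cE hb]]]]] := torus_decomposition j zc'.
apply: (Qeq _ _ (fun s x sx => esym (cE s x sx))).
pose C a : cochain n M 'I_n q := fun s x => \sum_l lam a l *: act_cochain (tor j (tau l)) c' s x.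
suff H l : Q (fun s x => \sum_(a <- l) C a s x) by apply: H.
elim: l => [|a l IHl].
  apply: Qb; have h0 := @is_coboundary0 _ _ _ _ psF 'I_n X oX q.
  by apply: eq_is_coboundary h0 => s x _; rewrite big_nil.
have za := is_cocycle_combination j (lam a) tau0 zc'.
have Qa : Q (C a).
  case ba : (b a) (hb a) => [m|m] hba; last first.
    by apply: Qb; apply: (negative_weight_coboundary za hba).
  apply: IH => // i ir; have [->|ij] := eqVneq i j; first by exists m.
  have [|b' hb'] := hc' i; first by rewrite inE negb_or ij.
  by exists b'; apply: eigen_combination.
by apply: (Qeq _ _ _ (QD _ _ Qa IHl)) => s x _; rewrite big_cons.
Qed.

(** The product of all torus factors at u is the scalar u, which acts by u^d through P and by
    u^(e-d) on the argument. *)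
Lemma total_weight q (c : cochain n M 'I_n q) (b : 'I_n -> int) :
  is_cocycle F X c -> (forall j, eigen_cochain j (b j) c) ->
  forall s x, inter X s x -> c s x = 0 \/ \sum_j b j = e.
Proof.
move=> zc cb s x sx.
pose T (r : seq 'I_n) u : 'M[k]_n := diag_mx (\row_i (if i \in r then u else 1)).
have H r u : uniq r -> u != 0 -> cochain_eq X (act_cochain (T r u) c)
    (fun s x => u ^ (\sum_(j <- r) b j) *: c s x).
  move=> ur u0; elim: r ur => [_|j r IH /= /andP[jr ur]] s' x' sx'.
    rewrite big_nil expr0z scale1r (_ : T [::] u = 1%:M) /act_cochain ?pm1 ?mulmx1 //.
    by apply/matrixP => i l; rewrite !mxE.
  have -> : T (j :: r) u = tor j u *m T r u.
    rewrite mulmx_diag; congr diag_mx; apply/rowP => i; rewrite !mxE inE.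
    by case: eqP => [->|_] /=; rewrite ?(negPf jr) ?mulr1 ?mul1r.
  rewrite act_cochainM {1}/act_cochain IH //; last exact/inter_tor.
  rewrite pm_scale -[pm P _ _]/(act_cochain (tor j u) c s' x') cb // scalerA.
  by rewrite big_cons [b j + _]addrC expfzDr.
have [->|cx0] := eqVneq (c s x) 0; [by left | right].
apply: (@exp_inj k) => u u0; have := H (enum 'I_n) u (enum_uniq _) u0 s x sx.
rewrite (_ : T (enum 'I_n) u = u%:M); last first.
  by apply/matrixP => i l; rewrite !mxE mem_enum.
have sc : OM_section (e - d%:Z) (inter X s) (c s) by exact: cocycle_section.
rewrite /act_cochain mul_mx_scalar (OM_section_scale sc sx u0).
rewrite -[u%:M]scalemx1 pmZ pm1 scalerA big_enum /= => /eqP.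
rewrite -subr_eq0 -scalerBl scaler_eq0 (negPf cx0) orbF subr_eq0 => /eqP <-.
by rewrite exprnP -expfzDr // addrC subrK.
Qed.

(** The standard cover is torus stable, but its translate is a different family of predicates; the
    identity refinement passes between them. *)
Lemma is_coboundary_tor q (c : cochain n M 'I_n q) j t : t != 0 ->
  is_coboundary F X c -> is_coboundary F X (act_cochain (tor j t) c).
Proof.
move=> t0 /(is_coboundary_act (unit_tor j t0) oX) h.
have oX' i : zopen (fun x => X i (x *m tor j t)).
  by apply: (zopen_linear (U := X i) (unit_tor j t0)).
have sub i : sub_region (X i) (fun x => X i (x *m tor j t)).
  move=> x xi; rewrite /coord_locus mulmx_tor; case: (i =P j) => // _.
  by rewrite mulf_neq0.
apply: eq_is_coboundary (is_coboundary_refine psF oX' oX sub h) => s x _.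
by congr (act_cochain _ c _ x); apply/ffunP => i; rewrite ffunE.
Qed.

Theorem standard_vanishing q (c : cochain n M 'I_n q) : e < 0 ->
  (q < n.-1)%N \/ - n%:Z + 1 <= e - d%:Z -> is_cocycle F X c -> is_coboundary F X c.
Proof.
move=> e0 qe; apply: (standard_reduction qe) => //.
- by move=> c1 c2; apply: eq_is_coboundary.
- by move=> c1 c2; apply: is_coboundaryD.
move=> c' zc /fin_all_exists[b hb].
have h0 := @is_coboundary0 _ _ _ _ psF 'I_n X oX q.
apply: eq_is_coboundary h0 => s x sx.
case: (total_weight zc hb sx) => // E; exfalso; move: e0; rewrite -E ltNge.
by apply/negP/negPn; apply: sumr_ge0.
Qed.

Theorem standard_torus_trivial q (c : cochain n M 'I_n q) : e = 0 ->
  (q < n.-1)%N \/ - n%:Z + 1 <= e - d%:Z -> is_cocycle F X c ->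
  forall j t, t != 0 -> is_coboundary F X (fun s x => act_cochain (tor j t) c s x - c s x).
Proof.
move=> e0 qe zc j t t0.
apply: (standard_reduction qe (Q := fun c => is_coboundary F X
  (fun s x => act_cochain (tor j t) c s x - c s x))) zc => [c1 c2 cc|c1 c2 h1 h2|c1 h1|c1 zc].
- apply: eq_is_coboundary => s x sx; rewrite /act_cochain !cc //.
  exact/inter_tor.
- apply: eq_is_coboundary (is_coboundaryD psF oX h1 h2) => s x _.
  by rewrite /act_cochain pm_add opprD addrACA.
- apply: eq_is_coboundary (is_coboundaryD psF oX (is_coboundary_tor j t0 h1) (is_coboundaryN psF oX h1)).
  by move=> s x.
move=> /fin_all_exists[b hb].
have h0 := @is_coboundary0 _ _ _ _ psF 'I_n X oX q.
apply: eq_is_coboundary h0 => s x sx; rewrite hb //.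
case: (total_weight zc hb sx) => [->|E]; first by rewrite scaler0 subrr.
have /psumr_eq0P -> // : \sum_i (b i)%:Z = 0 by rewrite E e0.
by rewrite expr0z scale1r subrr.
Qed.

End StandardCohomology.

(** * Generation of GL_n and conclusion *)

Section Generation.
Variables (k : closedFieldType) (n : nat) (G : 'M[k]_n -> Prop).
Hypothesis Gunit : forall g, G g -> g \in unitmx.
Hypothesis G1 : G 1%:M.
Hypothesis GM : forall g h, G g -> G h -> G (g *m h).
Hypothesis GJ : forall g h, h \in unitmx -> G g -> G (h *m g *m invmx h).
Hypothesis Gtor : forall j t, t != 0 -> G (tor j t).

Lemma unitmx_ker (h : 'M[k]_n) : (forall u : 'cV_n, h *m u = 0 -> u = 0) -> h \in unitmx.
Proof.
move=> hu; rewrite -unitmx_tr -row_free_unit; apply: inj_row_free => v vh.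
by apply: trmx_inj; rewrite trmx0; apply: hu; rewrite -[h]trmxK -trmx_mul vh trmx0.
Qed.

Lemma torE j (t : k) : tor j t = 1%:M + (t - 1) *: (delta_mx j j : 'M[k]_n).
Proof.
apply/matrixP => a b; rewrite !mxE.
have [->|ab] := eqVneq a b; last first.
  rewrite !mulr0n add0r; case: andP => [[/eqP aj /eqP bj]|_]; last by rewrite mulr0.
  by rewrite aj bj eqxx in ab.
by rewrite !mulr1n andbb; case: eqP => _; rewrite ?mulr1 ?mulr0 ?addr0 // addrC subrK.
Qed.

(** Conjugate to [tor j (1 + c)] by h, which sends e_j to v and the hyperplane of vanishing j-th
    coordinate to ker phi. Choosing j with phi_j nonzero makes e_j a complement of ker phi. *)
Lemma pseudo_reflection (v : 'cV[k]_n) (phi : 'rV[k]_n) c : phi *m v = c%:M ->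
  c != 0 -> 1 + c != 0 -> G (1%:M + v *m phi).
Proof.
move=> pv c0 c1; have phi0 : phi != 0.
  apply: contra_neq c0 => p0; have := congr1 (fun A : 'M_1 => A 0 0) pv.
  by rewrite p0 mul0mx !mxE eqxx mulr1n.
have [j pj] := neq0_coord phi0.
pose h : 'M[k]_n := 1%:M - (phi 0 j)^-1 *: (delta_mx j 0 *m phi) + v *m delta_mx 0 j.
have h_j : h *m delta_mx j (0 : 'I_1) = v.
  rewrite /h mulmxDl mulmxBl mul1mx -scalemxAl -!mulmxA (mulmx_delta_coord j phi).
  rewrite (mul_mx_scalar (phi 0 j)) scalerA mulVf // scale1r subrr add0r mul_delta_mx.
  by rewrite (_ : delta_mx 0 0 = 1%:M) ?mulmx1 //; apply/matrixP => a b; rewrite !ord1 !mxE.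
have phi_h : phi *m h = c *: delta_mx 0 j.
  rewrite /h mulmxDr mulmxBr mulmx1 -scalemxAr !mulmxA mulmx_delta_coord mul_scalar_mx.
  by rewrite scalerA mulVf // scale1r subrr add0r pv mul_scalar_mx.
have uh : h \in unitmx.
  apply: unitmx_ker => u hu0.
  have uj : u j 0 = 0.
    have := mulmxA phi h u; rewrite hu0 mulmx0 phi_h -scalemxAl => /esym/eqP.
    rewrite scaler_eq0 (negPf c0) /= -rowE => /eqP/matrixP/(_ 0 0).
    by rewrite !mxE.
  have : h *m u = u - ((phi 0 j)^-1 * (phi *m u) 0 0) *: delta_mx j 0.
    rewrite /h mulmxDl mulmxBl mul1mx -scalemxAl -!mulmxA -rowE.
    rewrite (_ : row j u = 0) ?mulmx0 ?addr0; last first.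
      by apply/matrixP => a b; rewrite !ord1 !mxE uj.
    by have := mx11_scalar (phi *m u); set a := (_ 0 0) => ->; rewrite mul_mx_scalar scalerA.
  rewrite hu0 => /esym/eqP; rewrite subr_eq0 => /eqP E.
  have := uj; rewrite E !mxE !eqxx mulr1 => e0.
  by rewrite e0 scale0r.
have djj : delta_mx j j = delta_mx j (0 : 'I_1) *m delta_mx 0 j :> 'M[k]_n.
  by rewrite mul_delta_mx.
have E : h *m tor j (1 + c) = (1%:M + v *m phi) *m h.
  rewrite torE djj mulmxDr mulmx1 -scalemxAr mulmxA h_j mulmxDl mul1mx -mulmxA phi_h.
  by rewrite -scalemxAr (addrAC 1) subrr add0r.
have -> : 1%:M + v *m phi = h *m tor j (1 + c) *m invmx h by rewrite E mulmxK.
by apply: GJ => //; apply: Gtor.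
Qed.

(** The case c = 0 is a transvection, a product of two pseudo-reflections along the same v: phi =
    phi1 + (1 + a) phi2 with phi1 v = a. *)
Lemma rank_one_perturbation (v : 'cV[k]_n) (phi : 'rV[k]_n) c : phi *m v = c%:M ->
  1 + c != 0 -> G (1%:M + v *m phi).
Proof.
move=> pv c1; have [c0|] := eqVneq c 0; last by move=> c0; apply: pseudo_reflection pv c0 c1.
have [->|v0] := eqVneq v 0; first by rewrite mul0mx addr0.
have [m vm] : exists m, v m 0 != 0.
  have [|m] := @neq0_coord k n v^T; last by rewrite mxE => vm; exists m.
  by apply: contra_neq v0 => v0; rewrite -[v]trmxK v0 trmx0.
(* Both factors are pseudo-reflections when a is neither 0 nor -1. *)
have X1 : 'X + 1%:P != 0 :> {poly k} by rewrite -size_poly_gt0 size_XaddC.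
have [a [a0 a1]] := exists_nonroot X1.
have {}a1 : 1 + a != 0 by move: a1; rewrite rootE hornerD hornerX hornerC addrC.
pose phi1 : 'rV[k]_n := (a / v m 0) *: delta_mx 0 m.
pose phi2 : 'rV[k]_n := (1 + a)^-1 *: (phi - phi1).
have p1v : phi1 *m v = a%:M.
  rewrite /phi1 -scalemxAl -rowE; apply/matrixP => i l; rewrite !ord1 !mxE.
  by rewrite divfK // eqxx mulr1n.
have p2v : phi2 *m v = (- a / (1 + a))%:M.
  rewrite /phi2 -scalemxAl mulmxBl pv p1v c0; apply/matrixP => i l; rewrite !ord1 !mxE.
  by rewrite eqxx !mulr1n sub0r mulrC.
have -> : 1%:M + v *m phi = (1%:M + v *m phi1) *m (1%:M + v *m phi2).
  rewrite mulmxDr mulmx1 mulmxDl mul1mx -[v *m phi1 *m _]mulmxA (mulmxA phi1) p1v.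
  rewrite mul_scalar_mx -!addrA; congr (_ + _); rewrite -!mulmxDr; congr (_ *m _).
  rewrite -{1}[phi2]scale1r -scalerDl /phi2 scalerA divff // scale1r.
  by rewrite addrC subrK.
apply: GM; first exact: pseudo_reflection p1v a0 a1.
have e1 : 1 + - a / (1 + a) = (1 + a)^-1 by field.
apply: pseudo_reflection p2v _ _; last by rewrite e1 invr_eq0.
by rewrite mulf_neq0 ?oppr_eq0 ?invr_eq0.
Qed.

(** Induction on the number i of basis vectors not yet known to be fixed. If g fixes the e_m with m
    < j, a rank one perturbation r of the identity fixes them too and agrees with g on e_j, so r^-1
    g fixes one more. *)
Lemma gl_generated g : g \in unitmx -> G g.
Proof.
suff H i : (i <= n)%N -> forall g, g \in unitmx ->
    (forall m : 'I_n, (m < n - i)%N -> g *m delta_mx m (0 : 'I_1) = delta_mx m 0) -> G g.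
  by move=> ug; apply: (H n) => // m; rewrite subnn.
elim: i => [_ {}g _ gm|i IH ni {}g ug gm].
  suff -> : g = 1%:M by [].
  apply/matrixP => a b; have := gm b; rewrite subn0 ltn_ord => /(_ isT).
  by rewrite -colE => /matrixP/(_ a 0); rewrite !mxE eqxx andbT.
have jn : (n - i.+1 < n)%N by lia.
pose j := Ordinal jn; pose w := g *m delta_mx j (0 : 'I_1).
have jE : (j : nat) = (n - i.+1)%N by [].
(* Otherwise g e_j would lie in the span of the e_m with m < j, which g fixes, against
   injectivity. *)
have [l jl wl] : exists2 l : 'I_n, (j <= l)%N & w l 0 != 0.
  apply: NNPP => nl; pose u : 'cV[k]_n := \col_l (if (l < j)%N then w l 0 else 0).
  have uE : u = \sum_l u l 0 *: delta_mx l 0.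
    rewrite {1}[u]matrix_sum_delta; apply: eq_bigr => l _; rewrite big_ord1.
    by rewrite (ord1 0).
  have gu : g *m u = u.
    rewrite {1}uE mulmx_sumr [RHS]uE; apply: eq_bigr => l _; rewrite -scalemxAr mxE.
    by case: ltnP => [lj|_]; rewrite ?scale0r // gm //; move: lj; rewrite jE; lia.
  have wu : w = u.
    apply/colP => l; rewrite [u l 0]mxE; case: ltnP => // jl.
    by apply/eqP/negPn/negP => wl; apply: nl; exists l.
  have : g *m delta_mx j (0 : 'I_1) = g *m u by rewrite gu -wu.
  move/(congr1 (mulmx (invmx g))); rewrite !mulKmx // => /colP/(_ j).
  by rewrite !mxE !eqxx ltnn => /eqP; rewrite oner_eq0.
(* For r = 1 + (w - e_j) phi, the last two conditions give r e_j = w and r e_m = e_m, and 1 + phi (w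
   - e_j) = b is nonzero. The j-th coordinate serves for phi unless it vanishes on w; then the l-th
   is added. *)
have [phi [b [b0 pw pj pm]]] : exists (phi : 'rV[k]_n) b, [/\ b != 0, phi *m w = b%:M,
    phi *m delta_mx j (0 : 'I_1) = 1%:M
  & forall m : 'I_n, (m < j)%N -> phi *m delta_mx m (0 : 'I_1) = 0].
  have D (a c : 'I_n) : delta_mx 0 a *m delta_mx c 0 = (a == c)%:R%:M :> 'M[k]_1.
    by rewrite mul_delta_mx_cond; apply/matrixP => x y; rewrite !ord1 mulrb; case: eqP; rewrite !mxE.
  have D0 (a c : 'I_n) : a != c -> delta_mx 0 a *m delta_mx c 0 = 0 :> 'M[k]_1.
    by move=> /negPf ac; rewrite D ac raddf0.
  have W a : delta_mx 0 a *m w = (w a 0)%:M :> 'M[k]_1.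
    by rewrite -rowE; apply/matrixP => x y; rewrite !ord1 !mxE eqxx mulr1n.
  have [wj|wj] := eqVneq (w j 0) 0; last first.
    exists (delta_mx 0 j), (w j 0); split; rewrite ?W ?D ?eqxx //.
    by move=> m mj; apply: D0; rewrite -val_eqE /= gtn_eqF.
  exists (delta_mx 0 j + delta_mx 0 l), (w l 0); split=> // [||m mj].
  - by rewrite mulmxDl !W wj raddf0 add0r.
  - rewrite mulmxDl !D eqxx; case: eqP => [lj|_]; first by rewrite lj wj eqxx in wl.
    by rewrite raddf0 addr0.
  by rewrite mulmxDl !D0 ?addr0 // -val_eqE /= gtn_eqF // (leq_trans mj).
pose r := 1%:M + (w - delta_mx j 0) *m phi.
have Gr : G r.
  apply: (@rank_one_perturbation _ _ (b - 1)); last by rewrite addrC subrK.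
  by rewrite mulmxBr pw pj -raddfB.
have ur := Gunit Gr.
have -> : g = r *m (invmx r *m g) by rewrite mulKVmx.
apply: GM => //; apply: IH; [lia | by rewrite unitmx_mul unitmx_inv ur |].
move=> m mj; have rm : r *m delta_mx m (0 : 'I_1) = g *m delta_mx m 0.
  rewrite /r mulmxDl mul1mx -mulmxA; case: (ltnP m j) => mj'.
    by rewrite pm // mulmx0 addr0 gm //; move: mj'; rewrite jE; lia.
  have -> : m = j by apply: ord_inj; move: mj mj'; rewrite jE; lia.
  by rewrite pj mulmx1 addrC subrK.
by rewrite -mulmxA -rm mulKmx.
Qed.

End Generation.

Section Main.
Variables (k : closedFieldType) (n d : nat) (P : poly_functor k d).
Local Notation M := (P 'cV[k]_n).
Local Notation X := (@coord_locus k n).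

Lemma POmega_vanishing e q : e < 0 -> (q < n.-1)%N \/ - n%:Z + 1 <= e - d%:Z ->
  POmega_cohomology_vanishes n P e q.
Proof.
move=> e0 qe z zP; have psF := POmega_presheaf P n e.
have [c [zc zc_z]] := standard_cover_class zP.
have cX := zcover_coord_locus k n.
apply: (same_class_trans psF (z' := CechRep X c)) => //.
exists 'I_n, X, id, (fun _ => tt); split=> //; first by move=> j x.
  by move=> j x xj; have [] := @zopen_std k n j x xj.
apply: eq_is_coboundary (standard_vanishing e0 qe zc) => s x sx.
rewrite /refine /= subr0; congr (c _ x); apply/ffunP => i; by rewrite ffunE.
Qed.

(** The action also moves the cover, so the translated cocycle is first compared with its
    restriction to the standard cover. *)
Lemma POmega_tor_trivial q : (q < n.-1)%N \/ - n%:Z + 1 <= 0 - d%:Z ->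
  forall j t, t != 0 -> forall z : cech_rep n M q, is_class (@POmega_section k n d P 0) z ->
  same_class (@POmega_section k n d P 0) (gl_act (tor j t) z) z.
Proof.
move=> qe j t t0 z zP; have psF := POmega_presheaf P n 0.
have [c [zc zc_z]] := standard_cover_class zP.
have cX := zcover_coord_locus k n.
have ut := unit_tor j t0.
have zX : is_class (@POmega_section k n d P 0) (CechRep X c) by [].
apply: (same_class_trans psF (is_class_gl_act ut zX)); first exact: same_class_gl_act.
have zt := is_cocycle_tor j t0 zc.
apply: (same_class_trans psF (z' := CechRep X (act_cochain (tor j t) c))) => //.
  have sub i : sub_region (X i) (fun x => X i (x *m tor j t)).
    move=> x xi; rewrite /coord_locus mulmx_tor; case: (i =P j) => // _.
    by rewrite mulf_neq0.
  have := @same_class_refine k n M _ psF _ (fun i x => X i (x *m tor j t)) _ X id q (act_cochain (tor j t) c) cX sub.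
  suff -> : refine id (act_cochain (tor j t) c) = act_cochain (tor j t) c by [].
  by apply: functional_extensionality => s; congr (act_cochain _ c _); apply/ffunP => i; rewrite ffunE.
apply: (same_class_trans psF (z' := CechRep X c)) => //; last exact: same_class_sym.
apply: same_class_coboundary => //.
exact: (standard_torus_trivial (erefl 0) qe zc j t0).
Qed.

Lemma POmega_gl_triviality q : (0 < n)%N -> (q < n.-1)%N \/ - n%:Z + 1 <= 0 - d%:Z ->
  POmega_gl_trivial n P q.
Proof.
move=> n0 qe g ug; have psF := POmega_presheaf P n 0.
have tor_trivial := POmega_tor_trivial qe.
pose G (g : 'M[k]_n) := g \in unitmx /\ forall z : cech_rep n M q,
  is_class (@POmega_section k n d P 0) z ->
  same_class (@POmega_section k n d P 0) (gl_act g z) z.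
have Gt j t : t != 0 -> G (tor j t).
  by move=> t0; split; [apply: unit_tor | apply: tor_trivial].
suff [] : G g by [].
apply: gl_generated => // [h []//||h h' [uh hz] [uh' h'z]|h h' uh' [uh hz]].
(* The identity is the torus element at t = 1; a coordinate exists since n > 0. *)
- by rewrite -(tor1 k (Ordinal n0)); apply: Gt; apply: oner_neq0.
- split; first by rewrite unitmx_mul uh.
  move=> z zP; rewrite gl_actM; apply: (same_class_trans psF (z' := gl_act h' z)).
  + exact: is_class_gl_act.
  + by apply: hz; apply: is_class_gl_act.
  exact: h'z.
split; first by rewrite !unitmx_mul uh' uh unitmx_inv.
move=> z zP; have ui : invmx h' \in unitmx by rewrite unitmx_inv.
have zi := is_class_gl_act ui zP.
(* z is written as h' applied to h'^-1 z, on which h acts trivially. *)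
rewrite gl_actM gl_actM -[X in same_class _ _ X]gl_act1 -(mulmxV uh') gl_actM.
by apply: same_class_gl_act => //; apply: hz.
Qed.

End Main.

Theorem theorem4p1 (k : closedFieldType) (n d : nat) (n_gt0 : (0 < n)%N)
    (P : poly_functor k d) :
  [/\ forall j : nat, (j < n.-1)%N -> POmega_gl_trivial n P j,
      (d <= n.-1)%N -> POmega_gl_trivial n P n.-1,
      forall e : int, e < 0 ->
        forall j : nat, (j < n.-1)%N -> POmega_cohomology_vanishes n P e j
    & forall e : int, d%:Z - n%:Z + 1 <= e -> e <= -1 ->
        POmega_cohomology_vanishes n P e n.-1].
Proof.
split=> [j jn|dn|e e0 j jn|e de e1].
- by apply: POmega_gl_triviality => //; left.
- by apply: POmega_gl_triviality => //; right; lia.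
- by apply: POmega_vanishing => //; left.
by apply: POmega_vanishing; [lia | right; lia].
Qed.
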